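(* Let $\varphi\colon R\to S$ be a module-finite homomorphism of commutative Noetherian rings such that $\operatorname{fd}_R(S)<\infty$, $\operatorname{Im}(\varphi^* )$ contains $\mathrm{m\text{-}Spec}(R)$, and the induced map $\operatorname{Pic}(\varphi)\colon\operatorname{Pic}(R)\to\operatorname{Pic}(S)$ is injective. If $C,C'$ are semidualizing $R$-complexes such that $\mathbf R\mathrm{Hom}_R(S,C)\simeq\mathbf R\mathrm{Hom}_R(S,C')$ in $\mathsf D(S)$, then $C\simeq C'$ in $\mathsf D(R)$.
   Context: $\mathsf D(R)$ is the derived category of $R$-complexes and $\simeq$ denotes isomorphism in it. An $R$-complex $C$ is semidualizing if its total homology is finitely generated and the homothety morphism $R\to\mathbf R\mathrm{Hom}_R(C,C)$ is an isomorphism in $\mathsf D(R)$. $\varphi$ is module-finite if $S$ is a finitely generated $R$-module; $\mathbf R\mathrm{Hom}_R(S,C)$ is viewed as an $S$-complex. $\varphi^*\colon\operatorname{Spec}(S)\to\operatorname{Spec}(R)$ is the induced map, $\mathrm{m\text{-}Spec}(R)$ the set of maximal ideals of $R$. $\operatorname{Pic}(R)$ is the group of isomorphism classes of finitely generated projective $R$-modules of rank 1 under tensor product, and $\operatorname{Pic}(\varphi)$ sends $[L]$ to $[L\otimes_RS]$. *)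

(* Defs.v *)
From HB Require Import structures.
From mathcomp Require Import all_boot all_algebra.
From mathcomp Require Import boolp ring.
Set Implicit Arguments.
Unset Strict Implicit.
Unset Printing Implicit Defensive.
Import GRing.Theory.
Local Open Scope ring_scope.
Local Open Scope quotient_scope.

(* Rings are [comPzRingType]s, so that the zero ring is allowed.             *)

Record submodule (R : pzRingType) (V : lmodType R) := SubmodulePred {
  submodule_pred :> {pred V};
  submodule_closed : submod_closed submodule_pred
}.
HB.instance Definition _ (R : pzRingType) (V : lmodType R) (W : submodule V) :=
  GRing.isSubmodClosed.Build R V (submodule_pred W)
    (GRing.submod_closed_semi (submodule_closed W)).

Section Constructions.
Variable R : pzRingType.

Definition subm (V : lmodType R) (W : submodule V) := {x : V | x \in W}.
HB.instance Definition _ (V : lmodType R) (W : submodule V) :=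
  SubChoice.on (subm W).
HB.instance Definition _ (V : lmodType R) (W : submodule V) :=
  [SubChoice_isSubLmodule of subm W by <:].

Section Quotient.
Variables (V : lmodType R) (W : submodule V).

Definition quotm := {ideal_quot (submodule_pred W)}.
HB.instance Definition _ := GRing.Zmodule.on quotm.
Definition quotm_pi (x : V) : quotm := \pi_{ideal_quot (submodule_pred W)} x.
Definition quotm_repr (q : quotm) : V := repr (q : {ideal_quot (submodule_pred W)}).

Lemma quotm_reprK q : quotm_pi (quotm_repr q) = q.
Proof. exact: (@reprK _ {ideal_quot (submodule_pred W)}). Qed.

Lemma quotm_piP x y : quotm_pi x = quotm_pi y <-> x - y \in W.
Proof. by rewrite Quotient.idealrBE; split=> /eqP. Qed.

Fact quotm_piB : zmod_morphism quotm_pi.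
Proof.
move=> x y; rewrite /quotm_pi Quotient.pi_add; congr (_ + _).
exact: Quotient.pi_opp.
Qed.

Definition quotm_scale (a : R) (q : quotm) := quotm_pi (a *: quotm_repr q).

Lemma quotm_scaleE a x : quotm_scale a (quotm_pi x) = quotm_pi (a *: x).
Proof.
by apply/quotm_piP; rewrite -scalerBr rpredZ //; apply/quotm_piP/quotm_reprK.
Qed.

Fact quotm_scaleA a b q :
  quotm_scale a (quotm_scale b q) = quotm_scale (a * b) q.
Proof. by rewrite -(quotm_reprK q) !quotm_scaleE scalerA. Qed.

Fact quotm_scale1 : left_id 1 quotm_scale.
Proof. by move=> q; rewrite -(quotm_reprK q) quotm_scaleE scale1r. Qed.

Lemma quotm_piD x y : quotm_pi (x + y) = quotm_pi x + quotm_pi y.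
Proof. exact: Quotient.pi_add. Qed.

Fact quotm_scaleDr : right_distributive quotm_scale +%R.
Proof.
move=> a q r; rewrite -(quotm_reprK q) -(quotm_reprK r) -quotm_piD.
by rewrite !quotm_scaleE scalerDr quotm_piD.
Qed.

Fact quotm_scaleDl q : {morph quotm_scale^~ q : a b / a + b}.
Proof.
by move=> a b; rewrite -(quotm_reprK q) !quotm_scaleE scalerDl quotm_piD.
Qed.

HB.instance Definition _ := GRing.Zmodule_isLmodule.Build R quotm
  quotm_scaleA quotm_scale1 quotm_scaleDr quotm_scaleDl.

Fact quotm_pi_is_linear : linear quotm_pi.
Proof. by move=> a x y; rewrite quotm_piD -quotm_scaleE. Qed.
HB.instance Definition _ :=
  GRing.isLinear.Build R V quotm *:%R quotm_pi quotm_pi_is_linear.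

End Quotient.

Section Product.
Variables (I : Type) (M : I -> lmodType R).

Definition prodm := forall i, M i.
HB.instance Definition _ := gen_eqMixin prodm.
HB.instance Definition _ := gen_choiceMixin prodm.

Let extp (f g : prodm) : (forall i, f i = g i) -> f = g.
Proof. exact: functional_extensionality_dep. Qed.

Fact prodm_addA : associative (fun f g : prodm => (fun i => f i + g i) : prodm).
Proof. by move=> f g h; apply: extp => i; rewrite addrA. Qed.
Fact prodm_addC : commutative (fun f g : prodm => (fun i => f i + g i) : prodm).
Proof. by move=> f g; apply: extp => i; rewrite addrC. Qed.
Fact prodm_add0 : left_id ((fun i => 0) : prodm)
  (fun f g : prodm => (fun i => f i + g i) : prodm).
Proof. by move=> f; apply: extp => i; rewrite add0r. Qed.
Fact prodm_addN : left_inverse ((fun i => 0) : prodm)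
  (fun f : prodm => (fun i => - f i) : prodm)
  (fun f g : prodm => (fun i => f i + g i) : prodm).
Proof. by move=> f; apply: extp => i; rewrite addNr. Qed.
HB.instance Definition _ :=
  GRing.isZmodule.Build prodm prodm_addA prodm_addC prodm_add0 prodm_addN.

Definition prodm_scale (a : R) (f : prodm) : prodm := fun i => a *: f i.
Fact prodm_scaleA a b f :
  prodm_scale a (prodm_scale b f) = prodm_scale (a * b) f.
Proof. by apply: extp => i; rewrite /prodm_scale scalerA. Qed.
Fact prodm_scale1 : left_id 1 prodm_scale.
Proof. by move=> f; apply: extp => i; rewrite /prodm_scale scale1r. Qed.
Fact prodm_scaleDr : right_distributive prodm_scale +%R.
Proof. by move=> a f g; apply: extp => i; rewrite /prodm_scale scalerDr. Qed.
Fact prodm_scaleDl f : {morph prodm_scale^~ f : a b / a + b}.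
Proof. by move=> a b; apply: extp => i; rewrite /prodm_scale scalerDl. Qed.
HB.instance Definition _ := GRing.Zmodule_isLmodule.Build R prodm
  prodm_scaleA prodm_scale1 prodm_scaleDr prodm_scaleDl.

End Product.

Definition mod_iso (M N : lmodType R) :=
  exists f : {linear M -> N}, bijective f.

Definition fin_gen (M : lmodType R) :=
  exists (n : nat) (e : 'I_n -> M),
    forall x, exists c : 'I_n -> R, x = \sum_i c i *: e i.

Definition projective (P : lmodType R) :=
  forall (M N : lmodType R) (g : {linear M -> N}) (f : {linear P -> N}),
    (forall y, exists x, g x = y) -> exists h : {linear P -> M}, g \o h =1 f.

Definition noetherian := forall I : submodule R^o, fin_gen (subm I).

End Constructions.

Definition res (R S : comPzRingType) (phi : {rmorphism R -> S})
  (M : lmodType S) : Type := M.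

Section Restriction.
Variables (R S : comPzRingType) (phi : {rmorphism R -> S}).

Section Res.
Variable M : lmodType S.

Local Notation res := (res phi M).
HB.instance Definition _ := GRing.Zmodule.on res.
Definition res_scale (r : R) (x : res) : res := phi r *: (x : M).
Fact res_scaleA a b x : res_scale a (res_scale b x) = res_scale (a * b) x.
Proof. by rewrite /res_scale scalerA rmorphM. Qed.
Fact res_scale1 : left_id 1 res_scale.
Proof. by move=> x; rewrite /res_scale rmorph1 scale1r. Qed.
Fact res_scaleDr : right_distributive res_scale +%R.
Proof. by move=> a x y; rewrite /res_scale scalerDr. Qed.
Fact res_scaleDl x : {morph res_scale^~ x : a b / a + b}.
Proof. by move=> a b; rewrite /res_scale rmorphD scalerDl. Qed.
HB.instance Definition _ := GRing.Zmodule_isLmodule.Build R res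
  res_scaleA res_scale1 res_scaleDr res_scaleDl.
End Res.

Definition module_finite := fin_gen (res phi S^o).

(* [homm M N] is Hom_R(M, N) for an S-module M and an R-module N, with the   *)
(* S-module structure (s f)(x) = f (s x).                                    *)
Section Hom.
Variables (M : lmodType S) (N : lmodType R).

Definition homm := {f : res phi M -> N | linear f}.
HB.instance Definition _ := gen_eqMixin homm.
HB.instance Definition _ := gen_choiceMixin homm.
Definition homm_fun (f : homm) : M -> N := sval f.
Coercion homm_fun : homm >-> Funclass.

Lemma hommP (f g : homm) : (forall x, f x = g x) -> f = g.
Proof. by move: f g => [f lf] [g lg] fg; apply/eq_exist/funext. Qed.

Lemma homm_lin (f : homm) r x y : f (phi r *: x + y) = r *: f x + f y.
Proof. exact: (svalP f). Qed.
Lemma hommD (f : homm) x y : f (x + y) = f x + f y.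
Proof. by rewrite -[x in LHS]scale1r -(rmorph1 phi) homm_lin scale1r. Qed.
Lemma homm0 (f : homm) : f 0 = 0.
Proof. by apply: (addrI (f 0)); rewrite -hommD !addr0. Qed.
Lemma hommZ (f : homm) r x : f (phi r *: x) = r *: f x.
Proof. by rewrite -[in LHS](addr0 (_ *: _)) homm_lin homm0 addr0. Qed.

Fact homm_add_lin (f g : homm) : linear ((fun x => f x + g x) : res phi M -> N).
Proof.
by move=> r x y /=; rewrite !homm_lin scalerDr addrACA.
Qed.
Definition homm_add f g : homm := exist _ _ (homm_add_lin f g).
Fact homm_opp_lin (f : homm) : linear ((fun x => - f x) : res phi M -> N).
Proof. by move=> r x y /=; rewrite homm_lin opprD scalerN. Qed.
Definition homm_opp f : homm := exist _ _ (homm_opp_lin f).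
Fact homm_zero_lin : linear ((fun _ => 0) : res phi M -> N).
Proof. by move=> r x y /=; rewrite scaler0 addr0. Qed.
Definition homm_zero : homm := exist _ _ homm_zero_lin.

Fact homm_addA : associative homm_add.
Proof. by move=> f g h; apply: hommP => x; apply: addrA. Qed.
Fact homm_addC : commutative homm_add.
Proof. by move=> f g; apply: hommP => x; apply: addrC. Qed.
Fact homm_add0 : left_id homm_zero homm_add.
Proof. by move=> f; apply: hommP => x; apply: add0r. Qed.
Fact homm_addN : left_inverse homm_zero homm_opp homm_add.
Proof. by move=> f; apply: hommP => x; apply: addNr. Qed.
HB.instance Definition _ :=
  GRing.isZmodule.Build homm homm_addA homm_addC homm_add0 homm_addN.

Fact homm_scale_lin (s : S) (f : homm) :
  linear ((fun x => f (s *: x)) : res phi M -> N).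
Proof.
move=> r x y; rewrite -homm_lin scalerDr; congr (f (_ + _)).
by rewrite !scalerA mulrC.
Qed.
Definition homm_scale s f : homm := exist _ _ (homm_scale_lin s f).
Fact homm_scaleA a b f : homm_scale a (homm_scale b f) = homm_scale (a * b) f.
Proof. by apply: hommP => x /=; rewrite /homm_fun /= scalerA mulrC. Qed.
Fact homm_scale1 : left_id 1 homm_scale.
Proof. by move=> f; apply: hommP => x; rewrite /homm_fun /= scale1r. Qed.
Fact homm_scaleDr : right_distributive homm_scale +%R.
Proof. by move=> a f g; apply: hommP => x. Qed.
Fact homm_scaleDl f : {morph homm_scale^~ f : a b / a + b}.
Proof.
by move=> a b; apply: hommP => x; rewrite {1}/homm_fun /= scalerDl hommD.
Qed.
HB.instance Definition _ := GRing.Zmodule_isLmodule.Build S homm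
  homm_scaleA homm_scale1 homm_scaleDr homm_scaleDl.

Lemma homm_addE (f g : homm) x : homm_fun (f + g) x = f x + g x. Proof. by []. Qed.
Lemma homm_oppE (f : homm) x : homm_fun (- f) x = - f x. Proof. by []. Qed.
Lemma homm_scaleE s (f : homm) x : homm_fun (s *: f) x = f (s *: x). Proof. by []. Qed.
Lemma homm_zeroE x : homm_fun 0 x = 0. Proof. by []. Qed.

End Hom.

Section Functoriality.
Variables (M M' : lmodType S) (N N' : lmodType R).

Fact homm_post_lin (g : {linear N -> N'}) (f : homm M N) :
  linear ((fun x => g (f x)) : res phi M -> N').
Proof. by move=> r x y; rewrite homm_lin linearP. Qed.
Definition homm_post g f : homm M N' := exist _ _ (homm_post_lin g f).
Fact homm_post_is_linear g : linear (homm_post g).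
Proof.
by move=> s f h; apply: hommP => x; apply: (linearD g).
Qed.
HB.instance Definition _ g :=
  GRing.isLinear.Build S (homm M N) (homm M N') *:%R (homm_post g)
    (homm_post_is_linear g).

Fact homm_pre_lin (g : {linear M' -> M}) (f : homm M N) :
  linear ((fun x => f (g x)) : res phi M' -> N).
Proof. by move=> r x y; rewrite -homm_lin linearP. Qed.
Definition homm_pre g f : homm M' N := exist _ _ (homm_pre_lin g f).
Fact homm_pre_is_linear g : linear (homm_pre g).
Proof.
move=> s f h; apply: hommP => x.
rewrite -[LHS]/(homm_fun f (s *: g x) + homm_fun h (g x)).
by rewrite -linearZ.
Qed.
HB.instance Definition _ g :=
  GRing.isLinear.Build S (homm M N) (homm M' N) *:%R (homm_pre g)
    (homm_pre_is_linear g).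
End Functoriality.

End Restriction.

(* [tensor phi M N] is the S-module M (x)_R N for an R-module M and an       *)
(* S-module N: the quotient of the free commutative monoid [seq (M * N)] by  *)
(* the bilinearity relations.  [tens_zero] makes (- m, n) an opposite of     *)
(* (m, n), so that this quotient is a group.                                 *)
Section Tensor.
Variables (R S : comPzRingType) (phi : {rmorphism R -> S}).
Variables (M : lmodType R) (N : lmodType S).
Implicit Types s t : seq (M * N).

Inductive tens_eq : seq (M * N) -> seq (M * N) -> Prop :=
| tens_refl s : tens_eq s s
| tens_sym s t : tens_eq s t -> tens_eq t s
| tens_trans s t u : tens_eq s t -> tens_eq t u -> tens_eq s u
| tens_cat s s' t t' :
    tens_eq s s' -> tens_eq t t' -> tens_eq (s ++ t) (s' ++ t')
| tens_comm s t : tens_eq (s ++ t) (t ++ s)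
| tens_zero n : tens_eq [:: (0, n)] [::]
| tens_addl m m' n : tens_eq [:: (m + m', n)] [:: (m, n); (m', n)]
| tens_addr m n n' : tens_eq [:: (m, n + n')] [:: (m, n); (m, n')]
| tens_bal r m n : tens_eq [:: (r *: m, n)] [:: (m, phi r *: n)].

Definition tens_rel : rel (seq (M * N)) := fun s t => `[< tens_eq s t >].

Fact tens_rel_equiv : equiv_class_of tens_rel.
Proof.
split=> [s|s t|t s u].
- exact/asboolP/tens_refl.
- by apply/asboolP/asboolP; apply: tens_sym.
- by move=> /asboolP st /asboolP tu; apply/asboolP/(tens_trans st tu).
Qed.
Canonical tens_equiv := EquivRelPack tens_rel_equiv.

Definition tensor := {eq_quot tens_rel}.
HB.instance Definition _ := Choice.on tensor.

Definition tens_pi s : tensor := \pi_{eq_quot tens_rel} s.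
Definition tens_repr (x : tensor) := repr (x : {eq_quot tens_rel}).
Definition pure m n : tensor := tens_pi [:: (m, n)].

Lemma tens_reprK x : tens_pi (tens_repr x) = x.
Proof. exact: (@reprK _ {eq_quot tens_rel}). Qed.

Lemma tens_piP s t : tens_pi s = tens_pi t <-> tens_eq s t.
Proof.
split=> [/eqP|st]; last by apply/eqmodP/asboolP.
by move/eqP/eqmodP/asboolP.
Qed.

Lemma tens_pi_repr s : tens_eq (tens_repr (tens_pi s)) s.
Proof. by apply/tens_piP; rewrite tens_reprK. Qed.

Lemma tens_eq_map (f : M * N -> M * N) :
    (forall n, tens_eq [:: f (0, n)] [::]) ->
    (forall m m' n, tens_eq [:: f (m + m', n)] [:: f (m, n); f (m', n)]) ->
    (forall m n n', tens_eq [:: f (m, n + n')] [:: f (m, n); f (m, n')]) ->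
    (forall r m n, tens_eq [:: f (r *: m, n)] [:: f (m, phi r *: n)]) ->
  forall s t, tens_eq s t -> tens_eq (map f s) (map f t).
Proof.
move=> f0 fl fr fb s t; elim=> //= {s t}.
- by move=> s; apply: tens_refl.
- by move=> s t _; apply: tens_sym.
- by move=> s t u _ st _; apply: tens_trans.
- by move=> s s' t t' _ ss' _ tt'; rewrite !map_cat; apply: tens_cat.
- by move=> s t; rewrite !map_cat; apply: tens_comm.
Qed.

Definition tens_add (x y : tensor) := tens_pi (tens_repr x ++ tens_repr y).
Definition tens_neg (p : M * N) := (- p.1, p.2).
Definition tens_opp (x : tensor) := tens_pi (map tens_neg (tens_repr x)).
Definition tens_act (a : S) (p : M * N) := (p.1, a *: p.2).
Definition tens_scale (a : S) (x : tensor) :=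
  tens_pi (map (tens_act a) (tens_repr x)).

Lemma tens_addE s t : tens_add (tens_pi s) (tens_pi t) = tens_pi (s ++ t).
Proof. by apply/tens_piP/tens_cat; apply: tens_pi_repr. Qed.

Lemma tens_eq_neg s t : tens_eq s t -> tens_eq (map tens_neg s) (map tens_neg t).
Proof.
apply: tens_eq_map => [n|m m' n|m n n'|r m n]; rewrite /tens_neg /=.
- rewrite oppr0; exact: tens_zero.
- rewrite opprD; exact: tens_addl.
- exact: tens_addr.
- rewrite -scalerN; exact: tens_bal.
Qed.

Lemma tens_oppE s : tens_opp (tens_pi s) = tens_pi (map tens_neg s).
Proof. by apply/tens_piP/tens_eq_neg/tens_pi_repr. Qed.

Lemma tens_eq_act a s t :
  tens_eq s t -> tens_eq (map (tens_act a) s) (map (tens_act a) t).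
Proof.
apply: tens_eq_map => [n|m m' n|m n n'|r m n]; rewrite /tens_act /=.
- exact: tens_zero.
- exact: tens_addl.
- rewrite scalerDr; exact: tens_addr.
- rewrite scalerA mulrC -scalerA; exact: tens_bal.
Qed.

Lemma tens_scaleE a s : tens_scale a (tens_pi s) = tens_pi (map (tens_act a) s).
Proof. by apply/tens_piP/tens_eq_act/tens_pi_repr. Qed.

Fact tens_addA : associative tens_add.
Proof.
move=> x y z; rewrite -(tens_reprK x) -(tens_reprK y) -(tens_reprK z).
by rewrite !tens_addE catA.
Qed.
Fact tens_addC : commutative tens_add.
Proof. by move=> x y; apply/tens_piP/tens_comm. Qed.
Fact tens_add0 : left_id (tens_pi [::]) tens_add.
Proof. by move=> x; rewrite -(tens_reprK x) tens_addE. Qed.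
Fact tens_addN : left_inverse (tens_pi [::]) tens_opp tens_add.
Proof.
move=> x; rewrite -(tens_reprK x) tens_oppE tens_addE.
apply/tens_piP; elim: (tens_repr x) => [|[m n] s IHs]; first exact: tens_refl.
have cancel_mn : tens_eq [:: (- m, n); (m, n)] [::].
  have := tens_addl (- m) m n; rewrite addNr => e.
  exact: tens_trans (tens_sym e) (tens_zero n).
have step1 : tens_eq (map tens_neg s ++ [:: (m, n)] ++ s)
    ([:: (m, n)] ++ map tens_neg s ++ s).
  by rewrite !catA; apply: tens_cat (tens_comm _ _) (tens_refl _).
apply: tens_trans (tens_cat (tens_refl [:: (- m, n)]) step1) _.
apply: tens_trans (tens_cat cancel_mn (tens_refl (map tens_neg s ++ s))) _.
exact: IHs.
Qed.
HB.instance Definition _ :=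
  GRing.isZmodule.Build tensor tens_addA tens_addC tens_add0 tens_addN.

Lemma tens_piD s t : tens_pi (s ++ t) = tens_pi s + tens_pi t.
Proof. exact/esym/tens_addE. Qed.

Fact tens_scaleA a b x : tens_scale a (tens_scale b x) = tens_scale (a * b) x.
Proof.
rewrite -(tens_reprK x) !tens_scaleE -map_comp.
by congr tens_pi; apply: eq_map => -[m n]; rewrite /tens_act /= scalerA.
Qed.
Fact tens_scale1 : left_id 1 tens_scale.
Proof.
move=> x; rewrite -[RHS]tens_reprK /tens_scale; congr tens_pi.
by rewrite -[RHS]map_id; apply: eq_map => -[m n]; rewrite /tens_act scale1r.
Qed.
Fact tens_scaleDr : right_distributive tens_scale +%R.
Proof.
move=> a x y; rewrite -(tens_reprK x) -(tens_reprK y) -tens_piD !tens_scaleE.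
by rewrite map_cat tens_piD.
Qed.
Fact tens_scaleDl x : {morph tens_scale^~ x : a b / a + b}.
Proof.
move=> a b; rewrite -(tens_reprK x) !tens_scaleE.
elim: (tens_repr x) => [|[m n] s IHs]; first exact/esym/addr0.
rewrite -[LHS]/(tens_pi ([:: (m, (a + b) *: n)] ++ map (tens_act (a + b)) s)).
rewrite tens_piD IHs scalerDl.
have -> : tens_pi [:: (m, a *: n + b *: n)]
    = tens_pi [:: (m, a *: n)] + tens_pi [:: (m, b *: n)].
  by rewrite -tens_piD; apply/tens_piP/tens_addr.
by rewrite addrACA; congr (_ + _); exact: (esym (tens_piD [:: _] _)).
Qed.
HB.instance Definition _ := GRing.Zmodule_isLmodule.Build S tensor
  tens_scaleA tens_scale1 tens_scaleDr tens_scaleDl.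

End Tensor.

Definition tensor_map (R S : comPzRingType) (phi : {rmorphism R -> S})
    (M : lmodType R) (N N' : lmodType S) (f : N -> N')
    (x : tensor phi M N) : tensor phi M N' :=
  tens_pi phi [seq (p.1, f p.2) | p <- tens_repr x].

Lemma tensor_mapE (R S : comPzRingType) (phi : {rmorphism R -> S})
    (M : lmodType R) (N N' : lmodType S) (f : {linear N -> N'}) s :
  tensor_map f (tens_pi phi s) = tens_pi phi [seq ((p.1 : M), f p.2) | p <- s].
Proof.
apply/tens_piP; have := tens_pi_repr phi s.
move: (tens_repr _) => t; elim=> //= {s t}.
- by move=> s; apply: tens_refl.
- by move=> s t _; apply: tens_sym.
- by move=> s t u _ st _; apply: tens_trans.
- by move=> s s' t t' _ ss' _ tt'; rewrite !map_cat; apply: tens_cat.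
- by move=> s t; rewrite !map_cat; apply: tens_comm.
- by move=> n; apply: tens_zero.
- by move=> m m' n; apply: tens_addl.
- by move=> m n n'; rewrite linearD; apply: tens_addr.
- by move=> r m n; rewrite linearZ; apply: tens_bal.
Qed.

Definition flat (R : comPzRingType) (F : lmodType R) :=
  forall (M N : lmodType R) (f : {linear M -> N}), injective f ->
    injective (@tensor_map R R idfun F M N f).

Section Spec.
Variable R : comPzRingType.

Record spec := Spec {
  prime_ideal :> submodule R^o;
  prime_ideal1 : (1 : R) \notin prime_ideal;
  prime_idealM : forall x y : R,
    x * y \in prime_ideal -> x \in prime_ideal \/ y \in prime_ideal
}.

Definition maximal_ideal (m : submodule R^o) :=
  (1 : R) \notin m /\
  forall J : submodule R^o,
    {subset m <= J} -> (1 : R) \notin J -> {subset J <= m}.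
End Spec.

(* Im(phi^* ) contains m-Spec(R), where phi^*(q) is the preimage of q. *)
Definition comap_hits_maximal (R S : comPzRingType) (phi : {rmorphism R -> S}) :=
  forall m : submodule R^o, maximal_ideal m ->
    exists q : spec S, forall x : R, (x \in m) = (phi x \in q).

Section Localization.
Variables (R : comPzRingType) (p : spec R).

Definition denom := {x : R | x \notin p}.
Definition den (s : denom) : R := sval s.

Definition denom1 : denom :=
  exist (fun x => is_true (x \notin p)) 1 (prime_ideal1 p).
Fact denomM_subproof (s t : denom) : den s * den t \notin p.
Proof.
by apply/negP => /prime_idealM[]; apply/negP; [exact: (svalP s)|exact: (svalP t)].
Qed.
Definition denomM (s t : denom) : denom :=
  exist (fun x => is_true (x \notin p)) _ (denomM_subproof s t).

Lemma den1 : den denom1 = 1. Proof. by []. Qed.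
Lemma denM s t : den (denomM s t) = den s * den t. Proof. by []. Qed.
Local Arguments den : simpl never.

Definition frac := (R * denom)%type.

Definition frac_rel : rel frac := fun x y =>
  `[< exists u : denom, den u * (x.1 * den y.2 - y.1 * den x.2) = 0 >].

Fact frac_rel_equiv : equiv_class_of frac_rel.
Proof.
split=> [x|x y|y x z].
- by apply/asboolP; exists denom1; rewrite subrr mulr0.
- by apply/asboolP/asboolP => -[u e]; exists u; rewrite -[RHS]oppr0 -e; ring.
- move=> /asboolP[u e] /asboolP[v f]; apply/asboolP.
  exists (denomM (denomM u v) y.2) => /=; rewrite !denM.
  transitivity (den v * den z.2 * (den u * (x.1 * den y.2 - y.1 * den x.2))
    + den u * den x.2 * (den v * (y.1 * den z.2 - z.1 * den y.2))).
    by ring.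
  by rewrite e f !mulr0 addr0.
Qed.
Canonical frac_equiv := EquivRelPack frac_rel_equiv.

Definition loc := {eq_quot frac_rel}.
HB.instance Definition _ := Choice.on loc.

Definition loc_pi (x : frac) : loc := \pi_{eq_quot frac_rel} x.
Definition loc_repr (x : loc) : frac := repr (x : {eq_quot frac_rel}).

Lemma loc_reprK x : loc_pi (loc_repr x) = x.
Proof. exact: (@reprK _ {eq_quot frac_rel}). Qed.

Lemma loc_piP x y : loc_pi x = loc_pi y <->
  exists u : denom, den u * (x.1 * den y.2 - y.1 * den x.2) = 0.
Proof.
split=> [/eqP|xy]; last by apply/eqmodP/asboolP.
by move/eqP/eqmodP/asboolP.
Qed.

Definition loc_add (x y : loc) := let x := loc_repr x in let y := loc_repr y in
  loc_pi (x.1 * den y.2 + y.1 * den x.2, denomM x.2 y.2).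
Definition loc_opp (x : loc) := loc_pi (- (loc_repr x).1, (loc_repr x).2).
Definition loc_mul (x y : loc) := let x := loc_repr x in let y := loc_repr y in
  loc_pi (x.1 * y.1, denomM x.2 y.2).

Lemma loc_pi_repr x :
  exists u : denom, den u * ((loc_repr (loc_pi x)).1 * den x.2
                             - x.1 * den (loc_repr (loc_pi x)).2) = 0.
Proof. by apply/loc_piP; rewrite loc_reprK. Qed.

Lemma loc_addE x y : loc_add (loc_pi x) (loc_pi y) =
  loc_pi (x.1 * den y.2 + y.1 * den x.2, denomM x.2 y.2).
Proof.
rewrite /loc_add; have [u e] := loc_pi_repr x; have [v f] := loc_pi_repr y.
move: (loc_repr _) (loc_repr _) e f => y' x' e f.
apply/loc_piP; exists (denomM u v) => /=; rewrite !denM.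
transitivity (den v * den y.2 * den y'.2
      * (den u * (x'.1 * den x.2 - x.1 * den x'.2))
    + den u * den x.2 * den x'.2
      * (den v * (y'.1 * den y.2 - y.1 * den y'.2))); first by ring.
by rewrite e f !mulr0 addr0.
Qed.

Lemma loc_oppE x : loc_opp (loc_pi x) = loc_pi (- x.1, x.2).
Proof.
rewrite /loc_opp; have [u e] := loc_pi_repr x; move: (loc_repr _) e => x' e.
apply/loc_piP; exists u => /=; rewrite -[RHS]oppr0 -e; ring.
Qed.

Lemma loc_mulE x y :
  loc_mul (loc_pi x) (loc_pi y) = loc_pi (x.1 * y.1, denomM x.2 y.2).
Proof.
rewrite /loc_mul; have [u e] := loc_pi_repr x; have [v f] := loc_pi_repr y.
move: (loc_repr _) (loc_repr _) e f => y' x' e f.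
apply/loc_piP; exists (denomM u v) => /=; rewrite !denM.
transitivity (den v * y'.1 * den y.2
      * (den u * (x'.1 * den x.2 - x.1 * den x'.2))
    + den u * x.1 * den x'.2
      * (den v * (y'.1 * den y.2 - y.1 * den y'.2))); first by ring.
by rewrite e f !mulr0 addr0.
Qed.

Lemma loc_pi_eq x y : x.1 * den y.2 = y.1 * den x.2 -> loc_pi x = loc_pi y.
Proof. by move=> e; apply/loc_piP; exists denom1; rewrite e subrr mulr0. Qed.

Fact loc_addA : associative loc_add.
Proof.
move=> x y z; rewrite -(loc_reprK x) -(loc_reprK y) -(loc_reprK z) !loc_addE.
by apply: loc_pi_eq => /=; rewrite ?denM ?den1; ring.
Qed.
Fact loc_addC : commutative loc_add.
Proof. by move=> x y; apply: loc_pi_eq => /=; rewrite ?denM ?den1; ring. Qed.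
Fact loc_add0 : left_id (loc_pi (0, denom1)) loc_add.
Proof.
move=> x; rewrite -(loc_reprK x) loc_addE.
by apply: loc_pi_eq => /=; rewrite ?denM ?den1; ring.
Qed.
Fact loc_addN : left_inverse (loc_pi (0, denom1)) loc_opp loc_add.
Proof.
move=> x; rewrite -(loc_reprK x) loc_oppE loc_addE.
by apply: loc_pi_eq => /=; rewrite ?denM ?den1; ring.
Qed.
HB.instance Definition _ :=
  GRing.isZmodule.Build loc loc_addA loc_addC loc_add0 loc_addN.

Lemma loc_piD x y : loc_pi x + loc_pi y =
  loc_pi (x.1 * den y.2 + y.1 * den x.2, denomM x.2 y.2).
Proof. exact: loc_addE. Qed.

Fact loc_mulA : associative loc_mul.
Proof.
move=> x y z; rewrite -(loc_reprK x) -(loc_reprK y) -(loc_reprK z) !loc_mulE.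
by apply: loc_pi_eq => /=; rewrite ?denM ?den1; ring.
Qed.
Fact loc_mulC : commutative loc_mul.
Proof. by move=> x y; apply: loc_pi_eq => /=; rewrite ?denM ?den1; ring. Qed.
Fact loc_mul1 : left_id (loc_pi (1, denom1)) loc_mul.
Proof.
by move=> x; rewrite -(loc_reprK x) loc_mulE; apply: loc_pi_eq => /=; rewrite ?denM ?den1; ring.
Qed.
Fact loc_mulDl : left_distributive loc_mul +%R.
Proof.
move=> x y z; rewrite -(loc_reprK x) -(loc_reprK y) -(loc_reprK z).
by rewrite loc_piD !loc_mulE loc_piD; apply: loc_pi_eq => /=; rewrite ?denM ?den1; ring.
Qed.
HB.instance Definition _ := GRing.Zmodule_isComPzRing.Build loc
  loc_mulA loc_mulC loc_mul1 loc_mulDl.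

Definition loc_map (a : R) : loc := loc_pi (a, denom1).

Fact loc_map_is_zmod_morphism : zmod_morphism loc_map.
Proof.
move=> a b; rewrite /loc_map -[- loc_pi _]/(loc_opp _) loc_oppE loc_piD.
by apply: loc_pi_eq => /=; rewrite ?denM ?den1; ring.
Qed.
HB.instance Definition _ :=
  GRing.isZmodMorphism.Build R loc loc_map loc_map_is_zmod_morphism.

Fact loc_map_is_monoid_morphism : monoid_morphism loc_map.
Proof.
split=> // a b; apply: (etrans _ (esym (loc_mulE _ _))).
by apply: loc_pi_eq => /=; rewrite ?denM ?den1; ring.
Qed.
HB.instance Definition _ :=
  GRing.isMonoidMorphism.Build R loc loc_map loc_map_is_monoid_morphism.

End Localization.

(* L_p, written as L (x)_R R_p, is free of rank 1 over R_p for every prime p. *)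
Definition rank_one (R : comPzRingType) (L : lmodType R) :=
  forall p : spec R,
    @mod_iso (loc p) (tensor (@loc_map R p) L (loc p)^o) (loc p)^o.

Record line_bundle (R : comPzRingType) := LineBundle {
  line_mod :> lmodType R;
  line_fin_gen : fin_gen line_mod;
  line_projective : projective line_mod;
  line_rank_one : rank_one line_mod
}.

(* Injectivity of [L] |-> [L (x)_R S] on isomorphism classes. *)
Definition Pic_injective (R S : comPzRingType) (phi : {rmorphism R -> S}) :=
  forall L L' : line_bundle R,
    mod_iso (tensor phi L S^o) (tensor phi L' S^o) -> mod_iso L L'.

(* Homological grading: the differential has components [dif i j], which     *)
(* vanish unless i = j + 1.                                                  *)
Record complex (R : pzRingType) := Complex {
  obj :> int -> lmodType R;
  dif : forall i j, {linear obj i -> obj j};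
  dif_shape : forall i j, i != j + 1 -> forall x, dif i j x = 0;
  dif_dif : forall i j k x, dif j k (dif i j x) = 0
}.

Record chain_map (R : pzRingType) (C D : complex R) := ChainMap {
  chain_fun :> forall i, {linear C i -> D i};
  chain_comm : forall i j x, dif D i j (chain_fun i x) = chain_fun j (dif C i j x)
}.

Section Homology.
Variable R : pzRingType.

Section Object.
Variables (C : complex R) (i : int).

Definition cycle_pred : {pred C i} := [pred x | dif C i (i - 1) x == 0].
Fact cycle_closed : submod_closed cycle_pred.
Proof.
split=> [|a x y /eqP x0 /eqP y0]; apply/eqP; first exact: linear0.
by rewrite linearP x0 y0 scaler0 addr0.
Qed.
Definition cycles : submodule (C i) := SubmodulePred cycle_closed.

Definition boundary_pred : {pred subm cycles} :=
  [pred z | `[< exists y, val z = dif C (i + 1) i y >]].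
Fact boundary_closed : submod_closed boundary_pred.
Proof.
split=> [|a x y /asboolP[x' xE] /asboolP[y' yE]]; apply/asboolP.
  by exists 0; rewrite linear0.
by exists (a *: x' + y'); rewrite linearP /= xE yE.
Qed.
Definition boundaries : submodule (subm cycles) := SubmodulePred boundary_closed.

Definition homology := quotm boundaries.
HB.instance Definition _ := GRing.Lmodule.on homology.
End Object.

Definition acyclic (C : complex R) := forall i (h : homology C i), h = 0.

(* The families of finite support: \bigoplus_i H_i(C). *)
Definition total_homology_pred (C : complex R) : {pred prodm (homology C)} :=
  [pred h | `[< exists s : seq int, forall i, i \notin s -> h i = 0 >]].
Fact total_homology_closed C : submod_closed (@total_homology_pred C).
Proof.
split=> [|a x y /asboolP[s xs] /asboolP[t yt]]; apply/asboolP.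
  by exists [::].
exists (s ++ t) => i; rewrite mem_cat negb_or => /andP[/xs xi0 /yt yi0].
by rewrite -[LHS]/(a *: x i + y i) xi0 yi0 scaler0 addr0.
Qed.
Definition total_homology (C : complex R) :=
  subm (SubmodulePred (@total_homology_closed C)).
HB.instance Definition _ C := GRing.Lmodule.on (total_homology C).

Section Map.
Variables (C D : complex R) (f : chain_map C D) (i : int).

Fact cycle_map_subproof (z : subm (cycles C i)) : f i (val z) \in cycles D i.
Proof. by apply/eqP; rewrite chain_comm (eqP (valP z)) linear0. Qed.
Definition cycle_map (z : subm (cycles C i)) : subm (cycles D i) :=
  Sub (f i (val z)) (cycle_map_subproof z).

Definition homology_map (h : homology C i) : homology D i :=
  quotm_pi (boundaries D i) (cycle_map (quotm_repr h)).

Lemma homology_mapE (z : subm (cycles C i)) :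
  homology_map (quotm_pi (boundaries C i) z) =
  quotm_pi (boundaries D i) (cycle_map z).
Proof.
apply/quotm_piP/asboolP.
have /quotm_piP/asboolP[y yE] := quotm_reprK (quotm_pi (boundaries C i) z).
by exists (f (i + 1) y); rewrite chain_comm -yE /= linearB.
Qed.
End Map.

Definition quasi_iso (C D : complex R) (f : chain_map C D) :=
  forall i, bijective (homology_map f (i := i)).

(* Isomorphism in D(R): every morphism of D(R) is a roof C <- X -> D whose   *)
(* left leg is a quasi-isomorphism, and it is an isomorphism if and only if  *)
(* the right leg is one too.                                                 *)
Definition derived_iso (C D : complex R) :=
  exists (X : complex R) (f : chain_map X C) (g : chain_map X D),
    quasi_iso f /\ quasi_iso g.

End Homology.

Section Concentrated.
Variables (R : pzRingType) (M : lmodType R).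

Definition conc_obj (i : int) : lmodType R :=
  if i is Posz 0 then M else 'rV[R]_0.
Definition conc_dif (i j : int) : {linear conc_obj i -> conc_obj j} := \0.

Definition concentrated : complex R :=
  @Complex R conc_obj conc_dif (fun _ _ _ _ => erefl) (fun _ _ _ _ => erefl).
End Concentrated.

(* [homC phi X Y] is Hom_R(X, Y) for an S-complex X and an R-complex Y, with *)
(* the S-structure of [homm].  Its elements of degree n are the families     *)
(* f i j : X_i -> Y_j that vanish unless j = i + n, i.e. the elements of     *)
(* \prod_i Hom_R(X_i, Y_(i + n)); the differential is                        *)
(* f |-> d f - (-1)^n f d.                                                   *)
Section HomComplex.
Variables (R S : comPzRingType) (phi : {rmorphism R -> S}).
Variables (X : complex S) (Y : complex R).

Definition bihom := prodm (fun i => prodm (fun j => homm phi (X i) (Y j))).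
HB.instance Definition _ := GRing.Lmodule.on bihom.

Definition homC_pred (n : int) : {pred bihom} :=
  [pred f | `[< forall i j, j != i + n -> f i j = 0 >]].
Fact homC_closed n : submod_closed (homC_pred n).
Proof.
split=> [|a f g /asboolP f0 /asboolP g0]; apply/asboolP => i j // ne.
by rewrite -[LHS]/(a *: f i j + g i j) f0 ?g0 // scaler0 addr0.
Qed.
Definition homC_sub n : submodule bihom := SubmodulePred (homC_closed n).
Definition homC_obj n := subm (homC_sub n).
HB.instance Definition _ n := GRing.Lmodule.on (homC_obj n).

Definition homC_bidif (n m : int) (f : bihom) : bihom := fun i j =>
  if (n == m + 1) && (j == i + m) then
    homm_post (dif Y (j + 1) j) (f i (j + 1))
    - (-1) ^+ `|n|%N *: homm_pre (dif X i (i - 1)) (f (i - 1) j)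
  else 0.

Fact homC_bidif_sub n m f : homC_bidif n m f \in homC_sub m.
Proof.
by apply/asboolP => i j /negPf ne; rewrite /homC_bidif ne andbF.
Qed.
Definition homC_fun n m (f : homC_obj n) : homC_obj m :=
  Sub (homC_bidif n m (val f)) (homC_bidif_sub n m (val f)).

Fact homC_fun_is_linear n m : linear (@homC_fun n m).
Proof.
move=> a f g; apply/val_inj/functional_extensionality_dep => i.
apply/functional_extensionality_dep => j.
rewrite -[RHS]/(a *: homC_bidif n m (val f) i j + homC_bidif n m (val g) i j).
rewrite -[LHS]/(homC_bidif n m (a *: val f + val g) i j) /homC_bidif.
case: ifP => _; last by rewrite scaler0 addr0.
by rewrite !linearP /= scalerDr addrACA.
Qed.
HB.instance Definition _ n m :=
  GRing.isLinear.Build S (homC_obj n) (homC_obj m) *:%R (@homC_fun n m)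
    (@homC_fun_is_linear n m).

Fact homC_shape n m : n != m + 1 -> forall f, @homC_fun n m f = 0.
Proof.
move=> /negPf nm f; apply/val_inj/functional_extensionality_dep => i.
apply/functional_extensionality_dep => j.
by rewrite -[LHS]/(homC_bidif n m (val f) i j) /homC_bidif nm.
Qed.

Fact sign_absz1 (m : int) : (-1) ^+ absz (m + 1) = - (-1) ^+ `|m|%N :> S.
Proof.
case: m => m; first by rewrite -PoszD addn1 exprS mulN1r.
by rewrite NegzE -[m.+1]addn1 PoszD opprD addrNK -opprD -PoszD !abszN /= addn1
           exprS mulN1r opprK.
Qed.

Fact homC_bidif_bidif n m k f : homC_bidif m k (homC_bidif n m f) = 0.
Proof.
apply: functional_extensionality_dep => i.
apply: functional_extensionality_dep => j; rewrite {1}/homC_bidif.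
case: ifP => // /andP[/eqP -> /eqP ->]; rewrite /homC_bidif.
have -> : (i + k + 1 == i + (k + 1)) = true by apply/eqP; ring.
have -> : (i + k == i - 1 + (k + 1)) = true by apply/eqP; ring.
rewrite !andbT; case: eqP => [-> |_]; last by rewrite !linear0 addr0.
rewrite !sign_absz1 opprK; set e := (-1) ^+ _.
have post2 h : homm_post (dif Y (i + k + 1) (i + k))
    (homm_post (dif Y (i + k + 1 + 1) (i + k + 1)) h) = 0 :> homm phi (X i) _.
  by apply: hommP => x; apply: dif_dif.
have pre2 h : homm_pre (dif X i (i - 1))
    (homm_pre (dif X (i - 1) (i - 1 - 1)) h) = 0 :> homm phi _ (Y (i + k)).
  by apply: hommP => x; rewrite /homm_fun /= dif_dif; apply: (homm0 h).
have swap h : homm_pre (dif X i (i - 1)) (homm_post (dif Y (i + k + 1) (i + k)) h)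
    = homm_post (dif Y (i + k + 1) (i + k)) (homm_pre (dif X i (i - 1)) h)
    :> homm phi _ _ by apply: hommP.
rewrite !linearB !linearZ /= post2 !opprK pre2 !scaler0 addr0 add0r.
by rewrite !scalerN scaleNr opprK swap addNr.
Qed.

Fact homC_dd n m k f : @homC_fun m k (@homC_fun n m f) = 0.
Proof. by apply/val_inj/homC_bidif_bidif. Qed.

Definition homC : complex S := @Complex S homC_obj
  (fun n m => @homC_fun n m : {linear _ -> _}) homC_shape homC_dd.
End HomComplex.

Definition K_injective (R : comPzRingType) (I : complex R) :=
  forall A : complex R, acyclic A -> acyclic (homC idfun A I).

(* RHom_R(-, Y) is computed by Hom_R(-, J) for a K-injective resolution      *)
(* Y -> J.                                                                   *)
Record injective_resolution (R : comPzRingType) (Y : complex R) :=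
  InjectiveResolution {
    ires_obj :> complex R;
    ires_map : chain_map Y ires_obj;
    ires_quasi_iso : quasi_iso ires_map;
    ires_K_injective : K_injective ires_obj
  }.

Definition RHom (R S : comPzRingType) (phi : {rmorphism R -> S})
    (X : complex S) (Y : complex R) (J : injective_resolution Y) : complex S :=
  homC phi X J.

Section Homothety.
Variables (R : comPzRingType) (C : complex R) (J : injective_resolution C).

(* The resolution C -> J as an element of degree 0 of Hom_R(C, J). *)
Definition unit_bihom : bihom idfun C J := fun i j =>
  if i =P j is ReflectT e then
    ecast k (homm idfun (C i) (J k)) e
      (exist _ _ (linearP (ires_map J i)) : homm idfun (C i) (J i))
  else 0.

Lemma unit_bihomE i (x : C i) : homm_fun (unit_bihom i i) x = ires_map J i x.
Proof.
rewrite /unit_bihom; case: eqP => [e|/(_ erefl)//].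
by rewrite (eq_axiomK e).
Qed.

Fact unit_bihom_sub : unit_bihom \in homC_sub idfun C J 0.
Proof.
apply/asboolP => i j; rewrite addr0 /unit_bihom.
by case: (@eqP _ i j) => // e /eqP[].
Qed.
Definition unit_hom : homC_obj idfun C J 0 := Sub unit_bihom unit_bihom_sub.

Fact unit_bihom_comm i i' j j' : i = j' -> i' = j ->
  homm_post (dif J j' j) (unit_bihom i j')
  = homm_pre (dif C i i') (unit_bihom i' j).
Proof.
move=> <- <-; apply: hommP => x.
rewrite -[LHS]/(dif J i i' (homm_fun (unit_bihom i i) x)).
rewrite -[RHS]/(homm_fun (unit_bihom i' i') (dif C i i' x)).
by rewrite !unit_bihomE chain_comm.
Qed.

Fact unit_hom_cycle m : homC_fun m unit_hom = 0.
Proof.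
apply/val_inj/functional_extensionality_dep => i.
apply/functional_extensionality_dep => j.
rewrite -[LHS]/(homC_bidif 0 m unit_bihom i j) /homC_bidif.
case: ifP => // /andP[/eqP m1 /eqP jE].
have ij : i = j + 1 by rewrite jE -addrA -m1 addr0.
rewrite (@unit_bihom_comm i (i - 1) j (j + 1)) //; last by rewrite ij addrK.
by rewrite expr0 scale1r subrr.
Qed.

Definition homothety0 (r : R^o) : homC_obj idfun C J 0 := (r : R) *: unit_hom.
Fact homothety0_is_linear : linear homothety0.
Proof. by move=> a x y; rewrite /homothety0 scalerDl scalerA. Qed.
HB.instance Definition _ :=
  GRing.isLinear.Build R R^o (homC_obj idfun C J 0) *:%R homothety0
    homothety0_is_linear.

Definition homothety_fun (i : int) :
    {linear concentrated R^o i -> RHom idfun C J i} :=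
  match i with
  | Posz 0 => homothety0
  | _ => \0
  end.

Fact homothety_comm i j x : dif (RHom idfun C J) i j (homothety_fun i x)
  = homothety_fun j (dif (concentrated R^o) i j x).
Proof.
rewrite [RHS]linear0; case: i x => [[|i]|i] x; rewrite ?linear0 //.
have z : homC_fun j (homothety0 x) = 0 :> homC_obj idfun C J j.
  by rewrite /homothety0 linearZ /= unit_hom_cycle scaler0.
exact: z.
Qed.

(* R -> RHom_R(C, C) = Hom_R(C, J), r |-> r times the resolution C -> J.     *)
Definition homothety : chain_map (concentrated R^o) (RHom idfun C J) :=
  ChainMap homothety_comm.
End Homothety.

Definition semidualizing (R : comPzRingType) (C : complex R) :=
  fin_gen (total_homology C) /\
  exists J : injective_resolution C, quasi_iso (homothety J).

Definition bounded (R : pzRingType) (F : complex R) :=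
  exists n : nat, forall i : int, (n < `|i|)%N -> forall x : F i, x = 0.

Definition finite_flat_dim (R : comPzRingType) (M : lmodType R) :=
  exists F : complex R,
    [/\ bounded F, forall i, flat (F i) & derived_iso F (concentrated M)].

(* Main.v *)
(* Let J and J' be the given resolutions and X = Hom(J, J').  For a module N of
   finite projective dimension, Hom(Hom(N, J), J') computes the derived tensor
   product of X and N.  For N = S, the hypothesis gives an S-linear isomorphism
   of Hom(S, J) with Hom(S, J'), so that this complex becomes
   Hom(Hom(S, J'), J') = S, because R = Hom(J', J').

   Every maximal ideal m of R lies below a prime q of S, which provides
   functionals S -> R / m detecting the elements outside of q.  With Nakayama's
   lemma they show that H_i(X) = 0 for i < 0 and that L = H_0(X) is generated,
   near m, by one element e, represented by a chain map J -> J' that Hom(S, -)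
   turns into an isomorphism near m.  A complex A with finitely generated
   homology is zero near m as soon as Hom(S, A) is: the Koszul complex of A on
   generators of m has a finite filtration by complexes killed by m, on which
   A -> cone(Hom(S, A) -> A) is null, so this map is nilpotent.  Applied to the
   cone of e, this yields that e has zero annihilator near m.  So L is a line
   bundle with L (x) S = S, whence L = R by injectivity on Picard groups, and a
   generator of L is a quasi-isomorphism J -> J'. *)
From HB Require Import structures.
Require Import Defs.
From mathcomp Require Import all_boot all_algebra.
From mathcomp Require Import boolp ring zify.
From mathcomp Require classical_sets.
Set Implicit Arguments.
Unset Strict Implicit.
Unset Printing Implicit Defensive.
Import GRing.Theory.
Local Open Scope ring_scope.

(** * A decision procedure for identities in abelian groups *)

(** No complex is ever localized, so that the K-injective targets stay fixed: a property holds near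
    [m] when it holds after multiplication by an element outside of [m], and the ideal of all
    multipliers that work makes it global again. Nakayama's lemma then needs Hom complexes with
    finitely generated homology, which a truncation argument provides. The main obstacle is that [S]
    need not be flat and that X = Hom(J, J') is not known to have homology bounded below, so no
    argument by lowest degree can start. Nilpotence supplies the start: it gives the vanishing of X
    near [m] in all sufficiently low degrees. In the lowest remaining degree the derived tensor
    product with [S] is the ordinary one, and Nakayama's lemma climbs upwards from there.
    Module-finiteness and finite flat dimension enter as one finite resolution of [S] by finitely
    generated projectives. It makes Hom(Hom(S, J), J') accessible through finite sums of copies of
    X, without projective resolutions of unbounded complexes. *)

Inductive zexp := ZVar of nat | ZAdd of zexp & zexp | ZOpp of zexp | ZZero.
Fixpoint zeval (V : zmodType) (env : seq V) e : V :=
  match e with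
  | ZVar n => env`_n
  | ZAdd e1 e2 => zeval env e1 + zeval env e2
  | ZOpp e1 => - zeval env e1
  | ZZero => 0
  end.
Fixpoint zcoef n e : int :=
  match e with
  | ZVar m => (n == m)%:Z
  | ZAdd e1 e2 => zcoef n e1 + zcoef n e2
  | ZOpp e1 => - zcoef n e1
  | ZZero => 0
  end.
Definition zeq n e1 e2 := all (fun i => zcoef i e1 == zcoef i e2) (iota 0 n).

(** The integer coefficients of the atoms are a normal form, so identities reduce to comparing
    integers. *)
Lemma zevalE (V : zmodType) (env : seq V) e :
  zeval env e = \sum_(i < size env) env`_i *~ zcoef i e.
Proof.
elim: e => [m|e1 IH1 e2 IH2|e IH|] /=.
- have [lt_m|ge_m] := ltnP m (size env).
    rewrite (bigD1 (Ordinal lt_m)) //= eqxx mulr1z big1 ?addr0 // => i ne.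
    case: eqP => [e|_]; last by rewrite mulr0z.
    by case/eqP: ne; apply: val_inj.
  rewrite nth_default // big1 // => i _; case: eqP => [e|_]; last by rewrite mulr0z.
  by move: (ltn_ord i); rewrite e ltnNge ge_m.
- by rewrite IH1 IH2 -big_split; apply: eq_bigr => i _; rewrite mulrzDr.
- by rewrite IH -sumrN; apply: eq_bigr => i _; rewrite mulrNz.
- by rewrite big1 // => i _; rewrite mulr0z.
Qed.

Lemma zeqP (V : zmodType) (env : seq V) e1 e2 :
  zeq (size env) e1 e2 -> zeval env e1 = zeval env e2.
Proof.
move=> /allP e; rewrite !zevalE; apply: eq_bigr => i _.
by congr (_ *~ _); apply/eqP/e; rewrite mem_iota ltn_ord.
Qed.

Ltac zmod_mem x env :=
  lazymatch env with
  | nil => constr:(false)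
  | cons x _ => constr:(true)
  | cons _ ?l => zmod_mem x l
  end.
Ltac zmod_env e env :=
  lazymatch e with
  | GRing.add ?a ?b => let env := zmod_env a env in zmod_env b env
  | GRing.opp ?a => zmod_env a env
  | GRing.zero => env
  | ?x => lazymatch zmod_mem x env with
          | true => env
          | false => constr:(cons x env)
          end
  end.
Ltac zmod_idx x env :=
  lazymatch env with
  | cons x _ => constr:(0%N)
  | cons _ ?l => let n := zmod_idx x l in constr:(S n)
  end.
Ltac zmod_reify e env :=
  lazymatch e with
  | GRing.add ?a ?b =>
      let a := zmod_reify a env in let b := zmod_reify b env in constr:(ZAdd a b)
  | GRing.opp ?a => let a := zmod_reify a env in constr:(ZOpp a)
  | GRing.zero => constr:(ZZero)
  | ?x => let n := zmod_idx x env in constr:(ZVar n)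
  end.
(* Instances of an atom that differ by canonical projections are merged.     *)
Ltac zmod_set x := let v := fresh "z" in set v := x; clearbody v.
Ltac zmod_abstract e :=
  lazymatch e with
  | GRing.add ?a ?b => zmod_abstract a; zmod_abstract b
  | GRing.opp ?a => zmod_abstract a
  | GRing.zero => idtac
  | ?x => first [is_var x | zmod_set x | idtac]
  end.
Ltac zmod :=
  lazymatch goal with |- @eq _ ?e1 ?e2 => zmod_abstract e1; zmod_abstract e2 end;
  lazymatch goal with
  | |- @eq ?T ?e1 ?e2 =>
      let env := zmod_env e1 (@nil T) in
      let env := zmod_env e2 env in
      let r1 := zmod_reify e1 env in
      let r2 := zmod_reify e2 env in
      refine (@zeqP _ env r1 r2 _); vm_compute; reflexivity
  end.

(* [linearD] and its relatives would also see the scalings and the opposite. *)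
Section Linear.
Variables (R : pzRingType) (U V : lmodType R) (f : {linear U -> V}).
Lemma linD x y : f (x + y) = f x + f y. Proof. exact: linearD. Qed.
Lemma linN x : f (- x) = - f x. Proof. exact: linearN. Qed.
Lemma linB x y : f (x - y) = f x - f y. Proof. exact: linearB. Qed.
Lemma lin0 : f 0 = 0. Proof. exact: linear0. Qed.
Lemma linZ a x : f (a *: x) = a *: f x. Proof. exact: linearZ. Qed.
Lemma lin_sum n (x : 'I_n -> U) : f (\sum_i x i) = \sum_i f (x i).
Proof. exact: linear_sum. Qed.
End Linear.

(* Sealed, so that no unification unfolds it. *)
Fact mklin_subproof (R : pzRingType) (U V : lmodType R) (f : U -> V) (lf : linear f) :
  {h : {linear U -> V} | h =1 f}.
Proof.
pose h : {linear U -> V} := HB.pack f (GRing.isLinear.Build R U V *:%R f lf).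
by exists h.
Qed.
Definition mklin (R : pzRingType) (U V : lmodType R) (f : U -> V) (lf : linear f) :=
  sval (mklin_subproof lf).
Lemma mklinE (R : pzRingType) (U V : lmodType R) (f : U -> V) (lf : linear f) x :
  mklin lf x = f x.
Proof. exact: (svalP (mklin_subproof lf)). Qed.

(* Elementwise homology: [k] below need not be [i + 1], since the components *)
(* of a differential outside of consecutive degrees are zero.                *)
Definition cyc (R : pzRingType) (C : complex R) (i : int) (z : C i) :=
  forall j, dif C i j z = 0.
Definition bnd (R : pzRingType) (C : complex R) (i : int) (z : C i) :=
  exists k (y : C k), dif C k i y = z.

(** * Cycles, boundaries and triangles *)

Section Elementwise.
Variable R : pzRingType.
Implicit Types (A B C D : complex R) (i j : int).

Section Additivity.
Variables (C D : complex R) (f : chain_map C D) (i j : int).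
Lemma difD x y : dif C i j (x + y) = dif C i j x + dif C i j y.
Proof. exact: linearD. Qed.
Lemma difB x y : dif C i j (x - y) = dif C i j x - dif C i j y.
Proof. exact: linearB. Qed.
Lemma difN x : dif C i j (- x) = - dif C i j x. Proof. exact: linearN. Qed.
Lemma difZ a x : dif C i j (a *: x) = a *: dif C i j x.
Proof. exact: linearZ. Qed.
Lemma dif0 : dif C i j 0 = 0. Proof. exact: linear0. Qed.
Lemma difS n (x : 'I_n -> C i) : dif C i j (\sum_l x l) = \sum_l dif C i j (x l).
Proof. exact: linear_sum. Qed.
Lemma chD x y : f i (x + y) = f i x + f i y. Proof. exact: linearD. Qed.
Lemma chB x y : f i (x - y) = f i x - f i y. Proof. exact: linearB. Qed.
Lemma chN x : f i (- x) = - f i x. Proof. exact: linearN. Qed.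
Lemma chZ a x : f i (a *: x) = a *: f i x. Proof. exact: linearZ. Qed.
Lemma ch0 : f i 0 = 0. Proof. exact: linear0. Qed.
Lemma chS n (x : 'I_n -> C i) : f i (\sum_l x l) = \sum_l f i (x l).
Proof. exact: linear_sum. Qed.
End Additivity.
Definition lD := (difD, chD).
Definition lB := (difB, chB).
Definition lZ := (difZ, chZ).
Definition l0 := (dif0, ch0).
Definition lS := (difS, chS).

Lemma cyc0 C i : cyc (0 : C i). Proof. by move=> j; rewrite linear0. Qed.
Lemma cycD C i (x y : C i) : cyc x -> cyc y -> cyc (x + y).
Proof. by move=> cx cy j; rewrite linearD cx cy addr0. Qed.
Lemma cycZ C i a (x : C i) : cyc x -> cyc (a *: x).
Proof. by move=> cx j; rewrite linearZ /= cx scaler0. Qed.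
Lemma cycN C i (x : C i) : cyc x -> cyc (- x).
Proof. by move=> cx j; rewrite linearN cx oppr0. Qed.
Lemma cycB C i (x y : C i) : cyc x -> cyc y -> cyc (x - y).
Proof. by move=> cx cy; apply/cycD/cycN. Qed.
Lemma cyc_dif C i j (x : C i) : cyc (dif C i j x).
Proof. by move=> k; apply: dif_dif. Qed.
Lemma cyc_sum C i n (x : 'I_n -> C i) : (forall k, cyc (x k)) -> cyc (\sum_k x k).
Proof. by move=> cx; elim/big_ind: _ => // [|y z]; [apply: cyc0|apply: cycD]. Qed.

Lemma bnd0 C i : bnd (0 : C i). Proof. by exists i, 0; rewrite linear0. Qed.
Lemma bnd_dif C i j (x : C i) : bnd (dif C i j x). Proof. by exists i, x. Qed.

Lemma bndP C i (x : C i) : bnd x <-> exists y, dif C (i + 1) i y = x.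
Proof.
split=> [[k [y <-]]|[y <-]]; last exact: bnd_dif.
have [e|/dif_shape ->] := eqVneq k (i + 1); last by exists 0; rewrite linear0.
by move: y; rewrite e => y; exists y.
Qed.

Lemma bndE C i j (x : C i) : j = i + 1 -> bnd x -> exists y, dif C j i y = x.
Proof. by move=> -> /bndP. Qed.

Lemma bndD C i (x y : C i) : bnd x -> bnd y -> bnd (x + y).
Proof.
by move=> /bndP[u <-] /bndP[v <-]; rewrite -linearD; apply: bnd_dif.
Qed.
Lemma bndZ C i a (x : C i) : bnd x -> bnd (a *: x).
Proof. by move=> /bndP[u <-]; rewrite -linearZ; apply: bnd_dif. Qed.
Lemma bndN C i (x : C i) : bnd x -> bnd (- x).
Proof. by move=> /bndP[u <-]; rewrite -linearN; apply: bnd_dif. Qed.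
Lemma bndB C i (x y : C i) : bnd x -> bnd y -> bnd (x - y).
Proof. by move=> cx cy; apply/bndD/bndN. Qed.
Lemma bnd_sum C i n (x : 'I_n -> C i) : (forall k, bnd (x k)) -> bnd (\sum_k x k).
Proof. by move=> cx; elim/big_ind: _ => // [|y z]; [apply: bnd0|apply: bndD]. Qed.
Lemma bnd_cyc C i (x : C i) : bnd x -> cyc x.
Proof. by move=> [k [y <-]]; apply: cyc_dif. Qed.
Lemma bndBC C i (x y : C i) : bnd (x - y) -> bnd (y - x).
Proof. by move/bndN; rewrite opprB. Qed.
Lemma bnd_trans C i (x y z : C i) : bnd (x - y) -> bnd (y - z) -> bnd (x - z).
Proof. by move=> xy yz; rewrite -(subrKA y); apply: bndD. Qed.
Lemma bnd_congr C i (x y : C i) : bnd (x - y) -> bnd x -> bnd y.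
Proof. by move=> xy bx; rewrite -(subKr x y); apply: bndB. Qed.

Lemma cycP C i (x : C i) : cyc x <-> dif C i (i - 1) x = 0.
Proof.
split=> [|x0 j]; first exact.
have [->|ne] := eqVneq j (i - 1); first exact: x0.
apply: dif_shape; apply: contra_neq ne => ->; lia.
Qed.

Lemma cycE C i j (x : C i) : i = j + 1 -> dif C i j x = 0 -> cyc x.
Proof. by move=> e x0; apply/cycP; have <- : j = i - 1 by lia. Qed.

Lemma chain_cyc C D (f : chain_map C D) i (x : C i) : cyc x -> cyc (f i x).
Proof. by move=> cx j; rewrite chain_comm cx linear0. Qed.
Lemma chain_bnd C D (f : chain_map C D) i (x : C i) : bnd x -> bnd (f i x).
Proof. by move=> [k [y <-]]; rewrite -chain_comm; apply: bnd_dif. Qed.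

Definition hclass C i (z : C i) (cz : cyc z) : homology C i :=
  quotm_pi (boundaries C i) (exist _ z (introT eqP ((cycP z).1 cz))).

Lemma hclassP C i (h : homology C i) : exists z (cz : cyc z), h = hclass cz.
Proof.
have [z zP] : exists z, h = quotm_pi (boundaries C i) z.
  by exists (quotm_repr h); rewrite quotm_reprK.
have cz : cyc (val z) by apply/cycP/eqP/(valP z).
by exists (val z), cz; rewrite zP; congr quotm_pi; apply: val_inj.
Qed.

Lemma hclass_eq C i (z z' : C i) (cz : cyc z) (cz' : cyc z') :
  hclass cz = hclass cz' <-> bnd (z - z').
Proof.
split=> [/quotm_piP/asboolP[y yE]|/bndP[y yE]].
  by exists (i + 1), y; apply: esym yE.
by apply/quotm_piP/asboolP; exists y; apply: esym yE.
Qed.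

Lemma hclass0P C i (z : C i) (cz : cyc z) : hclass cz = 0 <-> bnd z.
Proof.
have -> : 0 = hclass (cyc0 C i).
  by rewrite -(linear0 (quotm_pi (boundaries C i))); congr quotm_pi; apply: val_inj.
by rewrite hclass_eq subr0.
Qed.

Lemma hclassD C i (z z' : C i) (cz : cyc z) (cz' : cyc z') :
  hclass cz + hclass cz' = hclass (cycD cz cz').
Proof. by rewrite /hclass -linearD; congr quotm_pi; apply: val_inj. Qed.
Lemma hclassZ C i a (z : C i) (cz : cyc z) : a *: hclass cz = hclass (cycZ a cz).
Proof. by rewrite /hclass -linearZ; congr quotm_pi; apply: val_inj. Qed.

Lemma hclass_sum C i n (z : 'I_n -> C i) (cz : forall k, cyc (z k)) :
  \sum_k hclass (cz k) = hclass (cyc_sum cz).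
Proof.
rewrite /hclass -linear_sum; congr quotm_pi; apply: val_inj.
by rewrite (big_morph (fun u : subm (cycles C i) => val u) (id1 := 0) (op1 := +%R)).
Qed.

Lemma hclass_map C D (f : chain_map C D) i (z : C i) (cz : cyc z) :
  homology_map f (hclass cz) = hclass (chain_cyc f cz).
Proof. by rewrite homology_mapE; congr quotm_pi; apply: val_inj. Qed.

Lemma acyclicP C : acyclic C <-> forall i (z : C i), cyc z -> bnd z.
Proof.
split=> [aC i z cz|bC i h]; first by apply/(hclass0P cz)/aC.
by have [z [cz ->]] := hclassP h; apply/hclass0P/bC.
Qed.

Lemma quasi_isoP C D (f : chain_map C D) : quasi_iso f <->
  (forall i (z : C i), cyc z -> bnd (f i z) -> bnd z) /\
  (forall i (w : D i), cyc w -> exists2 z : C i, cyc z & bnd (w - f i z)).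
Proof.
split=> [qf|[qi qs] i].
  split=> [i z cz bz|i w cw].
    apply/(hclass0P cz)/(bij_inj (qf i)).
    rewrite -[in RHS]((hclass0P (cyc0 C i)).2 (bnd0 C i)) !hclass_map.
    by apply/hclass_eq; rewrite linear0 subr0.
  have [g _ gK] := qf i; have [z [cz zE]] := hclassP (g (hclass cw)).
  exists z => //; apply/(hclass_eq cw (chain_cyc f cz)).
  by rewrite -hclass_map -zE gK.
have inj : injective (homology_map f (i := i)).
  move=> h h'; have [z [cz ->]] := hclassP h; have [z' [cz' ->]] := hclassP h'.
  rewrite !hclass_map => /hclass_eq e; apply/hclass_eq.
  by apply: qi; [apply: cycB|rewrite linearB].
have /(_ _)/cid-/all_sig[g gK] : forall h, exists h', homology_map f (i := i) h' = h.
  move=> h; have [w [cw ->]] := hclassP h; have [z cz bz] := qs i w cw.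
  by exists (hclass cz); rewrite hclass_map; apply/hclass_eq/bndBC.
by exists g => // h; apply: inj; rewrite gK.
Qed.

(** Degrees such as [i - 1 + 1] and [i] are equal but not convertible; this identity between
    components of equal degree, zero otherwise, avoids casts in statements. *)
Definition idm_fun C i j (x : C i) : C j :=
  if i =P j is ReflectT e then ecast k (C k) e x else 0.
Fact idm_linear C i j : linear (@idm_fun C i j).
Proof.
move=> a x y; rewrite /idm_fun; case: eqP => [e|_]; last by rewrite scaler0 addr0.
by case: _ / e.
Qed.
Definition idm C i j : {linear C i -> C j} := mklin (@idm_linear C i j).

Lemma idm_id C i x : idm C i i x = x.
Proof. by rewrite mklinE /idm_fun; case: eqP => // e; rewrite (eq_axiomK e). Qed.
Lemma idm_ne C i j x : i != j -> idm C i j x = 0.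
Proof. by rewrite mklinE /idm_fun; case: eqP. Qed.
Lemma idmK C i j k x : i = j -> idm C j k (idm C i j x) = idm C i k x.
Proof. by move=> e; case: _ / e; rewrite idm_id. Qed.
Lemma idmKK C i j x : i = j -> idm C j i (idm C i j x) = x.
Proof. by move=> e; rewrite idmK // idm_id. Qed.
Lemma dif_idm C i j k x : i = j -> dif C j k (idm C i j x) = dif C i k x.
Proof. by move=> e; case: _ / e; rewrite idm_id. Qed.
Lemma idm_dif C i j k x : j = k -> idm C j k (dif C i j x) = dif C i k x.
Proof. by move=> e; case: _ / e; rewrite idm_id. Qed.
Lemma chain_idm C D (f : chain_map C D) i j x :
  f j (idm C i j x) = idm D i j (f i x).
Proof.
have [<-|ne] := eqVneq i j; first by rewrite !idm_id.
by rewrite !idm_ne // linear0.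
Qed.
Lemma cyc_idm C i j (x : C i) : cyc x -> cyc (idm C i j x).
Proof.
have [<-|ne] := eqVneq i j; first by rewrite idm_id.
by rewrite idm_ne // => _; apply: cyc0.
Qed.

Fact cid_comm C i j x : dif C i j (idfun x) = idfun (dif C i j x).
Proof. by []. Qed.
Definition cidm C : chain_map C C := ChainMap (@cid_comm C).

Fact ccomp_comm A B C (g : chain_map B C) (f : chain_map A B) i j x :
  dif C i j ((g i \o f i) x) = (g j \o f j) (dif A i j x).
Proof. by rewrite /= !chain_comm. Qed.
Definition ccomp A B C (g : chain_map B C) (f : chain_map A B) : chain_map A C :=
  ChainMap (ccomp_comm g f).

Fact cnull_comm A B i j x : dif B i j (\0 x) = \0 (dif A i j x) :> B j.
Proof. by rewrite linear0. Qed.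
Definition cnull A B : chain_map A B := ChainMap (@cnull_comm A B).

Lemma quasi_iso_comp A B C (g : chain_map B C) (f : chain_map A B) :
  quasi_iso g -> quasi_iso f -> quasi_iso (ccomp g f).
Proof.
move=> /quasi_isoP[gi gs] /quasi_isoP[fi fs]; apply/quasi_isoP; split.
  by move=> i z cz /gi bz; apply: fi => //; apply: bz; apply: chain_cyc.
move=> i w cw; have [y cy wy] := gs i w cw; have [x cx yx] := fs i y cy.
exists x => //; apply: bnd_trans wy _; rewrite /= -linearB; exact: chain_bnd.
Qed.

(* Two composable chain maps with zero composite such that the map induced   *)
(* on the mapping cone of the first one is a quasi-isomorphism.              *)
Record triangle A' A A'' (a : chain_map A' A) (g : chain_map A A'') : Prop :=
  Triangle {
  tri_comp : forall i x, g i (a i x) = 0;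
  tri_surj : forall i j (z : A'' i), i = j + 1 -> cyc z ->
    exists (x' : A' j) (x : A i),
      [/\ cyc x', dif A i j x = a j x' & bnd (z - g i x)];
  tri_inj : forall i j (x' : A' j) (x : A i), i = j + 1 -> cyc x' ->
    dif A i j x = a j x' -> bnd (g i x) ->
    exists2 w' : A' i, dif A' i j w' = x' & bnd (x - a i w')
}.

Record exact_seq A' A A'' (a : chain_map A' A) (g : chain_map A A'') : Prop :=
  ExactSeq {
  ex_inj : forall i x, a i x = 0 -> x = 0;
  ex_comp : forall i x, g i (a i x) = 0;
  ex_mid : forall i x, g i x = 0 -> exists y, x = a i y;
  ex_surj : forall i z, exists x, g i x = z
}.

Lemma exact_triangle A' A A'' (a : chain_map A' A) (g : chain_map A A'') :
  exact_seq a g -> triangle a g.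
Proof.
move=> [ai ga mid gs]; split=> // i j.
  move=> z ij cz; have [x xz] := gs i z.
  have [|x' x'E] := mid j (dif A i j x); first by rewrite -chain_comm xz cz.
  exists x', x; split=> //; last by rewrite xz subrr; apply: bnd0.
  by move=> k; apply: ai; rewrite -chain_comm -x'E dif_dif.
move=> x' x ij cx' dx /(bndE erefl)[y yE]; have [w wy] := gs _ y.
have [|w' w'E] := mid i (x - dif A (i + 1) i w).
  by rewrite linearB -chain_comm wy yE subrr.
exists w'; last by rewrite -w'E subKr; apply: bnd_dif.
apply/subr0_eq/ai; rewrite linearB -chain_comm -w'E linearB dif_dif subr0 dx.
by rewrite subrr.
Qed.

(** Exactness of the long homology sequence at [A]: the case [x' = 0] of [tri_inj]. *)
Lemma tri_exact A' A A'' (a : chain_map A' A) (g : chain_map A A'') :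
  triangle a g -> forall i (x : A i), cyc x -> bnd (g i x) ->
  exists2 y, cyc y & bnd (x - a i y).
Proof.
move=> tri i x cx bx.
have [|||w' w'E bw] := tri_inj tri (j := i - 1) (x' := 0) _ _ _ bx.
- by rewrite subrK.
- exact: cyc0.
- by rewrite cx linear0.
by exists w' => //; apply/cycP.
Qed.

(** A quasi-isomorphism is a triangle with zero first term, so facts about triangles specialize to
    quasi-isomorphisms. *)
Lemma quasi_iso_tri A' A A'' (a : chain_map A' A) (g : chain_map A A'') :
  (forall i (x : A' i), x = 0) -> quasi_iso g -> triangle a g.
Proof.
move=> A'0 /quasi_isoP[gi gs]; split=> i.
- by move=> x; rewrite (A'0 i x) !linear0.
- move=> j z ij cz; have [x cx bx] := gs i z cz; exists 0, x; split=> //.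
    exact: cyc0.
  by rewrite cx linear0.
- move=> j x' x ij cx' dx bx; exists 0; first by rewrite linear0 (A'0 _ x').
  rewrite linear0 subr0; apply: gi => //.
  by apply: (cycE ij); rewrite dx (A'0 _ x') linear0.
Qed.

Lemma tri_acyclic A' A A'' (a : chain_map A' A) (g : chain_map A A'') :
  triangle a g -> acyclic A' -> acyclic A'' -> acyclic A.
Proof.
move=> tri /acyclicP a' /acyclicP a''; apply/acyclicP => i z cz.
have [y cy zy] := tri_exact tri cz (a'' _ _ (chain_cyc g cz)).
by apply: bnd_congr (bndBC zy) _; apply/chain_bnd/a'.
Qed.

Section Shift.
Variable A : complex R.
Definition sh_dif i j : {linear A (i - 1) -> A (j - 1)} := \- dif A (i - 1) (j - 1).
Fact sh_shape i j : i != j + 1 -> forall x, sh_dif i j x = 0.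
Proof.
move=> ij x; rewrite /sh_dif /= dif_shape ?oppr0 //.
by apply: contra_neq ij => e; lia.
Qed.
Fact sh_dd i j k x : sh_dif j k (sh_dif i j x) = 0.
Proof. by rewrite /sh_dif /= linearN dif_dif !oppr0. Qed.
Definition sh : complex R := Complex sh_shape sh_dd.
Lemma sh_difE i j x : dif sh i j x = - dif A (i - 1) (j - 1) x. Proof. by []. Qed.
Lemma sh_cyc i (x : sh i) : cyc x <-> cyc (x : A (i - 1)).
Proof.
split=> cx; last by move=> j; rewrite sh_difE cx oppr0.
by apply/cycP/eqP; rewrite -oppr_eq0 -sh_difE cx.
Qed.
Lemma sh_bnd i (x : sh i) : bnd x <-> bnd (x : A (i - 1)).
Proof.
split=> [[k [y <-]]|].
  by rewrite sh_difE; apply/bndN/bnd_dif.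
case/(bndE (j := i + 1 - 1)) => [|y <-]; first lia.
by exists (i + 1), (- y); rewrite sh_difE linearN opprK.
Qed.
End Shift.

Section Cone.
Variables (A B : complex R) (f : chain_map A B).

Definition cone_obj i : lmodType R := (A (i - 1)%R * B i)%type.
Definition cone_dif_fun i j (p : cone_obj i) : cone_obj j :=
  (- dif A (i - 1) (j - 1) p.1, idm B (i - 1) j (f (i - 1) p.1) + dif B i j p.2).
Fact cone_dif_linear i j : linear (@cone_dif_fun i j).
Proof.
move=> a x y; rewrite /cone_dif_fun /= !linearP.
congr (_, _); by rewrite /= scalerDr addrACA.
Qed.
HB.instance Definition _ i j := GRing.isLinear.Build R (cone_obj i) (cone_obj j)
  *:%R (@cone_dif_fun i j) (@cone_dif_linear i j).
Definition cone_dif i j : {linear cone_obj i -> cone_obj j} := @cone_dif_fun i j.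
Fact cone_shape i j : i != j + 1 -> forall x, cone_dif i j x = 0.
Proof.
move=> ij x; rewrite /cone_dif /= /cone_dif_fun dif_shape; last first.
  by apply: contra_neq ij => e; lia.
rewrite dif_shape // idm_ne ?oppr0 ?addr0 //.
by apply: contra_neq ij => e; lia.
Qed.
Fact cone_dd i j k x : cone_dif j k (cone_dif i j x) = 0.
Proof.
rewrite /cone_dif /= /cone_dif_fun /=; congr (_, _).
  by rewrite linearN dif_dif !oppr0.
rewrite !linearN linearD dif_dif addr0; have [e|ne] := eqVneq (i - 1) j; last first.
  rewrite (idm_ne _ ne) linear0 addr0 (dif_shape (i := i - 1)) ?linear0 ?oppr0 //.
  by apply: contra_neq ne => e; lia.
rewrite dif_idm // chain_comm.
have [e'|ne] := eqVneq (j - 1) k; first by rewrite -chain_idm idm_dif // addNr.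
by rewrite idm_ne // oppr0 add0r dif_shape ?linear0 //; apply: contra_neq ne; lia.
Qed.
Definition cone : complex R := Complex cone_shape cone_dd.

Lemma cone_difE i j (p : cone i) : dif cone i j p =
  (- dif A (i - 1) (j - 1) p.1, idm B (i - 1) j (f (i - 1) p.1) + dif B i j p.2).
Proof. by []. Qed.

Definition cone_in_fun i (y : B i) : cone i := (0, y).
Fact cone_in_linear i : linear (@cone_in_fun i).
Proof. by move=> a x y; congr (_, _); rewrite /= scaler0 addr0. Qed.
HB.instance Definition _ i := GRing.isLinear.Build R (B i) (cone i)
  *:%R (@cone_in_fun i) (@cone_in_linear i).
Fact cone_in_comm i j x : dif cone i j ((@cone_in_fun i : {linear _ -> _}) x)
  = (@cone_in_fun j : {linear _ -> _}) (dif B i j x).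
Proof. by rewrite cone_difE /= !linear0 add0r. Qed.
Definition cone_in : chain_map B cone := ChainMap cone_in_comm.

Definition cone_out_fun i (p : cone i) : sh A i := p.1.
Fact cone_out_linear i : linear (@cone_out_fun i). Proof. by []. Qed.
HB.instance Definition _ i := GRing.isLinear.Build R (cone i) (sh A i)
  *:%R (@cone_out_fun i) (@cone_out_linear i).
Fact cone_out_comm i j x : dif (sh A) i j ((@cone_out_fun i : {linear _ -> _}) x)
  = (@cone_out_fun j : {linear _ -> _}) (dif cone i j x).
Proof. by []. Qed.
Definition cone_out : chain_map cone (sh A) := ChainMap cone_out_comm.

Lemma cone_exact : exact_seq cone_in cone_out.
Proof.
split=> // i.
- by move=> x [].
- by move=> [x y] /= ->; exists y.
- by move=> z; exists (z, 0).
Qed.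
End Cone.

End Elementwise.

(** * Hom complexes *)

Notation hom := (homC idfun).

Definition sg (R : comPzRingType) (n : int) : R := (-1) ^+ `|n|%N.
Lemma sgS (R : comPzRingType) n m : n = m + 1 -> sg R n = - sg R m.
Proof. by move=> ->; apply: sign_absz1. Qed.
Lemma sgM (R : comPzRingType) n : sg R n * sg R n = 1.
Proof. by rewrite /sg -exprMn mulrNN mulr1 expr1n. Qed.
Lemma sgK (R : comPzRingType) n (V : lmodType R) (x : V) : sg R n *: (sg R n *: x) = x.
Proof. by rewrite scalerA sgM scale1r. Qed.

Fact homm_of_linear (R : comPzRingType) (M N : lmodType R) (F : {linear M -> N}) :
  linear (F : res idfun M -> N).
Proof. by move=> a x y; apply: (linearP F). Qed.
Definition homm_of (R : comPzRingType) (M N : lmodType R) (F : {linear M -> N}) :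
  homm idfun M N := exist _ _ (homm_of_linear F).

Section Coefficients.
Variables (R : comPzRingType) (A B : complex R).

Definition hc_fun n (f : hom A B n) i j : A i -> B j :=
  homm_fun ((val (f : homC_obj idfun A B n) : bihom idfun A B) i j).
Fact hc_linear n f i j : linear (@hc_fun n f i j).
Proof. by move=> a x y; apply: (homm_lin _ a x y). Qed.
HB.instance Definition _ n f i j :=
  GRing.isLinear.Build R (A i) (B j) *:%R (@hc_fun n f i j) (@hc_linear n f i j).
Definition hc n (f : hom A B n) i j : {linear A i -> B j} := @hc_fun n f i j.

Lemma hc_ne n (f : hom A B n) i j x : j != i + n -> hc f i j x = 0.
Proof.
move=> ne; have /asboolP/(_ _ _ ne) e := valP (f : homC_obj idfun A B n).
by rewrite /hc /= /hc_fun e.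
Qed.

Lemma hcP n (f g : hom A B n) :
  (forall i j x, j = i + n -> hc f i j x = hc g i j x) -> f = g.
Proof.
move=> fg; apply: val_inj.
apply: functional_extensionality_dep => i.
apply: functional_extensionality_dep => j; apply: hommP => x.
rewrite -[LHS]/(hc f i j x) -[RHS]/(hc g i j x).
have [ji|ne] := eqVneq j (i + n); first exact: fg.
by rewrite !hc_ne.
Qed.

Lemma hcDE n (f g : hom A B n) i j x : hc (f + g) i j x = hc f i j x + hc g i j x.
Proof. by []. Qed.
Lemma hcN n (f : hom A B n) i j x : hc (- f) i j x = - hc f i j x.
Proof. by []. Qed.
Lemma hcB n (f g : hom A B n) i j x : hc (f - g) i j x = hc f i j x - hc g i j x.
Proof. by []. Qed.
Lemma hc0 n i j x : hc (0 : hom A B n) i j x = 0.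
Proof. by []. Qed.
Lemma hcZ n a (f : hom A B n) i j x : hc (a *: f) i j x = a *: hc f i j x.
Proof. by rewrite -linearZ. Qed.
Lemma hc_sum n (K : Type) (r : seq K) (Q : pred K) (f : K -> hom A B n) i j x :
  hc (\sum_(l <- r | Q l) f l) i j x = \sum_(l <- r | Q l) hc (f l) i j x.
Proof. by elim/big_rec2: _ => // l y z _ <-. Qed.

Definition hmk_bihom n (F : forall i j, {linear A i -> B j}) : bihom idfun A B :=
  fun i j => if j == i + n then homm_of (F i j) else 0.
Fact hmk_sub n F : hmk_bihom n F \in homC_sub idfun A B n.
Proof. by apply/asboolP => i j /negPf ne; rewrite /hmk_bihom ne. Qed.
Definition hmk n F : hom A B n := exist _ (hmk_bihom n F) (hmk_sub n F).

Lemma hmkE n F i j x : j = i + n -> hc (hmk n F) i j x = F i j x.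
Proof. by move=> /eqP e; rewrite /hc /= /hc_fun /= /hmk_bihom e. Qed.

Lemma hmk_compE n (E : int -> int -> lmodType R) (g : forall i j, {linear E i j -> B j})
    (f : forall i j, {linear A i -> E i j}) i j x : j = i + n ->
  hc (hmk n (fun i j => g i j \o f i j)) i j x = g i j (f i j x).
Proof. exact: hmkE. Qed.

(** All degrees are variables tied by equations, so that the formula applies to any form in which
    the degrees occur. *)
Lemma hc_dif n m (f : hom A B n) i j k l x : n = m + 1 -> k = j + 1 -> i = l + 1 ->
  j = i + m ->
  hc (dif (hom A B) n m f) i j x =
  dif B k j (hc f i k x) - sg R n *: hc f l j (dif A i l x).
Proof.
move=> nm -> il ji; rewrite -[LHS]/(homm_fun (homC_bidif n m (val (f : homC_obj _ _ _ _)) i j) x).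
have -> : l = i - 1 by lia.
rewrite /homC_bidif; have -> : (n == m + 1) && (j == i + m) = true.
  by rewrite nm ji !eqxx.
rewrite -[LHS]/(dif B (j + 1) j (hc f i (j + 1) x)
   - hc f (i - 1) j (dif A i (i - 1) (sg R n *: x))).
by rewrite !linearZ.
Qed.

Lemma hc_idm n (f : hom A B n) i j k x : i = k -> hc f k j (idm A i k x) = hc f i j x.
Proof. by move=> e; case: _ / e; rewrite idm_id. Qed.

Lemma hcyc n (f : hom A B n) : cyc f <->
  forall i j k l x, k = j + 1 -> i = l + 1 -> k = i + n ->
    dif B k j (hc f i k x) = sg R n *: hc f l j (dif A i l x).
Proof.
split=> [cf i j k l x kj il ji|e].
  apply/eqP; rewrite -subr_eq0; apply/eqP.
  rewrite -(@hc_dif n (n - 1)) ?cf ?hc0 //; lia.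
apply: (cycE (j := n - 1)); first lia.
apply: hcP => i j x ji; rewrite hc0 (@hc_dif _ _ _ _ _ (j + 1) (i - 1)); try lia.
rewrite (e _ _ _ (i - 1)) ?subrr //; lia.
Qed.

Lemma hbnd n m (f : hom A B n) (g : hom A B m) : m = n + 1 ->
  (forall i j k l x, k = j + 1 -> i = l + 1 -> j = i + n ->
    hc f i j x = dif B k j (hc g i k x) - sg R m *: hc g l j (dif A i l x)) ->
  dif (hom A B) m n g = f.
Proof.
move=> mn e; apply: hcP => i j x ji.
rewrite (@hc_dif _ _ _ _ _ (j + 1) (i - 1)) //; last lia.
by rewrite (e _ _ (j + 1) (i - 1)) //; lia.
Qed.
End Coefficients.

Section Functors.
Variable R : comPzRingType.
Implicit Types A B C : complex R.

Section Pre.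
Variables (A B C : complex R) (u : chain_map A B).
Definition hpre_bihom n (f : hom B C n) : bihom idfun A C := fun i j =>
  homm_pre (u i) ((val (f : homC_obj idfun B C n) : bihom _ _ _) i j).
Fact hpre_sub n f : @hpre_bihom n f \in homC_sub idfun A C n.
Proof. by apply/asboolP => i j ne; apply: hommP => x; apply: (hc_ne f (u i x) ne). Qed.
Definition hpre_fun n (f : hom B C n) : hom A C n := exist _ (hpre_bihom f) (hpre_sub f).
Lemma hc_hpre n f i j x : hc (@hpre_fun n f) i j x = hc f i j (u i x).
Proof. by []. Qed.
Fact hpre_linear n : linear (@hpre_fun n).
Proof. by move=> a x y; apply: hcP => i j z _; rewrite hcDE hcZ !hc_hpre hcDE hcZ. Qed.
HB.instance Definition _ n := GRing.isLinear.Build R (hom B C n) (hom A C n)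
  *:%R (@hpre_fun n) (@hpre_linear n).
Fact hpre_comm n m f : dif (hom A C) n m ((@hpre_fun n : {linear _ -> _}) f) =
  (@hpre_fun m : {linear _ -> _}) (dif (hom B C) n m f).
Proof.
have [e|ne] := eqVneq n (m + 1); last by rewrite !dif_shape ?linear0.
apply: hcP => i j x ji; rewrite hc_hpre.
rewrite !(@hc_dif _ _ _ _ _ _ _ _ (j + 1) (i - 1)) ?hc_hpre -?chain_comm //; lia.
Qed.
Definition hpre : chain_map (hom B C) (hom A C) := ChainMap hpre_comm.
Lemma hpreE n f i j x : hc (hpre n f) i j x = hc f i j (u i x). Proof. by []. Qed.
End Pre.

Section Post.
Variables (A B C : complex R) (u : chain_map B C).
Definition hpost_fun n (f : hom A B n) : hom A C n :=
  hmk n (fun i j => u j \o hc f i j).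
Lemma hc_hpost n f i j x : hc (@hpost_fun n f) i j x = u j (hc f i j x).
Proof.
have [e|ne] := eqVneq j (i + n); first by rewrite hmkE.
by rewrite !hc_ne // linear0.
Qed.
Fact hpost_linear n : linear (@hpost_fun n).
Proof. by move=> a x y; apply: hcP => i j z _; rewrite hcDE hcZ !hc_hpost hcDE hcZ linearP. Qed.
HB.instance Definition _ n := GRing.isLinear.Build R (hom A B n) (hom A C n)
  *:%R (@hpost_fun n) (@hpost_linear n).
Fact hpost_comm n m f : dif (hom A C) n m ((@hpost_fun n : {linear _ -> _}) f) =
  (@hpost_fun m : {linear _ -> _}) (dif (hom A B) n m f).
Proof.
have [e|ne] := eqVneq n (m + 1); last by rewrite !dif_shape ?linear0.
apply: hcP => i j x ji; rewrite hc_hpost.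
rewrite !(@hc_dif _ _ _ _ _ _ _ _ (j + 1) (i - 1)) //; try lia.
by rewrite !hc_hpost chain_comm [RHS]linearB [X in _ = _ - X]linearZ.
Qed.
Definition hpost : chain_map (hom A B) (hom A C) := ChainMap hpost_comm.
Lemma hpostE n f i j x : hc (hpost n f) i j x = u j (hc f i j x).
Proof. exact: hc_hpost. Qed.
End Post.

(* The total complex of [A' -> A -> A''], acyclic if and only if the two     *)
(* maps form a triangle.                                                     *)
Section Tot.
Variables (A' A A'' : complex R) (a : chain_map A' A) (g : chain_map A A'').
Hypothesis ga0 : forall i x, g i (a i x) = 0.

Definition tot_obj i : lmodType R := (A' (i - 2)%R * A (i - 1)%R * A'' i)%type.
Definition tot_dif_fun i j (p : tot_obj i) : tot_obj j :=
  (dif A' (i - 2) (j - 2) p.1.1,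
   idm A (i - 2) (j - 1) (a (i - 2) p.1.1) - dif A (i - 1) (j - 1) p.1.2,
   idm A'' (i - 1) j (g (i - 1) p.1.2) + dif A'' i j p.2).
Fact tot_dif_linear i j : linear (@tot_dif_fun i j).
Proof.
move=> c x y; rewrite /tot_dif_fun /= !linearP.
apply: injective_projections; last by rewrite /= scalerDr addrACA.
by apply: injective_projections; rewrite //= scalerN scalerBr addrACA.
Qed.
HB.instance Definition _ i j := GRing.isLinear.Build R (tot_obj i) (tot_obj j)
  *:%R (@tot_dif_fun i j) (@tot_dif_linear i j).
Definition tot_dif i j : {linear tot_obj i -> tot_obj j} := @tot_dif_fun i j.
Fact tot_shape i j : i != j + 1 -> forall x, tot_dif i j x = 0.
Proof.
move=> ij x; rewrite /tot_dif /= /tot_dif_fun.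
rewrite !dif_shape ?idm_ne ?subr0 ?addr0 //;
  by apply: contra_neq ij => e; lia.
Qed.
Fact tot_dd i j k x : tot_dif j k (tot_dif i j x) = 0.
Proof.
have [ij|] := eqVneq i (j + 1); last by move/tot_shape->; rewrite linear0.
have [jk|] := eqVneq j (k + 1); last by move/tot_shape->.
rewrite /tot_dif /= /tot_dif_fun /=; congr (_, _, _).
- exact: dif_dif.
- rewrite [dif A (j - 1) _ _]linearB dif_dif subr0 dif_idm; last lia.
  by rewrite chain_comm -chain_idm idm_dif ?subrr //; lia.
- rewrite [dif A'' j _ _]linearD dif_dif addr0 dif_idm; last lia.
  rewrite (linearB (g (j - 1))) chain_idm ga0 linear0 sub0r linearN -chain_comm.
  by rewrite idm_dif ?addNr //; lia.
Qed.
Definition tot : complex R := Complex tot_shape tot_dd.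

Lemma tot_difE i j (p : tot i) : dif tot i j p =
  (dif A' (i - 2) (j - 2) p.1.1,
   idm A (i - 2) (j - 1) (a (i - 2) p.1.1) - dif A (i - 1) (j - 1) p.1.2,
   idm A'' (i - 1) j (g (i - 1) p.1.2) + dif A'' i j p.2).
Proof. by []. Qed.

Lemma tot_acyclic : triangle a g -> acyclic tot.
Proof.
move=> tri; apply/acyclicP => i [[x' x] x''] /(_ (i - 1)).
rewrite tot_difE /= => -[/cycE cx' /subr0_eq xx' /eqP].
rewrite addr_eq0 => /eqP xx''.
have {}cx' : cyc x' by apply: cx'; lia.
have {xx'} dx : dif A (i - 1) (i - 2) x = a (i - 2) x'.
  rewrite -(idm_dif (j := i - 1 - 1)) -?xx' ?idmKK //; lia.
rewrite idm_id in xx''.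
(* The cycle equations say that [x] lifts the image of [x'] and that [- x''] bounds [g x], as
   [tri_inj] requires. *)
have [||w' w'E /(bndE (j := i))[|w wE]] := tri_inj tri (x' := x') (x := x) _ cx' dx.
- lia.
- by exists i, (- x''); rewrite linearN xx''.
- lia.
have cw : cyc (x'' + g i w).
  apply: (cycE (j := i - 1)); first lia.
  by rewrite linearD chain_comm wE linearB ga0 subr0 xx'' addrN.
(* What remains is the cycle [x'' + g w], which [tri_surj] bounds after the correction by [u] and
   [u']. *)
have [|u' [u [cu' du /bndP[y'' yE]]]] := tri_surj tri (j := i - 1) _ cw.
  lia.
exists (i + 1), (idm A' (i - 1) (i + 1 - 2) (w' + u'),
                 idm A i (i + 1 - 1) (u - w), y'').
rewrite tot_difE /= !dif_idm ?chain_idm ?idmK; try lia.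
congr (_, _, _).
- by rewrite linearD w'E cu' addr0.
- rewrite linearB wE du idm_id linearD opprB.
  by rewrite -[x - _ - _]addrA -opprD [LHS]addrC subrK.
- by rewrite yE idm_id linearB addrC addrA subrK addrK.
Qed.
End Tot.
End Functors.
Global Opaque hc hpre hpost homC.

Section HomTriangle.
Variables (R : comPzRingType) (A' A A'' I : complex R).
Variables (a : chain_map A' A) (g : chain_map A A'').
Hypothesis ga0 : forall i x, g i (a i x) = 0.
Local Notation T := (tot ga0).

Section Comb.
Variables (n n1 n2 : int) (u : hom A'' I n) (v : hom A I n1) (w : hom A' I n2).
(** The degrees of [u], [v], [w] increase by one each, because the summands of [T] are shifted by 0,
    1 and 2. *)
Definition tot_comb_fun i j (p : T i) : I j :=
  hc u i j p.2 + hc v (i - 1) j p.1.2 + hc w (i - 2) j p.1.1.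
Fact tot_comb_linear i j : linear (@tot_comb_fun i j).
Proof.
move=> c p q; rewrite /tot_comb_fun /= !linearP /= !scalerDr.
rewrite [X in X + _ = _]addrACA [LHS]addrACA; reflexivity.
Qed.
HB.instance Definition _ i j := GRing.isLinear.Build R (T i) (I j)
  *:%R (@tot_comb_fun i j) (@tot_comb_linear i j).
Definition tot_comb : hom T I n := hmk n (fun i j => @tot_comb_fun i j).
Lemma tot_combE i j p : j = i + n -> hc tot_comb i j p =
  hc u i j p.2 + hc v (i - 1) j p.1.2 + hc w (i - 2) j p.1.1.
Proof. by move=> ji; rewrite hmkE. Qed.
End Comb.

Lemma tot_comb_dif m n n1 n2 (u : hom A'' I n) (v : hom A I n1) (w : hom A' I n2) :
    n = m + 1 -> n1 = n + 1 -> n2 = n1 + 1 ->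
  dif (hom T I) n m (tot_comb u v w) =
  tot_comb (dif _ n m u) (dif _ n1 n v - sg R n *: hpre I g n u)
    (dif _ n2 n1 w - sg R n *: hpre I a n1 v).
Proof.
move=> nm n1n n2n; apply: hcP => i j [[x' x] x''] ji.
have s1 := sgS R n1n; have s2 := sgS R n2n.
rewrite (hc_dif _ (k := j + 1) (l := i - 1)) // ; try lia.
rewrite !tot_combE ?tot_difE /=; try lia.
rewrite !(hcB (dif _ _ _ _)) !(hcZ _ (hpre _ _ _ _)).
rewrite (hpreE g u) (hpreE a v).
rewrite (hc_dif u (k := j + 1) (l := i - 1)) //; try lia.
rewrite (hc_dif v (k := j + 1) (l := i - 1 - 1)) //; try lia.
rewrite (hc_dif w (k := j + 1) (l := i - 1 - 2)) //; try lia.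
rewrite !linearD (linearN (hc v _ _)) ?scalerDr (hc_idm u (i := i - 1)) //.
rewrite (hc_idm v (i := i - 2)) ; last lia.
rewrite s2 s1 opprK /= !scaleNr !scalerN.
zmod.
Qed.

Lemma tot_combP n n1 n2 (f : hom T I n) : n1 = n + 1 -> n2 = n1 + 1 ->
  exists (u : hom A'' I n) (v : hom A I n1) (w : hom A' I n2), f = tot_comb u v w.
Proof.
move=> n1n n2n.
pose in2 i (x : A'' i) : T i := (0, 0, x).
have in2_lin i : linear (@in2 i).
  by move=> c x y; rewrite /in2; apply: injective_projections => //=;
    apply: injective_projections; rewrite /= ?scaler0 ?addr0.
pose in1 i (x : A (i - 1)) : T i := (0, x, 0).
have in1_lin i : linear (@in1 i).
  by move=> c x y; rewrite /in1; apply: injective_projections => //=;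
    [apply: injective_projections; rewrite /= ?scaler0 ?addr0|rewrite scaler0 addr0].
pose in0 i (x : A' (i - 2)) : T i := (x, 0, 0).
have in0_lin i : linear (@in0 i).
  by move=> c x y; rewrite /in0; apply: injective_projections => //=;
    [apply: injective_projections; rewrite /= ?scaler0 ?addr0|rewrite scaler0 addr0].
pose L2 i := GRing.isLinear.Build R _ _ _ _ (in2_lin i).
pose l2 i : {linear A'' i -> T i} := HB.pack (@in2 i) (L2 i).
pose L1 i := GRing.isLinear.Build R _ _ _ _ (in1_lin i).
pose l1 i : {linear A (i - 1) -> T i} := HB.pack (@in1 i) (L1 i).
pose L0 i := GRing.isLinear.Build R _ _ _ _ (in0_lin i).
pose l0 i : {linear A' (i - 2) -> T i} := HB.pack (@in0 i) (L0 i).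
exists (hmk n (fun i j => hc f i j \o l2 i)).
exists (hmk n1 (fun i j => hc f (i + 1) j \o (l1 (i + 1) \o idm A i (i + 1 - 1)))).
exists (hmk n2 (fun i j => hc f (i + 2) j \o (l0 (i + 2) \o idm A' i (i + 2 - 2)))).
apply: hcP => i j [[x' x] x''] ji; rewrite tot_combE //= !hmkE /=; try lia.
have -> : hc f (i - 1 + 1) j (in1 (i - 1 + 1) (idm A (i - 1) (i - 1 + 1 - 1) x))
   = hc f i j (in1 i x).
  have -> : in1 (i - 1 + 1) (idm A (i - 1) (i - 1 + 1 - 1) x)
     = idm T i (i - 1 + 1) (in1 i x).
    have e : i = i - 1 + 1 by lia.
    by case: _ / e; rewrite !idm_id.
  by rewrite hc_idm //; lia.
have -> : hc f (i - 2 + 2) j (in0 (i - 2 + 2) (idm A' (i - 2) (i - 2 + 2 - 2) x'))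
   = hc f i j (in0 i x').
  have -> : in0 (i - 2 + 2) (idm A' (i - 2) (i - 2 + 2 - 2) x')
     = idm T i (i - 2 + 2) (in0 i x').
    have e : i = i - 2 + 2 by lia.
    by case: _ / e; rewrite !idm_id.
  by rewrite hc_idm //; lia.
rewrite -!linearD; congr (hc f i j _); rewrite /in2 /in1 /in0.
by apply: injective_projections; [apply: injective_projections|];
  rewrite /= ?addr0 ?add0r.
Qed.

Lemma tot_comb_inj n n1 n2 (u u' : hom A'' I n) (v v' : hom A I n1) (w w' : hom A' I n2) :
  n1 = n + 1 -> n2 = n1 + 1 ->
  tot_comb u v w = tot_comb u' v' w' -> [/\ u = u', v = v' & w = w'].
Proof.
move=> n1n n2n e.
have {}e i j p : j = i + n -> hc (tot_comb u v w) i j p = hc (tot_comb u' v' w') i j p.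
  by rewrite e.
split; apply: hcP => i j x ji.
- have := e i j (0, 0, x); rewrite !tot_combE //= !linear0 !addr0; exact.
- have := e (i + 1) j (0, idm A i (i + 1 - 1) x, 0).
  by rewrite !tot_combE /= ?linear0 ?addr0 ?add0r ?hc_idm //; try lia; apply; lia.
- have := e (i + 2) j (idm A' i (i + 2 - 2) x, 0, 0).
  by rewrite !tot_combE /= ?linear0 ?addr0 ?add0r ?hc_idm //; try lia; apply; lia.
Qed.

(** The complex Hom(T, I) is acyclic, and in components it is the total complex of the dual
    sequence. [key] is its exactness in components; [tri_surj] is the instance with two zero
    components, and [tri_inj] the general one. *)
Lemma K_injective_triangle : K_injective I -> triangle a g ->
  triangle (hpre I g) (hpre I a).
Proof.
move=> KI tri; have /acyclicP aT := KI T (@tot_acyclic _ _ _ _ a g ga0 tri).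
have key m n n1 n2 (u : hom A'' I m) (v : hom A I n) (w : hom A' I n1) :
    n = m + 1 -> n1 = n + 1 -> n2 = n1 + 1 -> cyc u ->
    dif (hom A I) n m v = sg R m *: hpre I g m u ->
    dif (hom A' I) n1 n w = sg R m *: hpre I a n v ->
  exists (u1 : hom A'' I n) (v1 : hom A I n1) (w1 : hom A' I n2),
    [/\ u = dif _ n m u1, v = dif _ n1 n v1 - sg R n *: hpre I g n u1 &
        w = dif _ n2 n1 w1 - sg R n *: hpre I a n1 v1].
  move=> nm n1n n2n cu dv dw.
  have /bndE-/(_ n nm)[f] : bnd (tot_comb u v w).
    apply: aT; apply: (cycE (j := m - 1)); first lia.
    rewrite (tot_comb_dif (n := m) (n1 := n) (n2 := n1)) //; last lia.
    rewrite cu dv dw !subrr; apply: hcP => i j p ji.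
    by rewrite tot_combE // !hc0 !addr0.
  have [u1 [v1 [w1 ->]]] := tot_combP f n1n n2n.
  rewrite tot_comb_dif //; case/tot_comb_inj=> // <- <- <-.
  by exists u1, v1, w1.
split.
- by move=> n f; apply: hcP => i j x _; rewrite !hpreE ga0 linear0 hc0.
- move=> i j z ij cz.
  have [|||||u1 [v1 [w1 [u0 v0 w0]]]] := @key (j - 1) j i (i + 1) 0 0 z _ _ _ (@cyc0 _ _ _).
  + lia.
  + lia.
  + by [].
  + by rewrite !linear0.
  + by rewrite cz !linear0.
  move/eqP: v0; rewrite eq_sym subr_eq0 => /eqP v0.
  exists (- u1), (- (sg R j *: v1)); split.
  + by apply/cycN/(cycE (j := j - 1)); [lia|].
  + by rewrite !linearN linearZ /= v0 sgK.
  + exists (i + 1), w1; rewrite w0 (linN (hpre I a i)) (linZ (hpre I a i)); zmod.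
- move=> i j u v ij cu dv /bndP[w wE].
  (* The sign on [v] turns the given equation into the cycle condition for the combination. *)
  have [||u1 [v1 [w1 [u0 v0 w0]]]] :=
    @key j i (i + 1) (i + 1 + 1) u (sg R j *: v) w ij erefl erefl cu.
  + by rewrite linearZ /= dv.
  + by rewrite wE linearZ /= sgK.
  exists u1 => //; exists (i + 1), (sg R j *: v1).
  rewrite linearZ /= -[v in RHS](sgK j) v0 scalerBr.
  rewrite (sgS R ij) scaleNr scalerN sgK; zmod.
Qed.
End HomTriangle.

Lemma K_triangle (R : comPzRingType) (A' A A'' I : complex R) (a : chain_map A' A)
  (g : chain_map A A'') :
  K_injective I -> triangle a g -> triangle (hpre I g) (hpre I a).
Proof. by move=> KI tri; apply: K_injective_triangle => //; apply: tri_comp tri. Qed.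

Record mulset (R : comPzRingType) := Mulset {
  ms_pred :> R -> Prop;
  ms1 : ms_pred 1;
  msM : forall s t, ms_pred s -> ms_pred t -> ms_pred (s * t)
}.

(** * Homology that vanishes near a prime *)

Section UpToMulset.
Variables (R : comPzRingType) (U : mulset R).
Implicit Types (A B : complex R) (i j : int).

(** Being a boundary after inverting [U], without forming the localization. For [U] the complement
    of a maximal ideal this is vanishing near that ideal; the multiplier may depend on the cycle. *)
Definition ubnd A i (z : A i) := exists2 s, U s & bnd (s *: z).
Definition unull A i := forall z : A i, cyc z -> ubnd z.

Lemma bnd_ubnd A i (z : A i) : bnd z -> ubnd z.
Proof. by move=> bz; exists 1; rewrite ?scale1r //; apply: ms1. Qed.
Lemma ubndD A i (x y : A i) : ubnd x -> ubnd y -> ubnd (x + y).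
Proof.
move=> [s Us bx] [t Ut bt]; exists (t * s); first exact: msM.
by rewrite scalerDr -scalerA mulrC -scalerA; apply: bndD; apply: bndZ.
Qed.
Lemma ubndZ A i a (x : A i) : ubnd x -> ubnd (a *: x).
Proof. by move=> [s Us bx]; exists s; rewrite // scalerA mulrC -scalerA; apply: bndZ. Qed.
Lemma ubndN A i (x : A i) : ubnd x -> ubnd (- x).
Proof. by rewrite -scaleN1r; apply: ubndZ. Qed.
Lemma ubndB A i (x y : A i) : ubnd x -> ubnd y -> ubnd (x - y).
Proof. by move=> bx /ubndN; apply: ubndD. Qed.
Lemma ubnd_congr A i (x y : A i) : bnd (x - y) -> ubnd x -> ubnd y.
Proof. by move=> /bnd_ubnd xy bx; rewrite -(subKr x y); apply: ubndB. Qed.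
Lemma ubndS A i s (x : A i) : U s -> ubnd (s *: x) -> ubnd x.
Proof. by move=> Us [t Ut]; rewrite scalerA; exists (t * s) => //; apply: msM. Qed.
Lemma chain_ubnd A B (f : chain_map A B) i (x : A i) : ubnd x -> ubnd (f i x).
Proof. by move=> [s Us bx]; exists s; rewrite // -lZ; apply: chain_bnd. Qed.

Lemma quasi_iso_unull A B (f : chain_map A B) i : quasi_iso f -> unull A i <-> unull B i.
Proof.
case/quasi_isoP => fi fs; split=> n z cz.
  have [y cy zy] := fs i z cz; apply: ubnd_congr (bndBC zy) _.
  exact/chain_ubnd/n.
have [s Us bz] := n _ (chain_cyc f cz); exists s => //.
by apply: fi; [apply: cycZ|rewrite lZ].
Qed.

Section Triangle.
Variables (A' A A'' : complex R) (a : chain_map A' A) (g : chain_map A A'').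
Hypothesis tri : triangle a g.

Lemma tri_uexact i (x : A i) : cyc x -> ubnd (g i x) ->
  exists s y, [/\ U s, cyc y & bnd (s *: x - a i y)].
Proof.
move=> cx [s Us bx]; rewrite -lZ in bx.
by have [y cy xy] := tri_exact tri (cycZ s cx) bx; exists s, y.
Qed.

Lemma unull_mid i : unull A' i -> unull A'' i -> unull A i.
Proof.
move=> n' n'' x cx; have [s [y [Us cy xy]]] := tri_uexact cx (n'' _ (chain_cyc g cx)).
by apply: (ubndS Us); apply: ubnd_congr (bndBC xy) _; apply/chain_ubnd/n'.
Qed.

Lemma tri_lift i j (z : A'' i) : i = j + 1 -> unull A' j -> cyc z ->
  exists s x, [/\ U s, cyc x & bnd (s *: z - g i x)].
Proof.
move=> ij n' cz; have [x' [x [cx' dx bx]]] := tri_surj tri ij cz.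
have [s Us /(bndE ij)[w wE]] := n' _ cx'.
exists s, (s *: x - a i w); split=> //.
  by apply: (cycE ij); rewrite lB lZ dx chain_comm wE lZ subrr.
by rewrite lB (tri_comp tri) subr0 lZ -scalerBr; apply: bndZ.
Qed.

Lemma unull_right i j : i = j + 1 -> unull A i -> unull A' j -> unull A'' i.
Proof.
move=> ij n n' z cz; have [s [x [Us cx xz]]] := tri_lift ij n' cz.
by apply: (ubndS Us); apply: ubnd_congr (bndBC xz) _; apply/chain_ubnd/n.
Qed.

End Triangle.
End UpToMulset.

(** * Noetherian rings and finite generation of homology in triangles *)

Section FinGen.
Variables (R : comPzRingType) (noethR : noetherian R).

Lemma noeth_ideal (P : R -> Prop) :
  P 0 -> (forall a x y, P x -> P y -> P (a * x + y)) ->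
  exists n (e : 'I_n -> R), (forall k, P (e k)) /\
    forall x, P x -> exists c : 'I_n -> R, x = \sum_k c k * e k.
Proof.
move=> P0 Plin; pose p : {pred R^o} := [pred x | `[< P x >]].
have pc : submod_closed p.
  split=> [|a x y /asboolP px /asboolP py]; apply/asboolP => //; exact: Plin.
have [n [e eP]] := noethR (SubmodulePred pc).
exists n, (fun k => val (e k)); split=> [k|x Px].
  by have /asboolP := valP (e k).
have px : x \in p by apply/asboolP.
have [c xE] := eP (exist _ x px); exists c.
rewrite -[LHS]/(val (exist _ x px : subm (SubmodulePred pc))) xE.
by rewrite (big_morph (fun u : subm (SubmodulePred pc) => val u) (id1 := 0) (op1 := +%R)).
Qed.

(** Submodules of a finite free module are finitely generated: lifts [v] of generators of the ideal
    of first coordinates, together with generators [w] of the part with zero first coordinate,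
    obtained by induction. *)
Lemma noeth_pow n (W : ('I_n -> R) -> Prop) :
  W (fun=> 0) -> (forall a x y, W x -> W y -> W (fun k => a * x k + y k)) ->
  exists p (w : 'I_p -> 'I_n -> R), (forall l, W (w l)) /\
    forall c, W c -> exists a : 'I_p -> R, forall k, c k = \sum_l a l * w l k.
Proof.
elim: n W => [|n IHn] W W0 Wlin.
  exists 0, (fun l _ => 0); split=> [[]//|c _]; exists (fun=> 0).
  by case.
have [|a x y [cx Wx xE] [cy Wy yE]|p [e [eW eP]]] :=
  @noeth_ideal (fun a => exists2 c, W c & c ord0 = a).
- by exists (fun=> 0).
- by exists (fun k => a * cx k + cy k); [apply: Wlin|rewrite xE yE].
pose ext (c : 'I_n -> R) (k : 'I_n.+1) := if unlift ord0 k is Some l then c l else 0.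
have [||q [w [wW wP]]] := IHn (fun c => W (ext c)).
- by have -> : ext (fun=> 0) = (fun=> 0) by apply/funext => k; rewrite /ext; case: unlift.
- move=> a x y Wx Wy.
  have -> : ext (fun k => a * x k + y k) = (fun k => a * ext x k + ext y k).
    by apply/funext => k; rewrite /ext; case: unlift => //; rewrite mulr0 addr0.
  exact: Wlin.
have /choice[v vP] k : exists c, W c /\ c ord0 = e k.
  by have [c Wc cE] := eW k; exists c.
have Wsum m (b : 'I_m -> R) (x : 'I_m -> 'I_n.+1 -> R) :
    (forall l, W (x l)) -> W (fun k => \sum_l b l * x l k).
  elim: m b x => [|m IHm] b x Wx.
    by have -> : (fun k => \sum_(l < 0) b l * x l k) = (fun=> 0)
      by apply/funext => k; rewrite big_ord0.
  have -> : (fun k => \sum_(l < m.+1) b l * x l k) =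
      (fun k => b ord0 * x ord0 k + \sum_(l < m) b (lift ord0 l) * x (lift ord0 l) k).
    by apply/funext => k; rewrite big_ord_recl.
  by apply: Wlin => //; apply: IHm => l; apply: Wx.
exists (p + q)%N, (fun l => match split l with inl l => v l | inr l => ext (w l) end).
split=> [l|c Wc].
  by case: split => l'; [have [] := vP l'|apply: wW].
have [|a aE] := eP (c ord0); first by exists c.
have [|b bE] := wP (fun k => c (lift ord0 k) - \sum_l a l * v l (lift ord0 k)).
  have -> : ext (fun k => c (lift ord0 k) - \sum_l a l * v l (lift ord0 k)) =
      (fun k => (-1) * (\sum_l a l * v l k) + c k).
    apply/funext => k; rewrite mulN1r addrC /ext.
    case: unliftP => [j ->|->] //; rewrite aE.
    apply/esym/eqP; rewrite subr_eq0; apply/eqP; apply: eq_bigr => l _.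
    by have [_ ->] := vP l.
  by apply: Wlin => //; apply: Wsum => l; have [] := vP l.
exists (fun l => match split l with inl l => a l | inr l => b l end) => k.
rewrite big_split_ord /=.
under eq_bigr => l _ do rewrite (unsplitK (inl l : 'I_p + 'I_q)).
under [X in _ + X]eq_bigr => l _ do rewrite (unsplitK (inr l : 'I_p + 'I_q)).
case: (unliftP ord0 k) => [j ->|->].
  have -> : \sum_(l < q) b l * ext (w l) (lift ord0 j) =
     c (lift ord0 j) - \sum_l a l * v l (lift ord0 j).
    by rewrite bE; apply: eq_bigr => l _; rewrite /ext liftK.
  by rewrite addrC subrK.
rewrite [X in _ + X]big1 ?addr0 => [|l _]; last by rewrite /ext unlift_none mulr0.
by rewrite aE; apply: eq_bigr => l _; have [_ ->] := vP l.
Qed.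

Lemma noeth_relations (M : lmodType R) r (e : 'I_r -> M) :
  exists p (w : 'I_p -> 'I_r -> R), (forall l, \sum_t w l t *: e t = 0) /\
    forall c, \sum_t c t *: e t = 0 -> exists a : 'I_p -> R, forall k, c k = \sum_l a l * w l k.
Proof.
apply: (noeth_pow (W := fun c => \sum_t c t *: e t = 0)) => [|a x y ax ay].
  by rewrite big1 // => t _; rewrite scale0r.
transitivity (a *: \sum_t x t *: e t + \sum_t y t *: e t); last by rewrite ax ay scaler0 addr0.
rewrite scaler_sumr -big_split; apply: eq_bigr => t _ /=.
by rewrite scalerDl scalerA.
Qed.

Definition fgh (A : complex R) i := exists n (e : 'I_n -> A i),
  (forall k, cyc (e k)) /\
  forall z, cyc z -> exists c : 'I_n -> R, bnd (z - \sum_k c k *: e k).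

Lemma fgh_null (A : complex R) i : (forall z : A i, cyc z -> bnd z) -> fgh A i.
Proof.
move=> b; exists 0, (fun=> 0); split=> [[]//|z cz]; exists (fun=> 0).
by rewrite big_ord0 subr0; apply: b.
Qed.

(** An extension argument: the classes related to zero are generated by [e], and the image in the
    homology of [B] is finitely generated because the ring is noetherian. Lifts of generators of the
    image complete [e]. *)
Lemma fgh_rel (A B : complex R) i j (Rel : A i -> B j -> Prop) :
    (forall a x y x' y', Rel x y -> Rel x' y' -> Rel (a *: x + x') (a *: y + y')) ->
    (forall x, cyc x -> exists2 y, cyc y & Rel x y) ->
    (exists n (e : 'I_n -> A i), (forall k, cyc (e k)) /\
       forall x y, cyc x -> Rel x y -> bnd y ->
       exists c : 'I_n -> R, bnd (x - \sum_k c k *: e k)) ->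
  fgh B j -> fgh A i.
Proof.
move=> Rlin Rtot [n [e [ce eP]]] [m [f [cf fP]]].
have [y0 _ Ry0] := Rtot 0 (@cyc0 _ _ _).
have R00 : Rel 0 0.
  by have := Rlin (-1) _ _ _ _ Ry0 Ry0; rewrite scaler0 addr0 scaleN1r addNr.
(* The coefficient vectors of the classes in the image, a submodule of a finite free module. *)
pose W (c : 'I_m -> R) := exists x y,
  [/\ cyc x, Rel x y & bnd (y - \sum_k c k *: f k)].
have [||p [w [wW wP]]] := @noeth_pow m W.
- exists 0, 0; split=> //; first exact: cyc0.
  by rewrite big1 ?subr0 => [|k _]; [apply: bnd0|rewrite scale0r].
- move=> a c c' [x [y [cx Rxy by_]]] [x' [y' [cx' Rxy' by_']]].
  exists (a *: x + x'), (a *: y + y'); split; first exact/cycD/cx'/cycZ.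
    exact: Rlin.
  have -> : \sum_k (a * c k + c' k) *: f k =
      a *: (\sum_k c k *: f k) + \sum_k c' k *: f k.
    rewrite scaler_sumr -big_split; apply: eq_bigr => k _.
    by rewrite scalerDl scalerA.
  by rewrite opprD addrACA -scalerBr; apply/bndD/by_'/bndZ.
have /choice[xy xyP] l : exists xy : A i * B j,
    [/\ cyc xy.1, Rel xy.1 xy.2 & bnd (xy.2 - \sum_k w l k *: f k)].
  by have [x [y]] := wW l; exists (x, y).
have Rsum c : Rel (\sum_(l < p) c l *: (xy l).1) (\sum_(l < p) c l *: (xy l).2).
  elim/big_rec2: _ => // l y x _ Rxy; apply: Rlin => //.
  by have [] := xyP l.
exists (n + p)%N, (fun k => match split k with inl k => e k | inr k => (xy k).1 end).
split=> [k|z cz]; first by case: split => k' //; have [] := xyP k'.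
have [y cy Rzy] := Rtot z cz; have [c cE] := fP y cy.
have [|b bE] := wP c; first by exists z, y.
have Rz : Rel (z - \sum_(l < p) b l *: (xy l).1) (y - \sum_(l < p) b l *: (xy l).2).
  have := Rlin (-1) _ _ _ _ (Rsum b) Rzy.
  by rewrite !scaleN1r addrC [X in Rel _ X]addrC.
have [||a aE] := eP _ _ _ Rz.
- by apply: cycB => //; apply: cyc_sum => l; apply: cycZ; have [] := xyP l.
- apply: bnd_trans cE _.
  have -> : \sum_k c k *: f k = \sum_(l < p) b l *: (\sum_k w l k *: f k).
    under [RHS]eq_bigr => l _ do rewrite scaler_sumr.
    rewrite exchange_big /=; apply: eq_bigr => k _; rewrite bE scaler_suml.
    by apply: eq_bigr => l _; rewrite scalerA.
  rewrite -sumrB; apply: bnd_sum => l; rewrite -scalerBr; apply/bndZ/bndBC.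
  by have [] := xyP l.
exists (fun k => match split k with inl k => a k | inr k => b k end).
rewrite big_split_ord /=.
have -> : \sum_(l < n) match split (lshift p l) with inl k => a k | inr k => b k end *:
    match split (lshift p l) with inl k => e k | inr k => (xy k).1 end = \sum_l a l *: e l.
  by apply: eq_bigr => l _; rewrite (unsplitK (inl l : 'I_n + 'I_p)).
have -> : \sum_(l < p) match split (rshift n l) with inl k => a k | inr k => b k end *:
    match split (rshift n l) with inl k => e k | inr k => (xy k).1 end = \sum_l b l *: (xy l).1.
  by apply: eq_bigr => l _; rewrite (unsplitK (inr l : 'I_n + 'I_p)).
have -> : z - (\sum_(l < n) a l *: e l + \sum_(l < p) b l *: (xy l).1) =
    z - \sum_(l < p) b l *: (xy l).1 - \sum_(l < n) a l *: e l by zmod.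
exact: aE.
Qed.

Lemma fgh_map (A B : complex R) i j (p : {linear A i -> B j}) :
    (forall x, cyc x -> cyc (p x)) ->
    (forall x, cyc x -> bnd (p x) -> bnd x) -> fgh B j -> fgh A i.
Proof.
move=> pc pb; apply: (@fgh_rel _ _ _ _ (fun x y => y = p x)).
- by move=> a x y x' y' -> ->; rewrite (linD p) (linZ p).
- by move=> x cx; exists (p x) => //; apply: pc.
- exists 0, (fun=> 0); split=> [[]//|x y cx -> bp]; exists (fun=> 0).
  by rewrite big_ord0 subr0; apply: pb.
Qed.

Section Triangle.
Variables (A' A A'' : complex R) (a : chain_map A' A) (g : chain_map A A'').
Hypothesis tri : triangle a g.

Lemma fgh_mid i : fgh A' i -> fgh A'' i -> fgh A i.
Proof.
move=> [n [e [ce eP]]]; apply: (@fgh_rel _ _ _ _ (fun x y => y = g i x)).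
- by move=> c x y x' y' -> ->; rewrite lD lZ.
- by move=> x cx; exists (g i x) => //; apply: chain_cyc.
- exists n, (fun k => a i (e k)); split=> [k|x y cx -> bx]; first exact: chain_cyc.
  have [y' cy' xy'] := tri_exact tri cx bx; have [c cE] := eP _ cy'; exists c.
  apply: bnd_trans xy' _; have -> : \sum_k c k *: a i (e k) = a i (\sum_k c k *: e k).
    by rewrite lS; apply: eq_bigr => k _; rewrite lZ.
  by rewrite -lB; apply: chain_bnd.
Qed.

Lemma fgh_left i j : i = j + 1 -> fgh A j -> fgh A'' i -> fgh A' j.
Proof.
move=> ij fA [n [e [ce eP]]]; move: fA.
(* [v k] is the value of the connecting homomorphism on [e k]; these values generate the kernel of
   the map to the homology of [A]. *)
have /choice[v vP] k : exists v : A' j, cyc v /\ exists2 x : A i,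
    dif A i j x = a j v & bnd (e k - g i x).
  have [x' [x [cx' dx ex]]] := tri_surj tri ij (ce k).
  by exists x'; split=> //; exists x.
apply: (@fgh_rel _ _ _ _ (fun x y => y = a j x)).
- by move=> c x y x' y' -> ->; rewrite lD lZ.
- by move=> x cx; exists (a j x) => //; apply: chain_cyc.
- exists n, v; split=> [k|x' y cx' ->]; first by have [] := vP k.
  move=> /(bndE ij)[x xE].
  have [|c cE] := eP (g i x).
    by apply: (cycE ij); rewrite chain_comm xE (tri_comp tri).
  exists c.
  have /choice[t tP] k : exists t : A i, dif A i j t = a j (v k) /\ bnd (e k - g i t).
    by have [_ [t]] := vP k; exists t.
  have [|||w' <- _] := tri_inj tri (x' := x' - \sum_k c k *: v k)
    (x := x - \sum_k c k *: t k) ij _ _ _; last exact: bnd_dif.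
  + apply: cycB => //; apply: cyc_sum => k; apply: cycZ; by have [] := vP k.
  + rewrite !lB xE !lS; congr (_ - _); apply: eq_bigr => k _.
    by rewrite !lZ; have [->] := tP k.
  + rewrite lB lS; apply: bnd_trans cE _; rewrite -sumrB.
    by apply: bnd_sum => k; rewrite lZ -scalerBr; apply: bndZ; have [] := tP k.
Qed.
End Triangle.
End FinGen.

(** * Exactness and shifts of Hom complexes *)

Section Hom.
Variable R : comPzRingType.
Implicit Types (A B C I P : complex R).

Section Split.
Variables (A' A A'' I : complex R) (a : chain_map A' A) (g : chain_map A A'').
Variables (r : forall i, {linear A i -> A' i}) (s : forall i, {linear A'' i -> A i}).
Hypothesis ex : exact_seq a g.
Hypothesis ra : forall i x, r i (a i x) = x.
Hypothesis gs : forall i x, g i (s i x) = x.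

Lemma hpre_exact : exact_seq (hpre I g) (hpre I a).
Proof.
split=> n.
- move=> f f0; apply: hcP => i j x ji.
  by have := congr1 (fun h => hc h i j (s i x)) f0; rewrite /= hpreE gs !hc0.
- by move=> f; apply: hcP => i j x _; rewrite !hpreE (ex_comp ex) linear0 hc0.
- move=> f f0; exists (hmk n (fun i j => hc f i j \o s i)).
  apply: hcP => i j x ji; rewrite hpreE hmkE //=.
  have [|y yE] := ex_mid ex (i := i) (x := x - s i (g i x)).
    by rewrite chB gs subrr.
  rewrite -[x in LHS](subrK (s i (g i x))) yE linearD.
  by have := congr1 (fun h => hc h i j y) f0; rewrite /= hpreE hc0 => ->; rewrite add0r.
- move=> f; exists (hmk n (fun i j => hc f i j \o r i)).
  by apply: hcP => i j x ji; rewrite hpreE hmkE //= ra.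
Qed.
End Split.

Lemma hpost_exact P A' A A'' (a : chain_map A' A) (g : chain_map A A'') :
    (forall i, projective (P i)) -> exact_seq a g ->
  exact_seq (hpost P a) (hpost P g).
Proof.
move=> pP ex; split=> n.
- move=> f f0; apply: hcP => i j x ji; rewrite hc0; apply: (ex_inj ex).
  by have := congr1 (fun h => hc h i j x) f0; rewrite /= hpostE.
- by move=> f; apply: hcP => i j x _; rewrite !hpostE (ex_comp ex).
- move=> f f0.
  have FE i j : exists h : {linear P i -> A' j}, forall x, a j (h x) = hc f i j x.
    have /choice[h hP] x : exists y, a j y = hc f i j x.
      have [|y ->] := ex_mid ex (i := j) (x := hc f i j x); last by exists y.
      by have := congr1 (fun h => hc h i j x) f0; rewrite /= hpostE hc0.
    have hl : linear h.
      move=> c x y; apply/subr0_eq/(ex_inj ex).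
      by rewrite chB chD chZ !hP linearP subrr.
    by exists (mklin hl) => x; rewrite mklinE.
  exists (hmk n (fun i j => sval (cid (FE i j)))); apply: hcP => i j x ji.
  by rewrite hpostE hmkE // (svalP (cid (FE i j))).
- move=> f.
  have FE i j : exists h : {linear P i -> A j}, g j \o h =1 hc f i j.
    exact/pP/(ex_surj ex).
  exists (hmk n (fun i j => sval (cid (FE i j)))); apply: hcP => i j x ji.
  by rewrite hpostE hmkE //; exact: (svalP (cid (FE i j)) x).
Qed.

Lemma hpre_comp A B C I (g : chain_map B C) (f : chain_map A B) n z :
  hpre I (ccomp g f) n z = hpre I f n (hpre I g n z).
Proof. by apply: hcP => i j x _; rewrite !hpreE. Qed.

(** A quasi-isomorphism is the triangle 0 -> A -> B; in the dual triangle the term Hom(0, I)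
    vanishes, which leaves an isomorphism on homology. *)
Lemma K_injective_quasi_iso A B I (f : chain_map A B) :
  K_injective I -> quasi_iso f -> quasi_iso (hpre I f).
Proof.
move=> KI qf.
pose Z := @concentrated R 'rV[R]_0.
have Z0 i (x : Z i) : x = 0.
  by case: i x => [[|i]|i] x; apply/matrixP => ? [].
pose z : chain_map Z A := cnull Z A.
have tri : triangle z f by apply: quasi_iso_tri.
have Kt := K_injective_triangle (tri_comp tri) KI tri.
have H0 n (u : hom Z I n) : u = 0.
  by apply: hcP => i j x _; rewrite (Z0 _ x) !linear0.
apply/quasi_isoP; split=> n u cu.
  case/(bndE erefl) => y yE.
  have [|w <- _] := tri_inj Kt (i := n + 1) (x' := u) (x := y) erefl cu yE.
    by rewrite (H0 _ (hpre _ _ _ _)); apply: bnd0.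
  exact: bnd_dif.
by apply: (tri_exact Kt) => //; rewrite (H0 _ (hpre _ _ _ _)); apply: bnd0.
Qed.

(* [N] is a shift of [M]: [N i] is identified with [M (i - 1)], the           *)
(* differentials correspond up to the sign [c].                               *)
Record shifted (c : R) (e : int -> R) (N M : complex R) := Shifted {
  sh_to : forall i j, {linear N i -> M j};
  sh_from : forall i j, {linear M j -> N i};
  sh_toK : forall i j, i = j + 1 -> cancel (sh_to i j) (sh_from i j);
  sh_fromK : forall i j, i = j + 1 -> cancel (sh_from i j) (sh_to i j);
  sh_toD : forall i j k l x, i = j + 1 -> k = l + 1 ->
    dif M j l (sh_to i j x) = c *: sh_to k l (dif N i k x);
  sh_cc : c * c = 1;
  sh_ec : forall i j, i = j + 1 -> e i * c = - e j;
  sh_ee : forall i, e i * e i = 1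
}.

Section Shifted.
Variables (c : R) (e : int -> R) (N M : complex R) (S : shifted c e N M).

Lemma sh_fromD i j k l y : i = j + 1 -> k = l + 1 ->
  dif N i k (sh_from S i j y) = c *: sh_from S k l (dif M j l y).
Proof.
move=> ij kl; apply: (can_inj (sh_toK S kl)).
rewrite linearZ /= (sh_fromK S kl) -[y in RHS](sh_fromK S ij).
by rewrite (sh_toD S _ ij kl) scalerA (sh_cc S) scale1r.
Qed.

Lemma shifted_acyclic : acyclic N -> acyclic M.
Proof.
move=> /acyclicP aN; apply/acyclicP => j y cy.
have [|z zE] := bndE (j := j + 1 + 1) erefl (aN (j + 1) (sh_from S (j + 1) j y) _).
  apply: (cycE (j := j)) => //.
  by rewrite (@sh_fromD _ j j (j - 1)) ?subrK // cy linear0 scaler0.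
exists (j + 1), (c *: sh_to S (j + 1 + 1) (j + 1) z).
rewrite difZ (@sh_toD _ _ _ _ S _ _ (j + 1)) // zE (sh_fromK S erefl).
by rewrite scalerA (sh_cc S) scale1r.
Qed.

Section HomShift.
Variable I : complex R.
(** The factor [e i] absorbs both [c] and the sign change of the Hom differential caused by raising
    the degree by one. *)
Definition hsh n m (f : hom N I n) : hom M I m :=
  hmk m (fun i j => e i \*: (hc f (i + 1) j \o sh_from S (i + 1) i)).
Fact hsh_linear n m : linear (@hsh n m).
Proof.
move=> a f g; apply: hcP => i j x ji; rewrite hcDE hcZ !hmkE //= hcDE hcZ.
by rewrite scalerDr !scalerA mulrC.
Qed.
Lemma hshE n m (f : hom N I n) i j k x : m = n + 1 -> k = i + 1 ->
  hc (hsh m f) i j x = e i *: hc f k j (sh_from S k i x).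
Proof.
move=> mn ->; have [ji|ne] := eqVneq j (i + m); first by rewrite hmkE.
by rewrite !hc_ne ?scaler0 //; apply: contra_neq ne => ->; lia.
Qed.
Lemma hsh_dif n m n' m' (f : hom N I n) : m = n + 1 -> m' = n' + 1 ->
  hsh m' (dif _ n n' f) = dif _ m m' (hsh m f).
Proof.
move=> mn mn'; have [nn'|ne] := eqVneq n (n' + 1); last first.
  rewrite !dif_shape //; last by apply: contra_neq ne; lia.
  by apply: hcP => i j x ji; rewrite hmkE //= hc0 scaler0.
have mm' : m = m' + 1 by lia.
apply: hcP => i j x ji; rewrite (hc_dif _ (k := j + 1) (l := i - 1)) //; last lia.
rewrite (hshE _ _ _ mn' erefl) (hc_dif _ (k := j + 1) (l := i)) //; last lia.
rewrite (hshE _ _ _ mn erefl) (@hshE _ _ _ _ _ i) //; last lia.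
rewrite (@sh_fromD _ i i (i - 1)) //; last lia.
rewrite scalerBr difZ (linZ (hc f i j)) !scalerA; congr (_ - _ *: _).
rewrite mulrAC (@sh_ec _ _ _ _ S i (i - 1)) ?(sgS R mn) ?mulNr 1?mulrC //; lia.
Qed.

Lemma hsh_inj n m (f : hom N I n) : m = n + 1 -> hsh m f = 0 -> f = 0.
Proof.
move=> mn f0; apply: hcP => i j x ji; rewrite hc0.
have := congr1 (fun h => hc h (i - 1) j (sh_to S i (i - 1) x)) f0.
rewrite /= (@hshE _ _ _ _ _ i) ?hc0 ?sh_toK //; try lia.
by move=> /(congr1 ( *:%R (e (i - 1)))); rewrite scalerA (sh_ee S) scale1r scaler0.
Qed.

Lemma hsh_surj n m (g : hom M I m) : m = n + 1 -> exists f : hom N I n, hsh m f = g.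
Proof.
move=> mn.
exists (hmk n (fun i j => e (i - 1) \*: (hc g (i - 1) j \o sh_to S i (i - 1)))).
apply: hcP => i j x ji; rewrite (hshE _ _ _ mn erefl) hmkE /=; last lia.
have e1 : i + 1 - 1 = i by lia.
rewrite scalerA e1 (sh_ee S) scale1r; congr (hc g i j _).
by rewrite sh_fromK.
Qed.

Lemma hsh_cyc n m (f : hom N I n) : m = n + 1 -> cyc (hsh m f) <-> cyc f.
Proof.
move=> mn; split=> cf k.
  by apply: (@hsh_inj k (k + 1)) => //; rewrite (hsh_dif _ mn) // cf.
have -> : k = k - 1 + 1 by lia.
by rewrite -(@hsh_dif n m (k - 1)) // cf; apply: hcP => i j x ji; rewrite hmkE //= !hc0 scaler0.
Qed.

Lemma hsh_bnd n m (f : hom N I n) : m = n + 1 -> bnd (hsh m f) <-> bnd f.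
Proof.
move=> mn; split=> [/(bndE erefl)[g gE]|[k [g <-]]]; last first.
  by rewrite (@hsh_dif k (k + 1)) //; apply: bnd_dif.
have [h hE] := hsh_surj g (n := m) erefl.
exists m, h; apply/subr0_eq/(@hsh_inj _ m) => //.
have hB u v : hsh m (u - v) = hsh m u - hsh m v :> hom M I m.
  apply: hcP => i j x ji; rewrite hcB !hmkE //= hcB scalerBr; congr (_ - _).
by rewrite hB (@hsh_dif _ (m + 1)) // hE gE subrr.
Qed.

Lemma shifted_unull (U : mulset R) n m : m = n + 1 ->
  unull U (hom N I) n <-> unull U (hom M I) m.
Proof.
have hZ a (u : hom N I n) : hsh m (a *: u) = a *: hsh m u.
  have := @hsh_linear n m a u 0.
  rewrite !addr0 => ->; rewrite -[RHS]addr0; congr (_ + _).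
  by apply: hcP => i j x ji; rewrite hmkE //= !hc0 scaler0.
move=> mn; split=> nul z cz.
  have [f fE] := hsh_surj z mn; move: cz; rewrite -fE => /(hsh_cyc _ mn)/nul[s Us bs].
  by exists s; rewrite // -hZ; apply/hsh_bnd.
by have [s Us] := nul _ ((hsh_cyc z mn).2 cz); rewrite -hZ => /(hsh_bnd _ mn); exists s.
Qed.

End HomShift.
End Shifted.

Section ShiftInstances.
Variables (A P : complex R).

Definition sh_shifted : shifted (-1) (fun=> 1) (sh A) A.
Proof.
exists (fun i j => idm A (i - 1) j) (fun i j => idm A j (i - 1)).
- by move=> i j ij x; rewrite idmKK //; lia.
- by move=> i j ij x; rewrite idmKK //; lia.
- move=> i j k l x ij kl; rewrite sh_difE linearN scaleN1r opprK.
  by rewrite dif_idm ?idm_dif //; lia.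
- by rewrite mulrNN mulr1.
- by move=> i j _; rewrite mul1r.
- by move=> i; rewrite mulr1.
Defined.

Definition hom_sh_shifted : shifted 1 (@sg R) (hom P A) (hom (sh P) A).
Proof.
pose to i j (f : hom P A i) : hom (sh P) A j := hmk j (fun k l => hc f (k - 1) l : {linear sh P k -> A l}).
have toE i j f k l x : i = j + 1 -> l = k + j -> hc (to i j f) k l x = hc f (k - 1) l x.
  by move=> ij lk; rewrite hmkE.
have tol i j : linear (to i j).
  by move=> a f g; apply: hcP => k l x lk; rewrite hcDE hcZ !hmkE //= hcDE hcZ.
pose fr i j (f : hom (sh P) A j) : hom P A i :=
  hmk i (fun k l => (hc f (k + 1) l : {linear P (k + 1 - 1) -> A l}) \o idm P k (k + 1 - 1)).
have frl i j : linear (fr i j).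
  by move=> a f g; apply: hcP => k l x lk; rewrite hcDE hcZ !hmkE //= hcDE hcZ.
exists (fun i j => mklin (tol i j)) (fun i j => mklin (frl i j)).
- move=> i j ij f; rewrite !mklinE; apply: hcP => k l x lk.
  by rewrite hmkE //= toE // ?hc_idm //; lia.
- move=> i j ij f; rewrite !mklinE; apply: hcP => k l x lk.
  rewrite hmkE //= hmkE /=; last lia.
  have -> : idm P (k - 1) (k - 1 + 1 - 1) x = idm (sh P) k (k - 1 + 1) x.
    have e : k = k - 1 + 1 by lia.
    by case: _ / e; rewrite !idm_id.
  by rewrite hc_idm //; lia.
- move=> i j k l f ij kl; rewrite !(mklinE (tol _ _)) scale1r.
  have [ik|ne] := eqVneq i (k + 1); last first.
    rewrite !dif_shape //; last by apply: contra_neq ne; lia.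
    by apply: hcP => p q x qp; rewrite hmkE.
  have jl : j = l + 1 by lia.
  apply: hcP => p q x qp; rewrite (hc_dif _ (k := q + 1) (l := p - 1)) //; last lia.
  rewrite [RHS](toE _ _ _ _ _ _ kl) // (hc_dif _ (k := q + 1) (l := p - 1 - 1)) //; try lia.
  rewrite !toE //; try lia.
  by rewrite sh_difE linearN (sgS R ij) scalerN scaleNr.
- by rewrite mulr1.
- by move=> i j /(sgS R) ->; rewrite mulr1.
- by move=> i; apply: sgM.
Qed.

Definition hom_post_sh_shifted : shifted (-1) (fun=> 1) (hom P (sh A)) (hom P A).
Proof.
pose to i j (f : hom P (sh A) i) : hom P A j :=
  hmk j (fun k l => idm A (l + 1 - 1) l \o (hc f k (l + 1) : {linear P k -> A (l + 1 - 1)})).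
have tol i j : linear (to i j).
  move=> a f g; apply: hcP => k l x lk; rewrite hcDE hcZ !hmkE //= hcDE hcZ.
  by rewrite linearP.
pose fr i j (f : hom P A j) : hom P (sh A) i := hmk i (fun k l => hc f k (l - 1) : {linear P k -> sh A l}).
have frl i j : linear (fr i j).
  by move=> a f g; apply: hcP => k l x lk; rewrite hcDE hcZ !hmkE //= hcDE hcZ.
exists (fun i j => mklin (tol i j)) (fun i j => mklin (frl i j)).
- move=> i j ij f; rewrite !mklinE; apply: hcP => k l x lk.
  rewrite hmkE //= hmkE /=; last lia.
  have e : l - 1 + 1 = l by lia.
  by rewrite e idm_id.
- move=> i j ij f; rewrite !mklinE; apply: hcP => k l x lk.
  rewrite hmkE //= hmkE /=; last lia.
  have e : l + 1 - 1 = l by lia.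
  by rewrite e idm_id.
- move=> i j k l f ij kl; rewrite !(mklinE (tol _ _)) scaleN1r.
  have [ik|ne] := eqVneq i (k + 1); last first.
    rewrite !dif_shape //; last by apply: contra_neq ne; lia.
    by apply: hcP => p q x qp; rewrite hcN hmkE //= hc0 linear0 oppr0.
  have jl : j = l + 1 by lia.
  apply: hcP => p q x qp; rewrite hcN (hc_dif _ (k := q + 1) (l := p - 1)) //; last lia.
  rewrite !hmkE //=; try lia.
  rewrite (hc_dif _ (k := q + 1 + 1) (l := p - 1)) //; try lia.
  rewrite sh_difE (sgS R ij) scaleNr opprK (linD (idm _ _ _)) (linN (idm _ _ _)).
  rewrite (linZ (idm _ _ _)) dif_idm ?idm_dif; try lia.
  zmod.
- by rewrite mulrNN mulr1.
- by move=> i j _; rewrite mul1r.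
- by move=> i; rewrite mulr1.
Qed.
End ShiftInstances.
End Hom.

(** * Perfect complexes *)

Section Modules.
Variable R : comPzRingType.
Implicit Types (A B I P : complex R).

Definition free n : lmodType R := prodm (fun _ : 'I_n => R^o).
Definition free_map n (M : lmodType R) (e : 'I_n -> M) (c : free n) : M :=
  \sum_k c k *: e k.
Fact free_map_linear n M e : linear (@free_map n M e).
Proof.
move=> a c d; rewrite /free_map scaler_sumr -big_split; apply: eq_bigr => k _.
by rewrite /= scalerA -scalerDl.
Qed.

Definition dual_basis (Q : lmodType R) n (e : 'I_n -> Q) (p : 'I_n -> {linear Q -> R^o}) :=
  forall x, x = \sum_k p k x *: e k.
Definition fgproj (Q : lmodType R) :=
  exists n (e : 'I_n -> Q) (p : 'I_n -> {linear Q -> R^o}), dual_basis e p.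

Fact coord_linear n k : linear (fun c : free n => c k : R^o).
Proof. by []. Qed.
Definition coord n k : {linear free n -> R^o} := mklin (@coord_linear n k).

Definition fbasis n (k : 'I_n) : free n := fun l => (k == l)%:R.
Lemma fbasisE n (c : free n) : c = \sum_k c k *: fbasis k.
Proof.
apply: functional_extensionality_dep => l.
have -> : (\sum_k c k *: fbasis k) l = \sum_k (c k *: fbasis k : free n) l.
  by elim/big_rec2: _ => // k y z _ <-.
rewrite (bigD1 l) //= big1 => [|k ne]; last first.
  by rewrite -[LHS]/(c k * (k == l)%:R) (negPf ne) mulr0.
by rewrite addr0 -[RHS]/(c l * (l == l)%:R) eqxx mulr1.
Qed.

Lemma free_fgproj n : fgproj (free n).
Proof.
exists n, (@fbasis n), (@coord n) => c; rewrite [LHS]fbasisE.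
by apply: eq_bigr => k _; rewrite mklinE.
Qed.

Lemma fgproj_projective Q : fgproj Q -> projective Q.
Proof.
move=> [n [e [p pe]]] M N g f gs.
have /choice[y yP] k : exists y, g y = f (e k) by apply: gs.
pose h x : M := \sum_k p k x *: y k.
have hl : linear h.
  move=> a u v; rewrite /h scaler_sumr -big_split; apply: eq_bigr => k _.
  by rewrite linearP scalerDl scalerA.
exists (mklin hl) => x /=; rewrite mklinE (linear_sum g) [in RHS](pe x) linear_sum.
by apply: eq_bigr => k _; rewrite !linearZ /= yP.
Qed.

Lemma fgproj_fin_gen Q : fgproj Q -> fin_gen Q.
Proof. by move=> [n [e [p pe]]]; exists n, e => x; exists (fun k => p k x). Qed.

(** Functions on the proofs of [i = k]: a copy of [Q] in degree [k] and zero elsewhere, without case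
    analysis on the degree. *)
Definition stalk_obj (k : int) (Q : lmodType R) i : lmodType R :=
  prodm (fun _ : i = k => Q).
Definition stalk_dif k Q i j : {linear stalk_obj k Q i -> stalk_obj k Q j} := \0.
Definition stalk k Q : complex R :=
  @Complex R (stalk_obj k Q) (stalk_dif k Q) (fun _ _ _ _ => erefl) (fun _ _ _ _ => erefl).

Section Stalk.
Variables (k : int) (Q : lmodType R).
Fact sin_linear i : linear ((fun x => (fun _ => x)) : Q -> stalk k Q i).
Proof. by []. Qed.
Definition sin i : {linear Q -> stalk k Q i} := mklin (@sin_linear i).
Definition sout_fun i (x : stalk k Q i) : Q := if i =P k is ReflectT e then x e else 0.
Fact sout_linear i : linear (@sout_fun i).
Proof.
by move=> a x y; rewrite /sout_fun; case: eqP => // _; rewrite scaler0 addr0.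
Qed.
Definition sout i : {linear stalk k Q i -> Q} := mklin (@sout_linear i).
Lemma sinK i x : i = k -> sout i (sin i x) = x.
Proof. by move=> e; rewrite mklinE /sout_fun; case: eqP => // e'; rewrite mklinE. Qed.
Lemma soutK i x : sin i (sout i x) = x.
Proof.
apply: functional_extensionality_dep => e; rewrite mklinE mklinE /sout_fun.
by case: eqP => // e'; rewrite (eq_irrelevance e e').
Qed.
Lemma stalk0 i (x : stalk k Q i) : i != k -> x = 0.
Proof. by move=> ne; apply: functional_extensionality_dep => e; rewrite e eqxx in ne. Qed.
Lemma stalk_dif0 i j x : dif (stalk k Q) i j x = 0. Proof. by []. Qed.
Lemma sin_idm i j x : i = k -> idm (stalk k Q) i j (sin i x) = sin j x.
Proof.
move=> ik; have [ij|ne] := eqVneq i j; first by case: _ / ij; rewrite idm_id.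
by rewrite idm_ne // [RHS]stalk0 // -ik eq_sym.
Qed.

Section StalkTo.
Variables (A : complex R) (f : {linear Q -> A k}) (f0 : forall x, cyc (f x)).
Fact stalk_to_comm i j x :
  dif A i j ((idm A k i \o (f \o sout i)) x) = (idm A k j \o (f \o sout j)) (dif (stalk k Q) i j x).
Proof.
rewrite stalk_dif0 linear0 /=; have [ki|ne] := eqVneq k i; last by rewrite idm_ne ?linear0.
by rewrite dif_idm // f0.
Qed.
Definition stalk_to : chain_map (stalk k Q) A := ChainMap stalk_to_comm.
Lemma stalk_toE x : stalk_to k x = f (sout k x).
Proof. by rewrite /= idm_id. Qed.
End StalkTo.

Lemma stalk_projective i : projective Q -> projective (stalk k Q i).
Proof.
move=> pQ M N g f gs; have [h hE] := pQ _ _ g (f \o sin i) gs.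
by exists (h \o sout i) => x /=; rewrite -[in RHS](soutK x); apply: hE.
Qed.
End Stalk.

Lemma prod_projective (M N : lmodType R) :
  projective M -> projective N -> projective (M * N : lmodType R)%type.
Proof.
move=> pM pN V W g f gs.
have l1 : linear (fun x : M => f (x, 0)).
  move=> a x y; rewrite -linearP; congr (f _).
  by apply: injective_projections; rewrite //= scaler0 addr0.
have l2 : linear (fun x : N => f (0, x)).
  move=> a x y; rewrite -linearP; congr (f _).
  by apply: injective_projections; rewrite //= scaler0 addr0.
have [h1 h1E] := pM _ _ g (mklin l1) gs.
have [h2 h2E] := pN _ _ g (mklin l2) gs.
have hl : linear (fun p : M * N => h1 p.1 + h2 p.2).
  by move=> a x y; rewrite /= !linearP /= scalerDr addrACA.
exists (mklin hl) => -[x y] /=; rewrite mklinE /= linearD.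
have := h1E x; have := h2E y; rewrite /= !mklinE => -> ->; rewrite -linearD; congr (f _).
by apply: injective_projections; rewrite /= ?addr0 ?add0r.
Qed.

(** Modules are placed in degree 0 only and cones create the other degrees. Induction on the
    construction replaces induction on the length of a resolution. *)
Inductive perf : complex R -> Prop :=
| perf_stalk Q : fgproj Q -> perf (stalk 0 Q)
| perf_cone A B (f : chain_map A B) : perf A -> perf B -> perf (cone f).

Lemma perf_projective P i : perf P -> projective (P i).
Proof.
move=> pP; elim: pP i => [Q /fgproj_projective pQ|A B f _ pA _ pB] i.
  exact: stalk_projective.
exact: prod_projective.
Qed.

Lemma hom_cone_exact A B (f : chain_map A B) I :
  exact_seq (hpre I (cone_out f)) (hpre I (cone_in f)).
Proof.
have rl i : linear (fun p : cone f i => p.2 : B i) by [].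
have sl i : linear ((fun x => (x, 0)) : sh A i -> cone f i).
  by move=> a x y; apply: injective_projections; rewrite //= scaler0 addr0.
apply: (hpre_exact (r := fun i => mklin (rl i)) (s := fun i => mklin (sl i)) I
  (cone_exact f)) => i x; by rewrite mklinE.
Qed.

(** For a module in degree 0 a contraction is chosen on the members of a dual basis and extended
    linearly; the cone step is a triangle. *)
Lemma perf_acyclic P A : perf P -> acyclic A -> acyclic (hom P A).
Proof.
move=> pP aA; elim: pP => {P} [Q [n [e [p pe]]]|P P' f _ aP _ aP'].
  apply/acyclicP => i z cz; have /acyclicP bA := aA.
  have /choice[y yP] k : exists y, dif A (i + 1) i y = hc z 0 i (sin 0 Q 0 (e k)).
    apply/bndP/bA; apply: (cycE (j := i - 1)); first lia.
    rewrite ((hcyc z).1 cz _ _ _ (-1)) ?stalk_dif0 ?linear0 ?scaler0 //; lia.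
  pose h x : A (i + 1) := \sum_k p k x *: y k.
  have hl : linear h.
    move=> a u v; rewrite /h scaler_sumr -big_split; apply: eq_bigr => k _.
    by rewrite linearP scalerDl scalerA.
  exists (i + 1), (hmk (i + 1) (fun u j => idm A (i + 1) j \o (mklin hl \o sout 0 Q u))).
  apply: hbnd => // u j k l x kj ul ju.
  have [u0|ne] := eqVneq u 0; last first.
    by rewrite (stalk0 x ne) dif0 !(lin0 (hc _ _ _)) dif0 scaler0 subrr.
  rewrite stalk_dif0 linear0 scaler0 subr0 hmkE /=; last lia.
  have ki : k = i + 1 by lia. have ji : j = i by lia.
  rewrite dif_idm // mklinE /h difS.
  rewrite ji -[x in LHS](soutK x) -(@sin_idm _ _ 0 u) // hc_idm //.
  rewrite [sout _ _ _ _ in LHS]pe !linear_sum; apply: eq_bigr => m _.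
  by rewrite difZ yP !linearZ.
apply: (tri_acyclic (exact_triangle (hom_cone_exact f A))) => //.
exact: shifted_acyclic (hom_sh_shifted A P) aP.
Qed.

Lemma hom_stalk_eq k Q A n (f g : hom (stalk k Q) A n) :
  (forall j q, j = k + n -> hc f k j (sin k Q k q) = hc g k j (sin k Q k q)) -> f = g.
Proof.
move=> fg; apply: hcP => i j x ji; have [ik|ne] := eqVneq i k.
  rewrite -(soutK x) -(@sin_idm _ _ k i) // !hc_idm //; apply: fg; lia.
by rewrite (stalk0 x ne) !(lin0 (hc _ _ _)).
Qed.

Section Eval.
Variables (P A : complex R) (p : P 0).
Hypothesis cp : cyc p.
Definition ev_fun i (f : hom P A i) : A i := hc f 0 i p.
Fact ev_linear i : linear (@ev_fun i).
Proof. by move=> a f g; rewrite /ev_fun hcDE hcZ. Qed.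
Fact ev_comm i j f : dif A i j (mklin (@ev_linear i) f) =
  mklin (@ev_linear j) (dif (hom P A) i j f).
Proof.
rewrite !(mklinE (@ev_linear _)) /ev_fun.
have [ij|ne] := eqVneq i (j + 1); last by rewrite !dif_shape ?hc0.
rewrite (hc_dif _ (k := i) (l := -1)) ?add0r // cp.
by rewrite (lin0 (hc _ _ _)) scaler0 subr0.
Qed.
Definition ev : chain_map (hom P A) A := ChainMap ev_comm.
Lemma evE i f : ev i f = hc f 0 i p. Proof. exact: mklinE. Qed.
End Eval.

Section Pairing.
Variables (D P A : complex R) (b : forall n, D n -> P 0 -> A n).
Hypothesis bl : forall n y, linear (@b n y).
Hypothesis br : forall n p, linear (fun y => @b n y p).
Hypothesis bd : forall n m y p, b (dif D n m y) p = dif A n m (b y p).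
Hypothesis b0 : forall n y p, bnd p -> @b n y p = 0.

(** A pairing with the component [P 0] that kills boundaries factors through the cokernel of the
    differential into [P 0]. Extended by zero to the other degrees it is thus a chain map into
    Hom(P, A), with no sign, as [P 0] sits in degree 0. *)
Definition pair_fun n (y : D n) : hom P A n :=
  hmk n (fun i j => idm A n j \o (mklin (@bl n y) \o idm P i 0)).
Lemma pair_funE n y i j p : j = i + n ->
  hc (@pair_fun n y) i j p = idm A n j (b y (idm P i 0 p)).
Proof. by move=> e; rewrite hmkE //= (mklinE (@bl n y)). Qed.
Fact pair_linear n : linear (@pair_fun n).
Proof.
by move=> a x y; apply: hcP => i j p ji; rewrite hcDE hcZ !pair_funE // br linearP.
Qed.
Fact pair_comm n m y : dif (hom P A) n m (mklin (@pair_linear n) y) =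
  mklin (@pair_linear m) (dif D n m y).
Proof.
rewrite (mklinE (@pair_linear n)) (mklinE (@pair_linear m)).
have by0 k z : @b k z 0 = 0 by apply: b0; apply: bnd0.
have [nm|ne] := eqVneq n (m + 1); last first.
  rewrite dif_shape //; apply: hcP => i j p ji.
  by rewrite pair_funE // bd dif_shape // linear0 hc0.
apply: hcP => i j p ji; rewrite (hc_dif _ (k := j + 1) (l := i - 1)) //; try lia.
rewrite !pair_funE //; try lia.
rewrite [b y (idm P (i - 1) 0 _)]b0; last first.
  have [e|ne] := eqVneq (i - 1) 0; first by rewrite idm_dif //; apply: bnd_dif.
  by rewrite idm_ne //; apply: bnd0.
rewrite linear0 scaler0 subr0 bd; have [i0|ne] := eqVneq i 0; last first.
  by rewrite (idm_ne _ ne) !by0 !l0 !linear0.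
by rewrite dif_idm ?idm_dif //; lia.
Qed.
Definition pairing : chain_map D (hom P A) := ChainMap pair_comm.
Lemma pairingE n y i j p : j = i + n ->
  hc (pairing n y) i j p = idm A n j (b y (idm P i 0 p)).
Proof. by move=> ji; rewrite /= (mklinE (@pair_linear n)) pair_funE. Qed.
End Pairing.
End Modules.

(** * Nilpotence *)

(** Each construction below shifts the degrees in which vanishing is known. The statements therefore
    concern a family of sets of degrees that is stable under unit shifts, instantiated to all
    degrees or to all sufficiently low ones. *)
Record smallness := Smallness {
  small :> (int -> Prop) -> Prop;
  sm_mono : forall Q Q' : int -> Prop, (forall i, Q i -> Q' i) -> small Q -> small Q';
  sm_and : forall Q Q' : int -> Prop, small Q -> small Q' -> small (fun i => Q i /\ Q' i);
  sm_dec : forall Q : int -> Prop, small Q -> small (fun i => Q (i - 1));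
  sm_inc : forall Q : int -> Prop, small Q -> small (fun i => Q (i + 1))
}.

Definition small_all : smallness.
Proof.
by exists (fun Q => forall i, Q i) => // Q Q' QQ' q i; apply: QQ'.
Defined.
Definition small_below : smallness.
Proof.
exists (fun Q => exists c : int, forall i, i < c -> Q i).
- by move=> Q Q' QQ' [c q]; exists c => i /q/QQ'.
- move=> Q Q' [c q] [c' q']; exists (Num.min c c') => i ic.
  by split; [apply: q|apply: q']; lia.
- by move=> Q [c q]; exists c => i ic; apply: q; lia.
- by move=> Q [c q]; exists (c - 1) => i ic; apply: q; lia.
Defined.

Section ConeMap.
Variables (R : comPzRingType).
Implicit Types (A B C D I : complex R).

Section Map.
Variables (A B A' B' : complex R) (e : chain_map A B) (e' : chain_map A' B').
Variables (f1 : chain_map A A') (f2 : chain_map B B').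
Hypothesis sq : forall i x, f2 i (e i x) = e' i (f1 i x).
Definition cone_map_fun i (p : cone e i) : cone e' i := (f1 (i - 1) p.1, f2 i p.2).
Fact cone_map_linear i : linear (@cone_map_fun i).
Proof. by move=> a x y; apply: injective_projections; rewrite /= linearP. Qed.
Fact cone_map_comm i j p : dif (cone e') i j (mklin (@cone_map_linear i) p) =
  mklin (@cone_map_linear j) (dif (cone e) i j p).
Proof.
rewrite (mklinE (@cone_map_linear i)) (mklinE (@cone_map_linear j)).
rewrite !cone_difE; apply: injective_projections; rewrite /=.
  by rewrite chN chain_comm.
by rewrite chD chain_idm sq chain_comm.
Qed.
Definition cone_map : chain_map (cone e) (cone e') := ChainMap cone_map_comm.
Lemma cone_mapE i p : cone_map i p = (f1 (i - 1) p.1, f2 i p.2).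
Proof. by rewrite /= (mklinE (@cone_map_linear i)). Qed.
End Map.

Lemma cone_map_exact A' A A'' B' B B'' (e' : chain_map A' B') (e : chain_map A B)
    (e'' : chain_map A'' B'') (a : chain_map A' A) (g : chain_map A A'')
    (b : chain_map B' B) (h : chain_map B B'')
    (sqa : forall i x, b i (e' i x) = e i (a i x))
    (sqg : forall i x, h i (e i x) = e'' i (g i x)) :
  exact_seq a g -> exact_seq b h -> exact_seq (cone_map sqa) (cone_map sqg).
Proof.
move=> [ai ac am asj] [bi bc bm bsj]; split=> i.
- by move=> [x y]; rewrite cone_mapE /= => -[/ai -> /bi ->].
- by move=> [x y]; rewrite !cone_mapE /= ac bc.
- move=> [x y]; rewrite cone_mapE /= => -[/am[x' ->] /bm[y' ->]].
  by exists (x', y'); rewrite cone_mapE.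
- move=> [x y]; have [x' xE] := asj _ x; have [y' yE] := bsj _ y.
  by exists (x', y'); rewrite cone_mapE /= xE yE.
Qed.

(** The composite A -> B -> cone(f) is null homotopic through the inclusion of [A] as first summand;
    composing that homotopy with [v] gives [w]. *)
Lemma cone_nullhomotopic A B (f : chain_map A B) I n (v : hom (cone f) I n) :
  cyc v -> bnd (hpre I f n (hpre I (cone_in f) n v)).
Proof.
move=> cv.
have il i : linear ((fun x => (x, 0)) : A (i - 1) -> cone f i).
  by move=> a x y; apply: injective_projections; rewrite //= scaler0 addr0.
pose w : hom A I (n + 1) :=
  hmk (n + 1) (fun i j => hc v (i + 1) j \o (mklin (il (i + 1)) \o idm A i (i + 1 - 1))).
exists (n + 1), (sg R n *: w); rewrite difZ.
have <- : sg R n *: (sg R n *: hpre I f n (hpre I (cone_in f) n v)) =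
   hpre I f n (hpre I (cone_in f) n v) by rewrite sgK.
congr (_ *: _); apply: hbnd => // i j k l x kj il' ji.
rewrite hcZ !hpreE !hmkE /=; try lia.
rewrite !(mklinE (il _)) (sgS R erefl) scaleNr opprK.
rewrite ((hcyc v).1 cv (i + 1) j k i _ kj erefl); last lia.
have idx q y : i = q -> hc v q j (idm A l (q - 1) y, 0) = hc v i j (idm A l (i - 1) y, 0).
  by move=> e; case: _ / e.
rewrite idx // -scalerDr -(linD (hc v i j)); congr (_ *: hc v i j _).
rewrite cone_difE /=; apply: injective_projections; rewrite /= ?addr0 ?dif0 ?addr0.
  by rewrite dif_idm ?idm_dif ?addNr //; lia.
by rewrite chain_idm idmKK //; lia.
Qed.
End ConeMap.

Section Nilpotence.
Variables (R : comPzRingType) (U : mulset R) (mm : submodule R^o) (I : complex R).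
Hypothesis KI : K_injective I.
Variables (P : complex R) (p : P 0) (rho : P 0 -> R).
Hypotheses (pP : perf P) (cp : cyc p).
Hypothesis rhol : forall a x y, rho (a *: x + y) - (a * rho x + rho y) \in mm.
Hypothesis rhob : forall x, bnd x -> rho x \in mm.
Hypothesis rho1 : rho p - 1 \in mm.
Implicit Types (A B C D : complex R).

Definition killed A := forall i (x : A i) r, r \in mm -> r *: x = 0.
Definition null A i := unull U (hom A I) i.
Local Notation T := (hom P).
Local Notation eps A := (ev A cp).
(** The cofibre of the evaluation Hom(P, A) -> A at [p]. When [P] resolves [S] and [p] represents 1,
    this is the map Hom(S, A) -> A. The function [rho] stands for a functional from the degree 0
    homology of [P] to the residue ring with value 1 on [p]; the residue ring is not formed, so
    [rho] is linear modulo [mm] only. *)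
Definition Lam A : complex R := cone (eps A).
Definition eta A : chain_map A (Lam A) := cone_in (eps A).

Fact Lam_map_subproof A B (f : chain_map A B) i x :
  f i (eps A i x) = eps B i (hpost P f i x).
Proof. by rewrite !evE hpostE. Qed.
Definition Lam_map A B (f : chain_map A B) : chain_map (Lam A) (Lam B) :=
  cone_map (Lam_map_subproof f).

Lemma Lam_map_eta A B (f : chain_map A B) i x :
  Lam_map f i (eta A i x) = eta B i (f i x).
Proof. by rewrite cone_mapE /= linear0. Qed.

Lemma Lam_exact A' A A'' (a : chain_map A' A) (g : chain_map A A'') :
  exact_seq a g -> exact_seq (Lam_map a) (Lam_map g).
Proof.
move=> ex; apply: cone_map_exact => //; apply: hpost_exact => // i.
exact: perf_projective.
Qed.

Lemma Lam_acyclic A : acyclic A -> acyclic (Lam A).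
Proof.
move=> aA; apply: (tri_acyclic (exact_triangle (cone_exact (eps A)))) => //.
apply/acyclicP => i z /sh_cyc cz; apply/sh_bnd.
by have /acyclicP := perf_acyclic pP aA; apply.
Qed.

Lemma Lam_killed A : killed A -> killed (Lam A).
Proof.
move=> kA i [f x] r rm; apply: injective_projections; rewrite /= ?kA //.
by apply: hcP => k j y _; rewrite hcZ hc0 kA.
Qed.

(** The length counts only the quotients killed by [mm]: acyclic quotients are invisible to Hom into
    a K-injective complex. *)
Inductive filt : nat -> complex R -> Prop :=
| filt_acyclic n A : acyclic A -> filt n A
| filt_quot n A' A A'' (a : chain_map A' A) (g : chain_map A A'') :
    exact_seq a g -> acyclic A'' -> filt n A' -> filt n A
| filt_killed n A' A A'' (a : chain_map A' A) (g : chain_map A A'') :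
    exact_seq a g -> killed A'' -> filt n A' -> filt n.+1 A.

Lemma filt_Lam n A : filt n A -> filt n (Lam A).
Proof.
elim=> {n A} [n A /Lam_acyclic|n A' A A'' a g ex aA _ IH|n A' A A'' a g ex kA _ IH].
- exact: filt_acyclic.
- exact: filt_quot (Lam_exact ex) (Lam_acyclic aA) IH.
- exact: filt_killed (Lam_exact ex) (Lam_killed kA) IH.
Qed.

(** On a complex killed by [mm], scaling by [rho] is an honest chain map [sig] from [A] to Hom(P,
    A), and [rho p = 1] modulo [mm] makes it a section of the evaluation. So [eta A] factors through
    A's evaluation map followed by the inclusion in its cone, which is null homotopic. *)
Lemma eta_killed A n (v : hom (Lam A) I n) : killed A -> cyc v ->
  bnd (hpre I (eta A) n v).
Proof.
move=> kA cv.
have rhoE (x y : P 0) k (z : A k) : rho x - rho y \in mm -> rho x *: z = rho y *: z.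
  by move=> xy; apply/subr0_eq; rewrite -scalerBl kA.
pose b k (z : A k) (x : P 0) := rho x *: z.
have bl k z : linear (@b k z).
  move=> a x y; apply/subr0_eq; rewrite /b scalerA -scalerDl -scalerBl.
  exact/kA/rhol.
have br k x : linear (fun z : A k => @b k z x).
  by move=> a z z'; rewrite /b scalerDr !scalerA mulrC.
have bd k l z x : b l (dif A k l z) x = dif A k l (b k z x) by rewrite /b difZ.
have b0 k z x : bnd x -> b k z x = 0 by move=> /rhob xm; rewrite /b kA.
pose sig := pairing bl br bd b0.
have -> : hpre I (eta A) n v = hpre I sig n (hpre I (eps A) n (hpre I (eta A) n v)).
  apply: hcP => i j x ji; rewrite !hpreE; congr (hc v i j (eta A i _)).
  rewrite evE pairingE ?add0r // !idm_id /b -[LHS]scale1r; apply/subr0_eq.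
  by rewrite -scalerBl kA // -opprB rpredN.
exact/chain_bnd/cone_nullhomotopic.
Qed.

Variable sm : smallness.

(** For a finitely generated projective [Q] the dual basis writes the identity of Hom(Q, D) as a sum
    of maps through [D]; cones are handled by the dual triangle. *)
Lemma small_null_hom Q D : perf Q -> sm (null D) -> sm (null (hom Q D)).
Proof.
move=> pQ sD; elim: pQ => {Q} [Q [n [e [q qe]]]|Q Q' f pQ IH pQ' IH'].
  apply: sm_mono sD => i nD z cz.
  have ce l : cyc (sin 0 Q 0 (e l)) by move=> j.
  pose a l := ev D (ce l).
  pose b l k (y : D k) (x : stalk 0 Q 0) : D k := (q l (sout 0 Q 0 x) : R) *: y.
  have bl l k y : linear (@b l k y).
    by move=> c x x'; rewrite /b !linearP scalerDl scalerA.
  have br l k x : linear (fun y : D k => @b l k y x).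
    by move=> c y y'; rewrite /b scalerDr !scalerA mulrC.
  have bd l k k' y x : b l k' (dif D k k' y) x = dif D k k' (b l k y x) by rewrite /b difZ.
  have b0 l k y x : bnd x -> b l k y x = 0.
    by case=> k' [x' <-]; rewrite /b stalk_dif0 !linear0 scale0r.
  pose c l := pairing (bl l) (br l) (bd l) (b0 l).
  have -> : z = \sum_l hpre I (a l) i (hpre I (c l) i z).
    apply: hcP => k j f jk; rewrite hc_sum.
    under eq_bigr => l _ do rewrite !hpreE.
    rewrite -lin_sum; congr (hc z k j _); apply: hom_stalk_eq => l x lk.
    rewrite hc_sum [in LHS](qe x) !linear_sum; apply: eq_bigr => m _.
    rewrite pairingE // idm_id /b sinK // (linZ (idm _ _ _)) evE.
    have -> : l = k by rewrite lk add0r.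
    by rewrite idm_id (linZ (sin _ _ _)) (linZ (hc _ _ _)).
  elim/big_ind: _ => [|x y|l _]; [exact/bnd_ubnd/bnd0|exact: ubndD|].
  exact/chain_ubnd/nD/chain_cyc.
have tri := K_triangle KI (exact_triangle (hom_cone_exact f D)).
have sh1 : sm (null (hom (sh Q) D)).
  apply: sm_mono (sm_dec IH) => i; rewrite /null => n.
  by apply/(@shifted_unull _ _ _ _ _ (hom_sh_shifted D Q) I U (i - 1)) => //; lia.
apply: sm_mono (sm_and sh1 IH') => i [n n'].
by apply: (unull_mid tri).
Qed.

Lemma small_null_hom_sh D : sm (null (T D)) -> sm (null (T (sh D))).
Proof.
move=> sD; apply: sm_mono (sm_inc sD) => i n.
exact/(@shifted_unull _ _ _ _ _ (hom_post_sh_shifted D P) I U i (i + 1)).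
Qed.

Lemma small_null_mid A' A A'' (a : chain_map A' A) (g : chain_map A A'') :
  exact_seq a g -> sm (null (T A')) -> sm (null (T A'')) -> sm (null (T A)).
Proof.
move=> ex sA' sA''; apply: sm_mono (sm_and sA' sA'') => i [n' n''].
have tri := K_triangle KI (exact_triangle (hpost_exact (fun i => @perf_projective _ _ i pP) ex)).
by apply: (unull_mid tri).
Qed.

(** Hom(P, Lam D) is an extension of a shift of Hom(P, Hom(P, D)) by Hom(P, D), so the hypothesis of
    the nilpotence argument is inherited by [Lam D]. *)
Lemma small_null_Lam D : sm (null (T D)) -> sm (null (T (Lam D))).
Proof.
move=> sD; apply: (small_null_mid (cone_exact (eps D)) sD).
exact: (small_null_hom_sh (small_null_hom pP sD)).
Qed.

Lemma filt_quot_step A' A A'' (a : chain_map A' A) (g : chain_map A A'') :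
    exact_seq a g -> acyclic A'' ->
    (forall D (f : chain_map A' D), sm (null (T D)) ->
      sm (fun i => forall z : hom D I i, cyc z -> ubnd U (hpre I f i z))) ->
  forall D (f : chain_map A D), sm (null (T D)) ->
    sm (fun i => forall z : hom D I i, cyc z -> ubnd U (hpre I f i z)).
Proof.
move=> ex aA IH D f sD; apply: sm_mono (IH D (ccomp f a) sD) => i h z cz.
have := h z cz; rewrite hpre_comp.
have tri := K_triangle KI (exact_triangle ex).
move=> /(tri_uexact tri (chain_cyc _ cz))[s [y [Us cy b]]].
apply: (ubndS Us); apply: ubnd_congr (bndBC b) _; apply: chain_ubnd.
by have /acyclicP bA := @KI _ aA; apply/bnd_ubnd/bA.
Qed.

(* Classes lift along [Hom(Lam D, I) -> Hom(D, I)] in small degrees, and the  *)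
(* lifts die on the top filtration quotient of [A], hence come from a shorter *)
(* filtration.                                                                *)
Lemma filt_nilpotent n A : filt n A -> forall D (f : chain_map A D),
  sm (null (T D)) ->
  sm (fun i => forall z : hom D I i, cyc z -> ubnd U (hpre I f i z)).
Proof.
(* [Lam A'] is a new complex of smaller length, not a subderivation: the bound [N] carries the outer
   induction, and the inner one passes the acyclic quotients at fixed length. *)
move: (leqnn n); move: {2}n => N; elim: N n A => [|N IHN] n A le_nN fA;
  elim: fA le_nN => {n A} //.
- move=> n A aA _ D f sD; apply: sm_mono sD => i _ z cz.
  by have /acyclicP bA := @KI _ aA; apply/bnd_ubnd/bA/chain_cyc.
- by move=> n A' A A'' a g ex aA _ IH le D f; apply: (filt_quot_step ex aA (IH le)).
- move=> n A aA _ D f sD; apply: sm_mono sD => i _ z cz.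
  by have /acyclicP bA := @KI _ aA; apply/bnd_ubnd/bA/chain_cyc.
- by move=> n A' A A'' a g ex aA _ IH le D f; apply: (filt_quot_step ex aA (IH le)).
move=> n A' A A'' a g ex kA fA' _ le D f sD.
(* The induction hypothesis is used for Lam A' -> Lam A -> Lam D, since the filtration of [A'] and
   the hypothesis on [D] both survive [Lam]. *)
have sm1 := IHN n (Lam A') le (filt_Lam fA') (Lam D)
  (ccomp (Lam_map f) (Lam_map a)) (small_null_Lam sD).
apply: sm_mono (sm_and sm1 sD) => i [h nTD] z cz.
have tD := K_triangle KI (exact_triangle (cone_exact (eps D))).
(* The obstruction to lifting [z] along [eta D] lies in Hom out of the shift of Hom(P, D), which is
   null here. *)
have [||s [x [Us cx sz]]] := tri_lift tD (j := i - 1) (U := U) _ _ cz.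
- lia.
- by apply/(@shifted_unull _ _ _ _ _ (sh_shifted (T D)) I U (i - 1) i) => //; lia.
have tA := K_triangle KI (exact_triangle (Lam_exact ex)).
(* The lift dies on [Lam A'], so up to a multiplier it comes from a class [y] on [Lam A'']; as [A'']
   is killed, [eta A''] annihilates [y]. *)
have := h x cx; rewrite hpre_comp => /(tri_uexact tA (chain_cyc _ cx))[t [y [Ut cy ty]]].
apply: (ubndS Us); have bx : ubnd U (hpre I f i (hpre I (eta D) i x)).
  exists t => //; have := chain_bnd (hpre I (eta A)) ty; rewrite chB chZ.
  have -> : hpre I (eta A) i (hpre I (Lam_map f) i x) = hpre I f i (hpre I (eta D) i x).
    by apply: hcP => k j u _; rewrite !hpreE Lam_map_eta.
  have -> : hpre I (eta A) i (hpre I (Lam_map g) i y) = hpre I g i (hpre I (eta A'') i y).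
    by apply: hcP => k j u _; rewrite !hpreE Lam_map_eta.
  move=> b; rewrite -(subrK (hpre I g i (hpre I (eta A'') i y)) (t *: _)).
  by apply: bndD b _; apply/chain_bnd/eta_killed.
apply: ubnd_congr bx; rewrite -chZ -chB; apply/chain_bnd/bndBC; exact: sz.
Qed.
End Nilpotence.

(** * Truncations *)

Section SubQuotient.
Variable R : comPzRingType.
Implicit Types (A B I : complex R).

Section Sub.
Variables (A : complex R) (V : forall i, submodule (A i)).
Hypothesis dV : forall i j x, x \in V i -> dif A i j x \in V j.
Definition subC_dif_fun i j (x : subm (V i)) : subm (V j) :=
  exist _ (dif A i j (val x)) (dV j (valP x)).
Fact subC_dif_linear i j : linear (@subC_dif_fun i j).
Proof. by move=> a x y; apply: val_inj; rewrite /= linearP. Qed.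
Definition subC_dif i j := mklin (@subC_dif_linear i j).
Lemma subC_difE i j x : val (subC_dif i j x) = dif A i j (val x).
Proof. by rewrite (mklinE (@subC_dif_linear i j)). Qed.
Fact subC_shape i j : i != j + 1 -> forall x, subC_dif i j x = 0.
Proof. by move=> ij x; apply: val_inj; rewrite subC_difE dif_shape. Qed.
Fact subC_dd i j k x : subC_dif j k (subC_dif i j x) = 0.
Proof. by apply: val_inj; rewrite !subC_difE dif_dif. Qed.
Definition subC : complex R :=
  @Complex R (fun i => subm (V i)) subC_dif subC_shape subC_dd.
Fact val_linear i : linear (fun x : subm (V i) => val x).
Proof. by []. Qed.
Fact subC_val_comm i j x : dif A i j (mklin (@val_linear i) x) =
  mklin (@val_linear j) (dif subC i j x).
Proof. by rewrite (mklinE (@val_linear i)) (mklinE (@val_linear j)) subC_difE. Qed.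
Definition subC_val : chain_map subC A := @ChainMap R subC A _ subC_val_comm.
Lemma subC_valE i x : subC_val i x = val x.
Proof. by rewrite /= (mklinE (@val_linear i)). Qed.
Lemma subC_val_inj i x : subC_val i x = 0 -> x = 0.
Proof. by rewrite subC_valE => e; apply: val_inj. Qed.
Lemma subC_val_eq i (x y : subC i) : subC_val i x = subC_val i y -> x = y.
Proof. by rewrite !subC_valE => e; apply: val_inj. Qed.
End Sub.

Section SubMap.
Variables (A : complex R) (V W : forall i, submodule (A i)).
Hypothesis dV : forall i j x, x \in V i -> dif A i j x \in V j.
Hypothesis dW : forall i j x, x \in W i -> dif A i j x \in W j.
Hypothesis VW : forall i x, x \in V i -> x \in W i.
Definition subC_map_fun i (x : subC dV i) : subC dW i :=
  exist _ (val (x : subm (V i))) (VW (valP (x : subm (V i)))).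
Fact subC_map_linear i : linear (@subC_map_fun i).
Proof. by move=> a x y; apply: val_inj. Qed.
Fact subC_map_comm i j x : dif (subC dW) i j (mklin (@subC_map_linear i) x) =
  mklin (@subC_map_linear j) (dif (subC dV) i j x).
Proof.
rewrite (mklinE (@subC_map_linear i)) (mklinE (@subC_map_linear j)); apply: val_inj.
by rewrite /= !subC_difE.
Qed.
Definition subC_map : chain_map (subC dV) (subC dW) := ChainMap subC_map_comm.
Lemma subC_mapE i x : val (subC_map i x : subm (W i)) = val (x : subm (V i)).
Proof. by rewrite /= (mklinE (@subC_map_linear i)). Qed.
Lemma subC_map_inj i x : subC_map i x = 0 -> x = 0.
Proof.
by move=> /(congr1 (fun y : subm (W i) => val y)); rewrite subC_mapE => e; apply: val_inj.
Qed.
End SubMap.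

Section Coker.
Variables (A' A : complex R) (a : chain_map A' A).
Definition im_pred i : {pred A i} := [pred x | `[< exists y, x = a i y >]].
Fact im_closed i : submod_closed (@im_pred i).
Proof.
split=> [|c x y /asboolP[x' ->] /asboolP[y' ->]]; apply/asboolP.
  by exists 0; rewrite ch0.
by exists (c *: x' + y'); rewrite chD chZ.
Qed.
Definition imC i : submodule (A i) := SubmodulePred (@im_closed i).
Definition coker_dif_fun i j (q : quotm (imC i)) : quotm (imC j) :=
  quotm_pi (imC j) (dif A i j (quotm_repr q)).
Lemma coker_difE i j x :
  coker_dif_fun j (quotm_pi (imC i) x) = quotm_pi (imC j) (dif A i j x).
Proof.
apply/quotm_piP; rewrite -difB.
have /quotm_piP/asboolP[y ->] := quotm_reprK (quotm_pi (imC i) x).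
by apply/asboolP; exists (dif A' i j y); rewrite chain_comm.
Qed.
Fact coker_dif_linear i j : linear (@coker_dif_fun i j).
Proof.
move=> c x y; rewrite -(quotm_reprK x) -(quotm_reprK y) -linearP !coker_difE.
by rewrite difD difZ linearP.
Qed.
Definition coker_dif i j := mklin (@coker_dif_linear i j).
Lemma coker_dif_pi i j x : coker_dif i j (quotm_pi (imC i) x) = quotm_pi (imC j) (dif A i j x).
Proof. by rewrite (mklinE (@coker_dif_linear i j)) coker_difE. Qed.
Fact coker_shape i j : i != j + 1 -> forall x, coker_dif i j x = 0.
Proof. by move=> ij x; rewrite -(quotm_reprK x) coker_dif_pi dif_shape // linear0. Qed.
Fact coker_dd i j k x : coker_dif j k (coker_dif i j x) = 0.
Proof. by rewrite -(quotm_reprK x) !coker_dif_pi dif_dif linear0. Qed.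
Definition coker : complex R :=
  @Complex R (fun i => quotm (imC i)) coker_dif coker_shape coker_dd.
Fact pi_linear i : linear (quotm_pi (imC i)).
Proof. exact: quotm_pi_is_linear. Qed.
Fact coker_pi_comm i j x : dif coker i j (mklin (@pi_linear i) x) =
  mklin (@pi_linear j) (dif A i j x).
Proof. by rewrite (mklinE (@pi_linear i)) (mklinE (@pi_linear j)) coker_dif_pi. Qed.
Definition coker_pi : chain_map A coker := @ChainMap R A coker _ coker_pi_comm.
Lemma coker_piE i x : coker_pi i x = quotm_pi (imC i) x.
Proof. by rewrite /= (mklinE (@pi_linear i)). Qed.

Lemma coker_pi0 i x : coker_pi i x = 0 <-> exists y, x = a i y.
Proof.
rewrite coker_piE -(linear0 (quotm_pi (imC i))); split=> [/quotm_piP/asboolP[y]|[y ->]].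
  by rewrite subr0; exists y.
by apply/quotm_piP/asboolP; exists y; rewrite subr0.
Qed.

Lemma coker_exact : (forall i x, a i x = 0 -> x = 0) -> exact_seq a coker_pi.
Proof.
move=> ai; split=> // i.
- by move=> x; apply/coker_pi0; exists x.
- by move=> x /coker_pi0.
- by move=> z; exists (quotm_repr z); rewrite coker_piE quotm_reprK.
Qed.
End Coker.

(* [trunc true k] and [trunc false k] are the subcomplexes                    *)
(* (... -> A_(k+1) -> Z_k -> 0) and (... -> A_(k+1) -> B_k -> 0).             *)
Section Trunc.
Variables (A : complex R) (b : bool) (k : int).
Definition trunc_pred i : {pred A i} := [pred x | `[< k < i \/ x = 0 \/
   i = k /\ if b then cyc x else bnd x >]].
Fact trunc_closed i : submod_closed (@trunc_pred i).
Proof.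
split=> [|a x y /asboolP[ki|[->|[ik cx]]] /asboolP[ki'|[->|[ik' cy]]]]; apply/asboolP; try by left.
- by right; left.
- by right; left; rewrite scaler0 addr0.
- by right; right; rewrite scaler0 add0r.
- by right; right; rewrite addr0; split=> //; case: b cx; [apply: cycZ|apply: bndZ].
- right; right; split=> //; case: b cx cy => cx cy; first exact/cycD/cy/cycZ.
  exact/bndD/cy/bndZ.
Qed.
Definition trunc_sub i : submodule (A i) := SubmodulePred (@trunc_closed i).
Fact trunc_dif i j x : x \in trunc_sub i -> dif A i j x \in trunc_sub j.
Proof.
have [ij|/dif_shape -> _] := eqVneq i (j + 1); last by apply/asboolP; right; left.
move=> /asboolP[ki|[->|[ik cx]]]; apply/asboolP.
- have [kj|kj] := eqVneq j k; last by left; lia.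
  by right; right; split=> //; case: b; [apply: cyc_dif|apply: bnd_dif].
- by right; left; rewrite dif0.
- by right; left; case: b cx => [|/bnd_cyc] cx; rewrite cx.
Qed.
Definition trunc := subC trunc_dif.
Definition trunc_val : chain_map trunc A := subC_val trunc_dif.
End Trunc.

Lemma trunc_acyclic A k : (forall i (z : A i), k <= i -> cyc z -> bnd z) ->
  acyclic (trunc A true k).
Proof.
move=> aA; apply/acyclicP => i [z zP] cz.
have cz' : cyc z.
  by move=> j; have := congr1 (trunc_val A true k j) (cz j); rewrite -chain_comm subC_valE ch0.
have [ki|ik] : k <= i \/ i < k by lia.
  have /bndP[y yE] := aA i z ki cz'.
  have yP : y \in trunc_sub A true k (i + 1) by apply/asboolP; left; lia.
  by exists (i + 1), (exist _ y yP); apply: subC_val_eq; rewrite -chain_comm !subC_valE.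
have -> : exist _ z zP = 0 :> subm (trunc_sub A true k i).
  by apply: val_inj; have /asboolP[?|[//|[? _]]] := zP; lia.
exact: bnd0.
Qed.

Fact trunc_TU_subproof A k i x : x \in trunc_sub A true (k + 1) i -> x \in trunc_sub A false k i.
Proof.
move=> /asboolP[ki|[->|[ik cx]]]; apply/asboolP; [by left; lia|by right; left|].
by left; lia.
Qed.
Definition trunc_TU A k : chain_map (trunc A true (k + 1)) (trunc A false k) :=
  subC_map (trunc_dif (k := k + 1)) (trunc_dif (k := k)) (@trunc_TU_subproof A k).
Fact trunc_UT_subproof A k i x : x \in trunc_sub A false k i -> x \in trunc_sub A true k i.
Proof.
move=> /asboolP[ki|[->|[ik cx]]]; apply/asboolP; [by left|by right; left|].
by right; right; split=> //; apply: bnd_cyc.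
Qed.
Definition trunc_UT A k : chain_map (trunc A false k) (trunc A true k) :=
  subC_map (trunc_dif (k := k)) (trunc_dif (k := k)) (@trunc_UT_subproof A k).

Lemma tri_quasi_iso_acyclic A' A A'' (a : chain_map A' A) (g : chain_map A A'') :
  triangle a g -> quasi_iso a -> acyclic A''.
Proof.
move=> tri /quasi_isoP[ai asj]; apply/acyclicP => i z cz.
have ij : i = i - 1 + 1 by lia.
have [x' [x [cx' dx zx]]] := tri_surj tri ij cz.
have [|w' w'E] := bndE ij (ai _ _ cx' _); first by rewrite -dx; apply: bnd_dif.
have [|y cy xy] := asj i (x - a i w').
  by apply: (cycE ij); rewrite difB dx chain_comm w'E subrr.
apply: bnd_congr (bndBC zx) _; have := chain_bnd g xy.
by rewrite !chB !(tri_comp tri) !subr0.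
Qed.

Lemma trunc_cyc A b k i (z : trunc A b k i) : cyc z <-> cyc (trunc_val A b k i z).
Proof.
split=> [cz|cz j]; first exact: chain_cyc.
by apply: (@subC_val_inj _ _ (trunc_dif (k := k))); rewrite -chain_comm cz.
Qed.

Section TruncIso.
Variables (A : complex R) (k : int).

(** The quotient has the single nonzero differential A_(k+1)/Z_(k+1) -> B_k, an isomorphism. *)
Lemma trunc_TU_quasi_iso : quasi_iso (trunc_TU A k).
Proof.
apply/quasi_isoP; split=> i.
  move=> [z zP] cz /bndP[[y yP] yE].
  have {}yE : dif A (i + 1) i y = z.
    have := congr1 (trunc_val A false k i) yE.
    by rewrite -chain_comm !subC_valE subC_mapE.
  have [ki|ik] : k + 1 <= i \/ i < k + 1 by lia.
    have yQ : y \in trunc_sub A true (k + 1) (i + 1) by apply/asboolP; left; lia.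
    by exists (i + 1), (exist _ y yQ); apply: subC_val_eq; rewrite -chain_comm !subC_valE.
  have -> : exist _ z zP = 0 :> subm (trunc_sub A true (k + 1) i).
    by apply: val_inj; have /asboolP[?|[//|[? _]]] := zP; lia.
  exact: bnd0.
move=> [w wP] cw.
have cw' : cyc w by have /trunc_cyc := cw; rewrite subC_valE.
have [ki|ik] : k + 1 <= i \/ i < k + 1 by lia.
  have wQ : w \in trunc_sub A true (k + 1) i.
    apply/asboolP; have [e|ne] := eqVneq i (k + 1); last by left; lia.
    by right; right.
  exists (exist _ w wQ); first by apply/trunc_cyc; rewrite subC_valE.
  have -> : trunc_TU A k i (exist _ w wQ) = exist _ w wP :> subm _.
    by apply: val_inj; rewrite subC_mapE.
  by rewrite subrr; apply: bnd0.
exists 0; first exact: cyc0.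
rewrite ch0 subr0; have /asboolP[ki|[w0|[ik' /bndP[y yE]]]] := wP.
- by lia.
- have -> : exist _ w wP = 0 :> subm (trunc_sub A false k i) by apply: val_inj.
  exact: bnd0.
- have yQ : y \in trunc_sub A false k (i + 1) by apply/asboolP; left; lia.
  by exists (i + 1), (exist _ y yQ); apply: subC_val_eq; rewrite -chain_comm !subC_valE.
Qed.

Lemma trunc_TU_acyclic : acyclic (coker (trunc_TU A k)).
Proof.
apply: tri_quasi_iso_acyclic trunc_TU_quasi_iso.
by apply/exact_triangle/coker_exact/subC_map_inj.
Qed.

Lemma trunc_val_quasi_iso : (forall i (z : A i), i < k -> cyc z -> bnd z) ->
  quasi_iso (trunc_val A true k).
Proof.
move=> aA; apply/quasi_isoP; split=> i.
  move=> [z zP] cz /bndP[y]; rewrite subC_valE /= => yE.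
  have [ki|ik] : k <= i \/ i < k by lia.
    have yQ : y \in trunc_sub A true k (i + 1) by apply/asboolP; left; lia.
    by exists (i + 1), (exist _ y yQ); apply: subC_val_eq; rewrite -chain_comm !subC_valE.
  have -> : exist _ z zP = 0 :> subm (trunc_sub A true k i).
    by apply: val_inj; have /asboolP[?|[//|[? _]]] := zP; lia.
  exact: bnd0.
move=> w cw; have [ki|ik] : k <= i \/ i < k by lia.
  have wQ : w \in trunc_sub A true k i.
    apply/asboolP; have [e|ne] := eqVneq i k; last by left; lia.
    by right; right.
  exists (exist _ w wQ); first by apply/trunc_cyc; rewrite subC_valE.
  by rewrite subC_valE subrr; apply: bnd0.
by exists 0; [apply: cyc0|rewrite ch0 subr0; apply: aA].
Qed.

Lemma trunc_val_acyclic : (forall i (z : A i), i < k -> cyc z -> bnd z) ->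
  acyclic (coker (trunc_val A true k)).
Proof.
move=> aA; apply: tri_quasi_iso_acyclic (trunc_val_quasi_iso aA).
by apply/exact_triangle/coker_exact/subC_val_inj.
Qed.

Lemma trunc_UT_concentrated i (x : coker (trunc_UT A k) i) : i != k -> x = 0.
Proof.
move=> ik; have ex := coker_exact (@subC_map_inj _ _ _ (trunc_dif (k := k))
  (trunc_dif (k := k)) (@trunc_UT_subproof A k)).
have [[y yP] <-] := ex_surj ex x; apply/coker_pi0.
have yQ : y \in trunc_sub A false k i.
  by have /asboolP[ki|[y0|[e _]]] := yP; apply/asboolP; [left|right; left|case/eqP: ik].
by exists (exist _ y yQ); apply: val_inj; rewrite subC_mapE.
Qed.

(* The relation between [Z_k] and [Z_k / B_k]. *)
Definition trunc_rel (z : A k) (x : coker (trunc_UT A k) k) :=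
  exists2 t, trunc_val A true k k t = z & coker_pi (trunc_UT A k) k t = x.

Lemma trunc_relP x : exists2 z, cyc z & trunc_rel z x.
Proof.
have ex := coker_exact (@subC_map_inj _ _ _ (trunc_dif (k := k))
  (trunc_dif (k := k)) (@trunc_UT_subproof A k)).
have [[y yP] <-] := ex_surj ex x; exists y; last by exists (exist _ y yP); rewrite ?subC_valE.
by have /asboolP[|[->|[]//]] := yP; [lia|apply: cyc0].
Qed.
Lemma trunc_rel_total z : cyc z -> exists x, trunc_rel z x.
Proof.
move=> cz; have zP : z \in trunc_sub A true k k by apply/asboolP; right; right.
by exists (coker_pi (trunc_UT A k) k (exist _ z zP)), (exist _ z zP); rewrite ?subC_valE.
Qed.
Lemma trunc_rel_lin a z z' x x' :
  trunc_rel z x -> trunc_rel z' x' -> trunc_rel (a *: z + z') (a *: x + x').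
Proof.
by move=> [t <- <-] [t' <- <-]; exists (a *: t + t'); rewrite chD chZ.
Qed.
Lemma trunc_rel0 z x : trunc_rel z x -> bnd z -> x = 0.
Proof.
move=> [[t tP] tz <-] bz; apply/coker_pi0; move: bz; rewrite -tz subC_valE /= => bt.
have tQ : t \in trunc_sub A false k k by apply/asboolP; right; right.
by exists (exist _ t tQ); apply: val_inj; rewrite subC_mapE.
Qed.
End TruncIso.

(* Filtration of a homologically bounded complex by its truncations. *)
Lemma devissage (CC : complex R -> Prop) (A : complex R) (lo : int) (n : nat) :
    (forall B, acyclic B -> CC B) ->
    (forall B' B B'' (b : chain_map B' B) (g : chain_map B B''),
      exact_seq b g -> acyclic B'' -> CC B' -> CC B) ->
    (forall B' B B'' (b : chain_map B' B) (g : chain_map B B'') k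
       (rel : A k -> B'' k -> Prop),
      exact_seq b g -> CC B' -> (forall i (x : B'' i), i != k -> x = 0) ->
      (forall x, exists2 z, cyc z & rel z x) ->
      (forall z, cyc z -> exists x, rel z x) ->
      (forall a z z' x x', rel z x -> rel z' x' -> rel (a *: z + z') (a *: x + x')) ->
      (forall z x, rel z x -> bnd z -> x = 0) -> CC B) ->
    (forall i (z : A i), i < lo -> cyc z -> bnd z) ->
    (forall i (z : A i), lo + n%:Z <= i -> cyc z -> bnd z) ->
  CC A.
Proof.
move=> Cac Cquot Cst Alo Ahi.
(* The truncation keeps the top [m] degrees of the homology. Lowering it by one degree is a
   quasi-isomorphism, from Z_(k+1) to B_k, followed by the extension by Z_k/B_k. *)
have CT m : (m <= n)%N -> CC (trunc A true (lo + n%:Z - m%:Z)).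
  elim: m => [_|m IHm mn].
    by rewrite subr0; apply/Cac/trunc_acyclic.
  set k := lo + n%:Z - m.+1%:Z.
  have kE : lo + n%:Z - m%:Z = k + 1 by rewrite /k; lia.
  have CU : CC (trunc A false k).
    apply: (Cquot _ _ _ (trunc_TU A k) (coker_pi _)).
    - exact/coker_exact/subC_map_inj.
    - exact: trunc_TU_acyclic.
    - by rewrite -kE; apply/IHm/ltnW.
  apply: (Cst _ _ _ (trunc_UT A k) (coker_pi _) k (@trunc_rel A k)) => //.
  - exact/coker_exact/subC_map_inj.
  - by move=> i x; apply: trunc_UT_concentrated.
  - exact: trunc_relP.
  - exact: trunc_rel_total.
  - by move=> *; apply: trunc_rel_lin.
  - exact: trunc_rel0.
apply: (Cquot _ _ _ (trunc_val A true lo) (coker_pi _)).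
- exact/coker_exact/subC_val_inj.
- exact: trunc_val_acyclic.
- by have := CT n (leqnn n); rewrite addrK.
Qed.
End SubQuotient.

(** * Finitely generated homology *)

Section FinGenHom.
Variables (R : comPzRingType) (noethR : noetherian R).
Implicit Types (A B I : complex R).

Lemma fgh_fin A i (K : finType) (e : K -> A i) : (forall k, cyc (e k)) ->
  (forall z, cyc z -> exists c : K -> R, bnd (z - \sum_k c k *: e k)) -> fgh A i.
Proof.
move=> ce eP; exists #|K|, (fun q => e (enum_val q)); split=> // z /eP[c cE].
exists (fun q => c (enum_val q)).
by rewrite -(big_enum_val (fun k => c k *: e k)).
Qed.

Lemma fgh_hom_free k n I j : fgh I (k + j) -> fgh (hom (stalk k (free R n)) I) j.
Proof.
move=> [r [e [ce eP]]].
have dl (x : I (k + j)) (t : 'I_n) : linear (fun c : free R n => c t *: x).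
  by move=> a c d; rewrite -[(a *: c + d) t]/(a * c t + d t) scalerDl scalerA.
pose E (x : I (k + j)) t : hom (stalk k (free R n)) I j :=
  hmk j (fun u v => idm I (k + j) v \o (mklin (dl x t) \o sout k (free R n) u)).
have Ec x t u v q : v = u + j -> hc (E x t) u v q = sout k (free R n) u q t *: idm I (k + j) v x.
  by move=> vu; rewrite hmkE //= (mklinE (dl x t)) (linZ (idm _ _ _)).
apply: (@fgh_fin _ _ ('I_n * 'I_r)%type (fun tl => E (e tl.2) tl.1)).
  move=> tl; apply/hcyc => u v u' v' q uv vu' uu'.
  rewrite Ec // stalk_dif0 (lin0 (hc _ _ _)) scaler0 difZ.
  by rewrite (cyc_idm u' (ce _)) scaler0.
move=> z cz.
have /choice[c cP] t : exists c : 'I_r -> R,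
    bnd (hc z k (k + j) (sin k _ k (fbasis R t)) - \sum_l c l *: e l).
  apply: eP; apply: (cycE (j := k + j - 1)); first lia.
  rewrite ((hcyc z).1 cz _ _ _ (k - 1)) ?stalk_dif0 ?(lin0 (hc _ _ _)) ?scaler0 //; lia.
have /choice[y yP] t : exists y : I (k + j + 1), dif I (k + j + 1) (k + j) y =
    hc z k (k + j) (sin k _ k (fbasis R t)) - \sum_l c t l *: e l by apply/bndP.
exists (fun tl => c tl.1 tl.2).
have yl : linear (fun c : free R n => \sum_t c t *: y t).
  move=> a x x'; rewrite scaler_sumr -big_split; apply: eq_bigr => t _ /=.
  by rewrite -[(a *: x + x') t]/(a * x t + x' t) scalerDl scalerA.
exists (j + 1), (hmk (j + 1) (fun u v => idm I (k + j + 1) v \o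
   (mklin yl \o sout k (free R n) u))).
apply: hbnd => // u v u' v' q uv vu' uu'.
rewrite stalk_dif0 (lin0 (hc _ _ _)) scaler0 subr0 hmkE /=; last lia.
have [uk|ne] := eqVneq u k; last by rewrite (stalk0 q ne) !(lin0 (hc _ _ _), lin0 (sout _ _ _), lin0 (mklin _), l0, lin0 (idm _ _ _)).
have u'k : u' = k + j + 1 by lia. have vk : v = k + j by lia.
move: uv uu' q; rewrite vk uk => _ _ q.
rewrite u'k idm_id (mklinE yl) hcB hc_sum difS.
rewrite (eq_bigr (fun tl : 'I_n * 'I_r => (sout k (free R n) k q tl.1) *: (c tl.1 tl.2 *: e tl.2))); last first.
  by move=> [t l] _; rewrite hcZ Ec // idm_id scalerA mulrC -scalerA.
rewrite -(pair_bigA _ (fun t l => (sout k (free R n) k q t) *: (c t l *: e l))) /=.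
under eq_bigr => t _ do rewrite -scaler_sumr.
have -> : hc z k (k + j) q =
    \sum_t sout k (free R n) k q t *: hc z k (k + j) (sin k _ k (fbasis R t)).
  rewrite -[q in LHS](soutK q) [in LHS](fbasisE (sout _ _ _ q)) !lin_sum.
  by apply: eq_bigr => t _; rewrite (linZ (sin _ _ _)) (linZ (hc _ _ _)).
rewrite -sumrB; apply: eq_bigr => t _.
by rewrite difZ yP -scalerBr.
Qed.

Definition conc A k := forall i (x : A i), i != k -> x = 0.

(** The cycle [z] maps [A] into the cycles of [I] in degree [k + j], hence factors through the
    truncation [E]. That complex is acyclic, so K-injectivity makes its inclusion into [I] null
    homotopic; [w] is the homotopy. *)
Lemma hom_conc_bnd A I k j (z : hom A I j) : K_injective I ->
  (forall i (y : I i), k + j <= i -> cyc y -> bnd y) -> conc A k -> cyc z -> bnd z.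
Proof.
move=> KI Ib cA cz.
pose E := trunc I true (k + j).
have /acyclicP aE := KI E (trunc_acyclic Ib).
pose iota : hom E I 0 := hmk 0 (fun u v => idm I u v \o trunc_val I true (k + j) u).
have ci : cyc iota.
  apply/hcyc => u v u' v' x uv vu' uu'; rewrite /sg expr0 scale1r !hmk_compE; try lia.
  have -> : trunc_val I true (k + j) v' (dif E u v' x) = dif I u v' (trunc_val I true (k + j) u x).
    exact/esym/chain_comm.
  by rewrite dif_idm ?idm_dif //; lia.
have [|w wE] := bndE (j := 1) _ (aE 0 iota ci); first by [].
have zP x : hc z k (k + j) x \in trunc_sub I true (k + j) (k + j).
  apply/asboolP; right; right; split=> //; apply: (cycE (j := k + j - 1)); first lia.
  rewrite ((hcyc z).1 cz _ _ _ (k - 1)) //; try lia.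
  by rewrite (cA _ (dif A k _ x)) ?(lin0 (hc _ _ _)) ?scaler0 //; lia.
pose h x : E (k + j) := exist _ (hc z k (k + j) x) (zP x).
have hl : linear h by move=> a x y; apply: val_inj; rewrite /= linearP.
exists (j + 1), (hmk (j + 1) (fun u v => hc w (k + j) v \o (mklin hl \o idm A u k))).
apply: hbnd => // u v u' v' x uv vu' uu'.
have [uk|ne] := eqVneq u k; last first.
  rewrite [x]cA // !hmkE /=; try lia.
  by rewrite !(l0, lin0 (hc _ _ _), lin0 (idm _ _ _), lin0 (mklin _)) scaler0 subr0.
rewrite [dif A u v' x]cA ?(lin0 (hc _ _ _)) ?scaler0 ?subr0; last by lia.
rewrite hmkE /=; last lia.
have vk : v = k + j by lia.
move: uv uu' x; rewrite vk uk => uv uu' x.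
rewrite idm_id (mklinE hl) uv.
have := congr1 (fun f => hc f (k + j) (k + j) (h x)) wE; rewrite /=.
rewrite (hc_dif _ (k := k + j + 1) (l := k + j - 1)) //; try lia.
rewrite hmk_compE; last lia.
rewrite idm_id subC_valE /= => <-.
have -> : dif E (k + j) (k + j - 1) (h x) = 0.
  apply: (@subC_val_inj _ _ _ (trunc_dif (k := k + j))).
  rewrite -chain_comm subC_valE /=; have := zP x => /asboolP[|[->|[_ -> //]]]; first lia.
  by rewrite dif0.
by rewrite (lin0 (hc _ _ _)) scaler0 subr0.
Qed.

Variable I : complex R.
Hypotheses (KI : K_injective I) (fI : forall i, fgh I i).
Variable hi : int.
Hypothesis Ihi : forall i (y : I i), hi <= i -> cyc y -> bnd y.

(** Dimension shifting along 0 -> N -> R^r -> A -> 0: degree [j] for [A] is controlled by degree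
    [j + 1] for the syzygy [N]. The process stops at [hi], above which everything vanishes, so [A]
    may have infinite projective dimension. *)
Lemma fgh_hom_conc (n : nat) A k j (r : nat) (e : 'I_r -> A k) :
  conc A k -> (forall x, exists c : 'I_r -> R, x = \sum_t c t *: e t) ->
  hi - n%:Z <= k + j -> fgh (hom A I) j.
Proof.
elim: n A j r e => [|n IHn] A j r e cA eP le_hi.
  apply: fgh_null => z; apply: (hom_conc_bnd (k := k)) => // i y ij; apply: Ihi; lia.
have fl := free_map_linear e.
have fc x : cyc (mklin fl x) by apply/cycP/cA; lia.
pose g : chain_map (stalk k (free R r)) A := stalk_to fc.
have [p [w [wW wP]]] := noeth_relations noethR e.
pose ker_pred i : {pred stalk k (free R r) i} := [pred x | g i x == 0].
have kerc i : submod_closed (@ker_pred i).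
  split=> [|a x y /eqP x0 /eqP y0]; apply/eqP; first exact: ch0.
  by rewrite chD chZ x0 y0 scaler0 addr0.
pose ker i := SubmodulePred (@kerc i).
have dker i j' x : x \in ker i -> dif (stalk k (free R r)) i j' x \in ker j'.
  by move=> _; rewrite stalk_dif0; apply/eqP; rewrite ch0.
pose N := subC dker.
have ex : exact_seq (subC_val dker) g.
  split=> i.
  - exact: subC_val_inj.
  - by move=> x; rewrite subC_valE; apply/eqP/(valP (x : subm (ker i))).
  - move=> x gx; have xk : x \in ker i by apply/eqP.
    by exists (exist _ x xk); rewrite subC_valE.
  - move=> z; have [ik|ne] := eqVneq i k; last first.
      by exists 0; rewrite ch0 [RHS]cA.
    move: z; rewrite ik => z; have [c ->] := eP z; exists (sin k (free R r) k c).
    by rewrite stalk_toE sinK // (mklinE fl).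
have tri := K_triangle KI (exact_triangle ex).
apply: (fgh_left noethR tri (i := j + 1) erefl); first exact: fgh_hom_free.
have cN : conc N k by move=> i x ik; apply: val_inj; apply: stalk0.
have wk l : sin k (free R r) k (w l) \in ker k.
  by apply/eqP; rewrite stalk_toE sinK // (mklinE fl) [LHS]wW.
pose e' l : N k := exist _ (sin k (free R r) k (w l)) (wk l).
apply: (IHn N (j + 1) p e') => //; last lia.
move=> [x xk]; have /eqP := xk; rewrite stalk_toE (mklinE fl) => /wP[a aE].
exists a; apply: (@subC_val_eq _ _ _ dker); rewrite chS [LHS]subC_valE [LHS]/=.
rewrite -[x in LHS]soutK.
have -> : sout k (free R r) k x = \sum_l a l *: (w l : free R r).
  apply: functional_extensionality_dep => t; rewrite aE.
  by apply: esym; elim/big_rec2: _ => // l y z _ <-.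
by rewrite lin_sum; apply: eq_bigr => l _; rewrite subC_valE (linZ (sin _ _ _)).
Qed.

End FinGenHom.

Definition fg_homology (R : comPzRingType) (A : complex R) :=
  (forall i, fgh A i) /\ exists (lo : int) (n : nat),
    forall i (z : A i), i < lo \/ lo + n%:Z <= i -> cyc z -> bnd z.

Lemma fgh_hom (R : comPzRingType) (A I : complex R) j : noetherian R -> K_injective I ->
  fg_homology I -> fg_homology A -> fgh (hom A I) j.
Proof.
move=> noethR KI [fI [lo' [n' bI]]] [fA [lo [n bA]]]; move: j.
apply: (@devissage _ (fun A => forall j, fgh (hom A I) j) A lo n).
- by move=> B aB j; apply: fgh_null; have /acyclicP := KI _ aB; apply.
- move=> B' B B'' b g ex aB fB' j; have tri := K_triangle KI (exact_triangle ex).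
  apply: (fgh_mid noethR tri) => //; apply: fgh_null.
  by have /acyclicP := KI _ aB; apply.
- move=> B' B B'' b g k rel ex fB' cB relP relT relL rel0 j.
  have tri := K_triangle KI (exact_triangle ex).
  apply: (fgh_mid noethR tri) => //.
  have [r [e [ce eP]]] := fA k.
  have /choice[y yP] l : exists y, rel (e l) y by apply: relT.
  (* The number of shifts that reach the vanishing range; if [d] is negative the range is already
     reached and its absolute value is still a valid bound. *)
  pose d := lo' + n'%:Z - (k + j).
  apply: (@fgh_hom_conc _ noethR I KI fI (lo' + n'%:Z) _ (absz d) B'' k j r y) => //.
  + by move=> i z hi; apply: bI; right.
  + move=> x; have [z cz zx] := relP x; have [c cE] := eP z cz; exists c.
    apply/subr0_eq/(rel0 (z - \sum_l c l *: e l)) => //.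
    have R0 : rel 0 0.
      by have := relL (-1) _ _ _ _ zx zx; rewrite !scaleN1r !addNr.
    have Rs : rel (\sum_l c l *: e l) (\sum_l c l *: y l).
      elim/big_rec2: _ => // l u v _ uv; exact: relL.
    by have := relL (-1) _ _ _ _ Rs zx; rewrite !scaleN1r addrC [X in rel _ X]addrC.
  + lia.
- by move=> i z ilo; apply: bA; left.
- by move=> i z ilo; apply: bA; right.
Qed.

(** * Koszul complexes *)

Section Koszul.
Variables (R : comPzRingType) (noethR : noetherian R).
Implicit Types (A B I : complex R).

Section Mul.
Variables (x : R) (A : complex R).
Fact mul_linear i : linear (fun a : A i => x *: a).
Proof. by move=> c a b; rewrite scalerDr !scalerA mulrC. Qed.
Fact mul_comm i j a : dif A i j (mklin (@mul_linear i) a) = mklin (@mul_linear j) (dif A i j a).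
Proof. by rewrite (mklinE (@mul_linear i)) (mklinE (@mul_linear j)) difZ. Qed.
Definition mulC : chain_map A A := ChainMap mul_comm.
Lemma mulCE i a : mulC i a = x *: a. Proof. by rewrite /= (mklinE (@mul_linear i)). Qed.
Lemma hpre_mulC I i (v : hom A I i) : hpre I mulC i v = x *: v.
Proof. by apply: hcP => k l y lk; rewrite hpreE mulCE hcZ (linZ (hc v _ _)). Qed.
End Mul.

Fixpoint koszul (xs : seq R) A : complex R :=
  if xs is x :: xs' then cone (mulC x (koszul xs' A)) else A.

(** A homotopy for multiplication by [r] is recorded because it passes to cones of multiplication
    maps, whereas if [r] merely kills the homology of [A], only its square is sure to kill that of
    the cone. *)
Definition nullh (r : R) A := exists h : forall i j, {linear A i -> A j},
  forall i k l x, k = i + 1 -> i = l + 1 ->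
    r *: x = dif A k i (h i k x) + h l i (dif A i l x).

Lemma nullh_bnd r A i (z : A i) : nullh r A -> cyc z -> bnd (r *: z).
Proof.
move=> [h hP] cz; rewrite (hP i (i + 1) (i - 1)) ?subrK // cz (lin0 (h _ _)) addr0.
exact: bnd_dif.
Qed.

Lemma nullh_cone r x A : nullh r A -> nullh r (cone (mulC x A)).
Proof.
move=> [h hP].
pose H i j (p : cone (mulC x A) i) : cone (mulC x A) j :=
  (- h (i - 1) (j - 1) p.1, h i j p.2).
have Hl i j : linear (@H i j).
  move=> a p q; apply: injective_projections; rewrite /= linearP //.
  by rewrite opprD scalerN.
exists (fun i j => mklin (Hl i j)) => i k l [u v] ki il.
rewrite !(mklinE (Hl _ _)) !cone_difE /H; apply: injective_projections; rewrite /=.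
  by rewrite difN opprK (linN (h _ _)) opprK; apply: hP; lia.
rewrite !mulCE (hP i k l v ki il) (linD (h _ _)) scalerN.
have H1 q : i = q -> idm A q i (x *: h (i - 1) q u) = x *: h (i - 1) i u.
  by move=> e; case: _ / e; rewrite idm_id.
have H2 q : i - 1 = q -> h q i (idm A (i - 1) q (x *: u)) = x *: h (i - 1) i u.
  by move=> e; case: _ / e; rewrite idm_id (linZ (h _ _)).
rewrite (linN (idm _ _ _)) H1 ?H2; try lia.
zmod.
Qed.

Lemma nullh_cone_self x A : nullh x (cone (mulC x A)).
Proof.
pose H i j (p : cone (mulC x A) i) : cone (mulC x A) j := (idm A i (j - 1) p.2, 0).
have Hl i j : linear (@H i j).
  by move=> a p q; apply: injective_projections; rewrite /= ?linearP ?scaler0 ?addr0.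
exists (fun i j => mklin (Hl i j)) => i k l [u v] ki il.
rewrite !(mklinE (Hl _ _)) !cone_difE /H; apply: injective_projections; rewrite /=.
  rewrite mulCE (linD (idm _ _ _)) idmKK; last lia.
  rewrite dif_idm ?idm_dif; try lia.
  zmod.
by rewrite mulCE dif0 addr0 addr0 (linZ (idm _ _ _)) idmKK //; lia.
Qed.

Lemma koszul_nullh xs A x : x \in xs -> nullh x (koszul xs A).
Proof.
elim: xs => //= y xs IH; rewrite inE => /predU1P[->|/IH]; first exact: nullh_cone_self.
exact: nullh_cone.
Qed.

Lemma fg_homology_cone A B (f : chain_map A B) :
  fg_homology A -> fg_homology B -> fg_homology (cone f).
Proof.
move=> [fA [lA [nA bA]]] [fB [lB [nB bB]]].
have tri := exact_triangle (cone_exact f); split=> [i|].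
  apply: (fgh_mid noethR tri) => //.
  apply: (@fgh_map _ noethR (sh A) A i (i - 1) (idm A (i - 1) (i - 1)) _ _ (fA (i - 1))) => x /sh_cyc cx.
    by rewrite idm_id.
  by rewrite idm_id => bx; apply/sh_bnd.
pose lo := Num.min (lA + 1) lB.
pose d := (Num.max (lA + nA%:Z + 1) (lB + nB%:Z) - lo : int).
exists lo, (absz d) => i z hi cz.
have [|y cy zy] := tri_exact tri cz.
  apply/sh_bnd; apply: bA; last exact/sh_cyc/chain_cyc.
  lia.
apply: bnd_congr (bndBC zy) _; apply/chain_bnd/bB => //; lia.
Qed.

Lemma fg_homology_koszul xs A : fg_homology A -> fg_homology (koszul xs A).
Proof. by move=> fA; elim: xs => //= x xs IH; apply: fg_homology_cone. Qed.

(* The component of an element of [Hom(cone f, I)] on the shifted source.     *)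
Section ConeFst.
Variables (A B I : complex R) (f : chain_map A B).
Fact cone_inl_linear i : linear ((fun x => (x, 0)) : A (i - 1) -> cone f i).
Proof. by move=> a x y; apply: injective_projections; rewrite //= scaler0 addr0. Qed.
Definition cone_fst n k (v : hom (cone f) I n) : hom A I k :=
  hmk k (fun i j => hc v (i + 1) j \o (mklin (@cone_inl_linear (i + 1)) \o idm A i (i + 1 - 1))).
Lemma cone_fstE n k (v : hom (cone f) I n) i q j x : k = n + 1 -> q = i + 1 ->
  hc (cone_fst k v) i j x = hc v q j (idm A i (q - 1) x, 0).
Proof.
move=> kn ->; have [ji|ne] := eqVneq j (i + k).
  by rewrite hmkE //= (mklinE (@cone_inl_linear _)).
by rewrite !hc_ne //; apply: contra_neq ne => ->; lia.
Qed.
Lemma cone_fst_dif n k m (v : hom (cone f) I n) : n = m + 1 -> k = n + 1 ->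
  cone_fst n (dif _ n m v) =
  dif _ k n (cone_fst k v) - sg R n *: hpre I f n (hpre I (cone_in f) n v).
Proof.
move=> nm kn; apply: hcP => i j x ji.
rewrite hcB hcZ !hpreE (cone_fstE _ _ _ nm erefl).
rewrite (hc_dif _ (k := j + 1) (l := i)) //; last lia.
rewrite (hc_dif _ (k := j + 1) (l := i - 1)) //; last lia.
rewrite (cone_fstE _ _ _ kn erefl) (@cone_fstE _ _ _ _ i) //; last lia.
rewrite (sgS R kn) scaleNr opprK -[RHS]addrA; congr (_ + _).
rewrite cone_difE /= dif0 addr0 chain_idm idmKK; last lia.
have -> : (- dif A (i + 1 - 1) (i - 1) (idm A i (i + 1 - 1) x), f i x) =
  - ((idm A (i - 1) (i - 1) (dif A i (i - 1) x), 0) : cone f i) + cone_in f i (f i x).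
  apply: injective_projections; rewrite /= ?oppr0 ?add0r // addr0 idm_id dif_idm //; lia.
rewrite (linD (hc v i j)) (linN (hc v i j)) scalerDr opprD scalerN opprK.
by [].
Qed.
End ConeFst.
End Koszul.

(** * Consequences of a null cone *)

Section ConeHom.
Variables (R : comPzRingType) (A B I : complex R) (f : chain_map A B) (U : mulset R).

Lemma cone_fst_out n k (y : hom (sh A) I n) : k = n + 1 ->
  cone_fst k (hpre I (cone_out f) n y) = hsh (sh_shifted A) k y.
Proof.
move=> kn; apply: hcP => u v x vu; rewrite (cone_fstE _ _ _ kn erefl) hpreE.
by rewrite (hshE (sh_shifted A) y v x kn erefl) scale1r.
Qed.

Lemma cone_out_in n (y : hom (sh A) I n) : hpre I (cone_in f) n (hpre I (cone_out f) n y) = 0.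
Proof.
apply: hcP => u v x vu; rewrite !hpreE hc0.
by rewrite [cone_out _ _ _]/= (lin0 (hc y _ _)).
Qed.

(** The surjectivity part of the long exact sequence up to [U]: [z], moved to the shifted source,
    becomes null on the cone, and the bounding element [v] restricts on [B] to the required
    preimage. *)
Lemma cone_divisible i : unull U (hom (cone f) I) (i - 1) ->
  forall z : hom A I i, cyc z -> exists s v, [/\ U s, cyc v & bnd (s *: z - hpre I f i v)].
Proof.
move=> nu z cz.
have ii : i = i - 1 + 1 by rewrite subrK.
have [y yz] := hsh_surj (sh_shifted A) z ii.
have cy : cyc y by apply/(hsh_cyc (sh_shifted A) y ii); rewrite yz.
have [s Us /(bndE ii)[v vE]] := nu _ (chain_cyc (hpre I (cone_out f)) cy).
have := cone_fst_dif v ii erefl (k := i + 1).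
have -> : cone_fst i (dif _ i (i - 1) v) = s *: z.
  rewrite vE -yz -(cone_fst_out _ ii).
  by apply: hcP => k l x lk; rewrite hcZ !(cone_fstE _ _ _ ii erefl) hcZ.
move=> E; exists s, (- sg R i *: hpre I (cone_in f) i v); split=> //.
  by apply: cycZ; apply: (cycE (j := i - 1)) => //; rewrite chain_comm vE chZ cone_out_in scaler0.
exists (i + 1), (cone_fst (i + 1) v).
by rewrite E chZ scaleNr opprK subrK.
Qed.

(** The injectivity part: a bounding element for the pullback of [v] corrects a cochain extension of
    [v] to a cycle on the cone, which is null. *)
Lemma cone_injective i : unull U (hom (cone f) I) i ->
  forall v : hom B I i, cyc v -> bnd (hpre I f i v) -> ubnd U v.
Proof.
move=> nu v cv bv; have ex := hom_cone_exact f I.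
have ii : i = i - 1 + 1 by rewrite subrK.
have [u uE] := ex_surj ex v.
have [|y yE] := ex_mid ex (x := dif _ i (i - 1) u).
  by rewrite -chain_comm uE cv.
have by1 : bnd (hsh (sh_shifted A) i y).
  rewrite -(cone_fst_out _ ii) -yE (cone_fst_dif u ii erefl) uE.
  by apply: bndB; [exact: bnd_dif | exact: bndZ].
have /(hsh_bnd (sh_shifted A) y ii)/(bndE ii)[y1 y1E] := by1.
have [|s Us bs] := nu (u - hpre I (cone_out f) i y1).
  apply: (cycE (j := i - 1)) => //.
  by rewrite difB chain_comm y1E -yE subrr.
exists s => //; have := chain_bnd (hpre I (cone_in f)) bs.
by rewrite chZ chB uE cone_out_in subr0.
Qed.

(** A class on the shifted source that is pulled back from [B] dies on the cone; up to sign, [t]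
    applied to the second component bounds it. *)
Lemma cone_out_null n (y : hom (sh A) I n) (t : hom B I (n + 1)) : cyc t ->
  hsh (sh_shifted A) (n + 1) y = hpre I f (n + 1) t -> bnd (hpre I (cone_out f) n y).
Proof.
move=> ct yt.
have sl i : linear (fun q : cone f i => q.2) by [].
exists (n + 1), (sg R n *: hmk (n + 1) (fun i j => hc t i j \o mklin (@sl i))).
apply: hbnd => // i j k l q kj il ji.
rewrite hpreE !hcZ !hmk_compE; try lia.
rewrite !(mklinE (@sl _)) difZ ((hcyc t).1 ct i j k l) //; last lia.
rewrite (sgS R (erefl (n + 1))) !scaleNr scalerN !sgK opprK.
rewrite cone_difE /= (linD (hc t _ _)) [- _ + _]addrC addrK.
rewrite hc_idm; last lia.
have := congr1 (fun h => hc h (i - 1) j q.1) yt; rewrite hpreE.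
rewrite (@hshE _ _ _ _ _ (sh_shifted A) _ _ _ y (i - 1) j i) ?subrK // scale1r => <-.
by rewrite [sh_from _ _ _]/= /idm [cone_out _ _ _]/= idm_id.
Qed.
End ConeHom.

(** * Detection of vanishing *)

Section LocalNakayama.
Variables (R : comPzRingType) (U : mulset R) (mm : submodule R^o).
Hypothesis Um : forall s c, U s -> c \in mm -> U (s + c).

Lemma mmM a c : c \in mm -> a * c \in mm.
Proof. by move=> cm; have := rpredZ (a : R) cm. Qed.

(** Elimination of one generator at a time: [s - c ord0] lies in [U], so the first relation solves
    for [e ord0] up to a multiplier, and substitution keeps the other coefficients in [mm]. *)
Lemma nakayama (M : complex R) i n (e : 'I_n -> M i) :
  (forall k, exists s (c : 'I_n -> R), [/\ U s, forall l, c l \in mm &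
     bnd (s *: e k - \sum_l c l *: e l)]) ->
  forall k, ubnd U (e k).
Proof.
elim: n e => [|n IHn] e He k; first by case: k.
have [s [c [Us cm b0]]] := He ord0.
have Ut : U (s - c ord0) by apply: Um; rewrite // rpredN.
set t := s - c ord0 in Ut.
have e0 : bnd (t *: e ord0 - \sum_l c (lift ord0 l) *: e (lift ord0 l)).
  by move: b0; rewrite big_ord_recl scalerBl opprD addrA.
have IH : forall l : 'I_n, ubnd U (e (lift ord0 l)).
  apply: (IHn (fun l => e (lift ord0 l))) => {}k.
  have [s' [c' [Us' cm' b']]] := He (lift ord0 k).
  exists (t * s'), (fun l => c' ord0 * c (lift ord0 l) + t * c' (lift ord0 l)).
  split; first exact: msM.
    by move=> l; apply: rpredD; apply: mmM.
  move: b'; rewrite big_ord_recl => b'.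
  suff -> : (t * s') *: e (lift ord0 k) - \sum_(l < n)
      (c' ord0 * c (lift ord0 l) + t * c' (lift ord0 l)) *: e (lift ord0 l) =
    t *: (s' *: e (lift ord0 k) - (c' ord0 *: e ord0 +
      \sum_(l < n) c' (lift ord0 l) *: e (lift ord0 l))) +
    c' ord0 *: (t *: e ord0 - \sum_l c (lift ord0 l) *: e (lift ord0 l)).
    by apply: bndD; apply: bndZ.
  under eq_bigr => l _ do rewrite scalerDl -!scalerA.
  rewrite big_split /= -!scaler_sumr !scalerBr !scalerDr !scalerA (mulrC t (c' ord0)).
  zmod.
have [{}k ->|->] := unliftP ord0 k; first exact: IH.
apply: (ubndS Ut); apply: (@ubnd_congr _ _ _ _ (\sum_l c (lift ord0 l) *: e (lift ord0 l))).
  by apply: bndBC.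
by elim/big_ind: _ => [|x y|l _]; [exact/bnd_ubnd/bnd0 | exact: ubndD | exact/ubndZ/IH].
Qed.

Lemma nakayama_unull (M : complex R) i : fgh M i ->
  (forall z : M i, cyc z -> exists s n (x : 'I_n -> R) (v : 'I_n -> M i),
     [/\ U s, forall k, x k \in mm, forall k, cyc (v k) & bnd (s *: z - \sum_k x k *: v k)]) ->
  unull U M i.
Proof.
move=> [n [e [ce eP]]] H z cz; have [c cE] := eP z cz.
apply: (@ubnd_congr _ _ _ _ (\sum_k c k *: e k)); first exact: bndBC.
suff ue : forall k, ubnd U (e k).
  by elim/big_ind: _ => [|x y|l _]; [exact/bnd_ubnd/bnd0 | exact: ubndD | exact/ubndZ/ue].
apply: nakayama => k; have [s [m [x [v [Us xm cv b]]]]] := H (e k) (ce k).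
have /choice[d dE] l : exists d : 'I_n -> R, bnd (v l - \sum_k d k *: e k) by apply: eP.
exists s, (fun q => \sum_l x l * d l q); split=> //.
  by move=> q; apply: rpred_sum => l _; rewrite mulrC; apply: mmM.
apply: bnd_trans b _.
under [X in _ - X]eq_bigr => q _ do rewrite scaler_suml.
rewrite exchange_big /= -sumrB.
elim/big_ind: _ => [|a b|l _]; [exact: bnd0 | exact: bndD |].
suff -> : x l *: v l - \sum_q (x l * d l q) *: e q = x l *: (v l - \sum_q d l q *: e q) by apply: bndZ.
by rewrite scalerBr scaler_sumr; under [X in _ - X]eq_bigr => q _ do rewrite -scalerA.
Qed.

(** Each generator of [mm] is null homotopic on the Koszul complex, so [mm] kills its homology, and
    with it the pieces Z_k/B_k of the truncation filtration. *)
Lemma koszul_filt (noethR : noetherian R) (xs : seq R) A : (forall r, r \in mm -> exists c : nat -> R,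
    r = \sum_(k < size xs) c k * xs`_k) -> fg_homology A ->
  exists n, filt mm n (koszul xs A).
Proof.
move=> xsP /(fg_homology_koszul noethR xs)[_ [lo [n bA]]].
have nul r : r \in mm -> forall i (z : koszul xs A i), cyc z -> bnd (r *: z).
  move=> /xsP[c ->] i z cz; rewrite scaler_suml; apply: bnd_sum => k.
  rewrite -scalerA; apply: bndZ; apply: (nullh_bnd _ cz); apply: koszul_nullh.
  exact: mem_nth.
apply: (@devissage _ (fun A => exists n, filt mm n A) (koszul xs A) lo n).
- by move=> B aB; exists 0%N; apply: filt_acyclic.
- by move=> B' B B'' b g ex aB [m fB]; exists m; apply: filt_quot ex aB fB.
- move=> B' B B'' b g k rel ex [m fB] cB relP _ relL rel0; exists m.+1.
  apply: (filt_killed ex) fB => i; have [->|ne] := eqVneq i k; last first.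
    by move=> x r _; rewrite [x]cB // scaler0.
  move=> x r rm; have [z cz zx] := relP x.
  have R0 : rel 0 0 by have := relL (-1) _ _ _ _ zx zx; rewrite !scaleN1r !addNr.
  have := relL r _ _ _ _ zx R0; rewrite !addr0 => /rel0; apply; exact: nul.
- by move=> i z ilo; apply: bA; left.
- by move=> i z ilo; apply: bA; right.
Qed.
End LocalNakayama.

Section Detection.
Variables (R : comPzRingType) (noethR : noetherian R) (U : mulset R) (mm : submodule R^o).
Hypothesis Um : forall s c, U s -> c \in mm -> U (s + c).
Variables (I : complex R) (P : complex R) (p : P 0) (rho : P 0 -> R).
Hypotheses (KI : K_injective I) (fI : fg_homology I) (pP : perf P) (cp : cyc p).
Hypothesis rhol : forall a x y, rho (a *: x + y) - (a * rho x + rho y) \in mm.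
Hypothesis rhob : forall x, bnd x -> rho x \in mm.
Hypothesis rho1 : rho p - 1 \in mm.

(* The cone of multiplication by [x] on [A] is [U]-null only if [x] acts       *)
(* surjectively on the homology of [Hom(A, I)], so Nakayama's lemma removes   *)
(* the generators of [mm] from the Koszul complex one by one.                 *)
Theorem null_detection (sm : smallness) A : fg_homology A ->
  sm (null U I (hom P A)) -> sm (null U I A).
Proof.
move=> fA nTA.
have [||n [e [em eP]]] := @noeth_ideal _ noethR (fun r => r \in mm).
- exact: rpred0.
- by move=> a x y xm ym; apply: rpredD => //; apply: mmM.
pose xs := [seq e k | k <- enum 'I_n].
have xsm x : x \in xs -> x \in mm by move=> /mapP[k _ ->].
have xsP r : r \in mm -> exists c : nat -> R, r = \sum_(k < size xs) c k * xs`_k.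
  move=> /eP[c ->]; exists (fun k => if insub k is Some k then c k else 0).
  have sx : size xs = n by rewrite size_map size_enum_ord.
  rewrite -(big_mkord xpredT (fun k => (if insub k is Some k then c k else 0) * xs`_k)) sx big_mkord.
  apply: eq_bigr => k _; rewrite valK (nth_map k) ?size_enum_ord //.
  by rewrite nth_ord_enum.
have [m fK] := koszul_filt noethR xsP fA.
have nT : sm (null U I (hom P (koszul xs A))).
  elim: (xs) => //= x ys IH; apply: (small_null_mid KI pP (cone_exact _) IH).
  by apply: small_null_hom_sh IH.
(* Nilpotence is applied to the identity of the Koszul complex, which turns the vanishing of maps
   into that of the complex. *)
have nK := filt_nilpotent KI pP cp rhol rhob rho1 fK (cidm _) nT.
have {nK} : sm (null U I (koszul xs A)).
  apply: sm_mono nK => i H z cz; have := H z cz.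
  suff -> : hpre I (cidm (koszul xs A)) i z = z by [].
  by apply: hcP => k l x lk; rewrite hpreE.
elim: xs xsm {xsP fK nT} => //= x ys IH ysm /sm_dec nK; apply: IH.
  by move=> y yin; apply: ysm; rewrite inE yin orbT.
apply: sm_mono nK => i nK; apply: (nakayama_unull Um).
  by apply: fgh_hom => //; apply: fg_homology_koszul.
move=> z /(cone_divisible nK)[s [v [Us cv]]]; rewrite hpre_mulC => b.
exists s, 1%N, (fun=> x), (fun=> v); split=> //.
  by move=> _; apply: ysm; rewrite inE eqxx.
by rewrite big_ord1.
Qed.
End Detection.

(** * Flat and projective dimension *)

Section Modules.
Variable R : comPzRingType.
Implicit Types (M N K G F V W : lmodType R).

(** A linear total relation needs to be single-valued at 0 only. Maps defined through choices of
    representatives are obtained this way. *)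
Lemma rel_linear V W (T : V -> W -> Prop) :
  (forall x, exists y, T x y) ->
  (forall a x x' y y', T x y -> T x' y' -> T (a *: x + x') (a *: y + y')) ->
  (forall y, T 0 y -> y = 0) ->
  exists h : {linear V -> W}, forall x, T x (h x).
Proof.
move=> /choice[h hT] Tl T0.
have hl : linear h.
  move=> a x x'; apply: subr0_eq; apply: T0.
  have := Tl (-1) _ _ _ _ (Tl a _ _ _ _ (hT x) (hT x')) (hT (a *: x + x')).
  by rewrite !scaleN1r addNr [- _ + _]addrC.
by exists (mklin hl) => x; rewrite (mklinE hl).
Qed.

Definition lcomp (U V W : lmodType R) (g : {linear V -> W}) (f : {linear U -> V}) : {linear U -> W} := g \o f.

Record ses K G N (a : {linear K -> G}) (g : {linear G -> N}) : Prop := Ses {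
  ses_inj : forall x, a x = 0 -> x = 0;
  ses_comp : forall x, g (a x) = 0;
  ses_mid : forall x, g x = 0 -> exists y, x = a y;
  ses_surj : forall z, exists x, g x = z
}.

Lemma ses_factor K G N V (a : {linear K -> G}) (g : {linear G -> N}) (f : {linear V -> G}) :
  ses a g -> (forall x, g (f x) = 0) -> exists h : {linear V -> K}, forall x, f x = a (h x).
Proof.
move=> ex gf; apply: (@rel_linear _ _ (fun x y => f x = a y)) => [x|c x x' y y' xy xy'|y].
- exact: (ses_mid ex).
- by rewrite !linearP xy xy'.
- by rewrite lin0 => /esym/(ses_inj ex).
Qed.

Lemma ses_ker G N (g : {linear G -> N}) : (forall z, exists x, g x = z) ->
  exists K (a : {linear K -> G}), ses a g.
Proof.
move=> gs; pose kp : {pred G} := [pred x | g x == 0].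
have kc : submod_closed kp.
  split=> [|a x y /eqP x0 /eqP y0]; apply/eqP; first exact: lin0.
  by rewrite linearP x0 y0 scaler0 addr0.
pose W := SubmodulePred kc.
have vl : linear (fun x : subm W => val x) by [].
exists (subm W), (mklin vl); split=> //.
- by move=> x; rewrite (mklinE vl) => x0; apply: val_inj.
- by move=> x; rewrite (mklinE vl); apply/eqP/(valP x).
- move=> x x0; have xk : x \in W by apply/eqP.
  by exists (exist _ x xk); rewrite (mklinE vl).
Qed.

Definition trivial_rel N k (c : 'I_k -> R) (x : 'I_k -> N) :=
  exists l (y : 'I_l -> N) (a : 'I_k -> 'I_l -> R),
    (forall i, x i = \sum_j a i j *: y j) /\ forall j, \sum_i c i * a i j = 0.

(** The equational criterion for flatness. It is free of tensor products, so that kernels and sums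
    become linear algebra. *)
Definition eqflat N := forall k (c : 'I_k -> R) (x : 'I_k -> N),
  \sum_i c i *: x i = 0 -> trivial_rel c x.

Lemma trivial_relD N k (c : 'I_k -> R) (x x' : 'I_k -> N) :
  trivial_rel c x -> trivial_rel c x' -> trivial_rel c (fun i => x i + x' i).
Proof.
move=> [l [y [a [xE ca]]]] [l' [y' [a' [xE' ca']]]].
exists (l + l')%N, (fun j => match split j with inl j => y j | inr j => y' j end),
  (fun i j => match split j with inl j => a i j | inr j => a' i j end); split.
  move=> i; rewrite big_split_ord /= xE xE'; congr (_ + _); apply: eq_bigr => j _.
    by have := unsplitK (inl j : 'I_l + 'I_l')%type; rewrite /unsplit => ->.
  by have := unsplitK (inr j : 'I_l + 'I_l')%type; rewrite /unsplit => ->.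
by move=> j; case: (split j).
Qed.

Lemma trivial_rel1 N k (c a : 'I_k -> R) (y : N) :
  \sum_i c i * a i = 0 -> trivial_rel c (fun i => a i *: y).
Proof.
by move=> ca; exists 1%N, (fun=> y), (fun i _ => a i); split=> // i; rewrite big_ord1.
Qed.

Lemma trivial_rel0 N k (c : 'I_k -> R) (x : 'I_k -> N) : (forall i, x i = 0) -> trivial_rel c x.
Proof.
move=> x0; exists 0%N, (fun=> 0), (fun _ _ => 0); split=> [i|[]//].
by rewrite big_ord0.
Qed.

Lemma trivial_rel_ext N k (c : 'I_k -> R) (x x' : 'I_k -> N) :
  (forall i, x i = x' i) -> trivial_rel c x -> trivial_rel c x'.
Proof. by move=> /funext ->. Qed.

Lemma trivial_relN N k (c : 'I_k -> R) (x : 'I_k -> N) :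
  trivial_rel c x -> trivial_rel c (fun i => - x i).
Proof.
move=> [l [y [a [xE ca]]]]; exists l, (fun j => - y j), a; split=> // i.
by rewrite xE -sumrN; apply: eq_bigr => j _; rewrite scalerN.
Qed.

(** The sum of the [x i] tensored with [c i] vanishes over the ring, hence, by flatness, already
    over the ideal generated by the [c i]. The derivation of this vanishing from the tensor
    relations is then read as a trivial relation. *)
Lemma flat_eqflat F : flat F -> eqflat F.
Proof.
move=> fF k c x cx.
pose Ip : {pred R^o} := [pred r | `[< exists d : 'I_k -> R, r = \sum_i c i * d i >]].
have Ic : submod_closed Ip.
  split=> [|a r s /asboolP[d ->] /asboolP[e ->]]; apply/asboolP.
    by exists (fun=> 0); rewrite big1 // => i _; rewrite mulr0.
  exists (fun i => a * d i + e i); rewrite scaler_sumr -big_split; apply: eq_bigr => i _.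
  by rewrite /= mulrDr mulrCA.
pose I := SubmodulePred Ic.
have vl : linear (fun r : subm I => val r : R^o) by [].
have vi : injective (mklin vl) by move=> r s; rewrite !(mklinE vl); apply: val_inj.
have cI i : c i \in I.
  apply/asboolP; exists (fun j => (i == j)%:R); rewrite (bigD1 i) //= eqxx mulr1.
  by rewrite big1 ?addr0 // => j /negPf; rewrite eq_sym => ->; rewrite mulr0.
pose ci i : subm I := exist _ (c i) (cI i).
pose s := [seq (x i, ci i) | i <- enum 'I_k].
have pure_sum : forall s : seq (F * subm I),
    tens_eq idfun [seq (p.1, mklin vl p.2) | p <- s] [:: (\sum_(p <- s) val p.2 *: p.1, 1 : R^o)].
  elim=> [|[y r] t IH] /=.
    by rewrite big_nil; apply/tens_sym/tens_zero.
  rewrite big_cons /= (mklinE vl).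
  apply: tens_trans; last exact/tens_sym/tens_addl.
  apply: (@tens_cat _ _ _ _ _ [:: _] [:: _]) => //.
  apply: tens_trans; last exact/tens_sym/tens_bal.
  have -> : (idfun (val r) *: (1 : R^o)) = val r by exact: mulr1.
  exact: tens_refl.
have /tens_piP : tens_pi idfun s = tens_pi idfun [::].
  apply: (fF _ _ _ vi); rewrite !tensor_mapE; apply/tens_piP.
  apply: tens_trans (pure_sum s) _.
  rewrite big_map big_enum /= cx; exact: tens_zero.
have /choice[d dE] (r : subm I) : exists d : 'I_k -> R, val r = \sum_i c i * d i.
  by have /asboolP := valP r.
(* [d] expands elements of the ideal in the [c i]. The choice is not linear, but its defects are
   relations among the [c i], so each tensor relation changes [v] by a trivial relation. *)
pose v (t : seq (F * subm I)) i : F := \sum_(p <- t) d p.2 i *: p.1.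
have main t u : tens_eq idfun t u -> trivial_rel c (fun i => v t i - v u i).
  elim=> {t u} [t|t u _ H|t u w _ H1 _ H2|t t' u u' _ H1 _ H2|t u|y|y y' r|y r r'|a y r].
  - by apply: trivial_rel0 => i; rewrite subrr.
  - by apply: trivial_rel_ext (trivial_relN H) => i; rewrite opprB.
  - by apply: trivial_rel_ext (trivial_relD H1 H2) => i; rewrite addrA subrK.
  - apply: trivial_rel_ext (trivial_relD H1 H2) => i; rewrite /v !big_cat /=; zmod.
  - by apply: trivial_rel0 => i; rewrite /v !big_cat /= addrC subrr.
  - by apply: trivial_rel0 => i; rewrite /v big_nil big_seq1 /= scaler0 subrr.
  - apply: trivial_rel0 => i; rewrite /v !big_cons !big_nil /= !addr0 scalerDr subrr //.
  - have cd : \sum_i c i * (d (r + r') i - d r i - d r' i) = 0.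
      under eq_bigr => i _ do rewrite !mulrBr.
      rewrite !sumrB -!dE -[val (r + r')]/((val r : R) + (val r' : R)).
      by move: (val r : R) (val r' : R) => u u'; ring.
    apply: trivial_rel_ext (trivial_rel1 y cd) => i; rewrite /v !big_cons !big_nil /= !addr0.
    by rewrite !scalerBl; zmod.
  - have cd : \sum_i c i * (d r i * a - d (idfun a *: r) i) = 0.
      under eq_bigr => i _ do rewrite mulrBr mulrA.
      by rewrite sumrB -mulr_suml -!dE /= mulrC; apply: subrr.
    apply: trivial_rel_ext (trivial_rel1 y cd) => i; rewrite /v !big_seq1 /=.
    by rewrite scalerBl scalerA.
move=> /main H.
apply: trivial_rel_ext (_ : trivial_rel c (fun i => (v s i - v [::] i) + (x i - v s i))) => [i|].
  by rewrite /v big_nil; zmod.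
apply: trivial_relD => //.
(* The expansion of [c j] chosen by [d] may differ from the obvious one; the difference is
   annihilated by [c]. *)
exists k, x, (fun i j => (i == j)%:R - d (ci j) i); split=> [i|j].
  under [RHS]eq_bigr => j _ do rewrite scalerBl.
  rewrite sumrB /v big_map big_enum /=; congr (_ - _).
  rewrite (bigD1 i) //= eqxx scale1r big1 ?addr0 // => j /negPf.
  by rewrite eq_sym => ->; rewrite scale0r.
under eq_bigr => i _ do rewrite mulrBr.
rewrite sumrB -dE /= (bigD1 j) //= eqxx mulr1 big1 ?addr0 ?subrr // => i /negPf ->.
by rewrite mulr0.
Qed.

(** All relations but one are trivialized first; the last one then becomes a single relation among
    the new elements [y]. *)
Lemma eqflat_multi N : eqflat N -> forall r k (c : 'I_r -> 'I_k -> R) (x : 'I_k -> N),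
  (forall q, \sum_i c q i *: x i = 0) -> exists l (y : 'I_l -> N) (a : 'I_k -> 'I_l -> R),
    (forall i, x i = \sum_j a i j *: y j) /\ forall q j, \sum_i c q i * a i j = 0.
Proof.
move=> eN; elim=> [|r IHr] k c x cx.
  exists k, x, (fun i j => (i == j)%:R); split=> [i|[]//].
  rewrite (bigD1 i) //= eqxx scale1r big1 ?addr0 // => j /negPf.
  by rewrite eq_sym => ->; rewrite scale0r.
have [|l [y [a [xE ca]]]] := IHr k (fun q => c (lift ord0 q)) x; first by move=> q; apply: cx.
have [|m [z [b [yE cb]]]] := eN l (fun j => \sum_i c ord0 i * a i j) y.
  rewrite -[RHS](cx ord0); under eq_bigr => j _ do rewrite scaler_suml.
  rewrite exchange_big; apply: eq_bigr => i _; rewrite xE scaler_sumr.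
  by apply: eq_bigr => j _; rewrite scalerA.
exists m, z, (fun i t => \sum_j a i j * b j t); split=> [i|q t].
  rewrite xE; under eq_bigr => j _ do rewrite yE scaler_sumr.
  rewrite exchange_big; apply: eq_bigr => t _; rewrite scaler_suml.
  by apply: eq_bigr => j _; rewrite scalerA.
have -> : \sum_i c q i * (\sum_j a i j * b j t) = \sum_j (\sum_i c q i * a i j) * b j t.
  under eq_bigr => i _ do rewrite mulr_sumr.
  rewrite exchange_big; apply: eq_bigr => j _; rewrite mulr_suml.
  by apply: eq_bigr => i _; rewrite mulrA.
have [{}q ->|->] := unliftP ord0 q; last exact: cb.
by apply: big1 => j _; rewrite ca mul0r.
Qed.

(** The relation is trivialized in [G] by elements [y j]. Their images in [F] satisfy relations as
    well; trivializing these and lifting back to [G] yields corrections that move the [y j] into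
    [K]. *)
Lemma eqflat_ker K G F (a : {linear K -> G}) (g : {linear G -> F}) :
  ses a g -> eqflat G -> eqflat F -> eqflat K.
Proof.
move=> ex eG eF k c x cx.
have [|l [y [b [xE cb]]]] := eG k c (fun i => a (x i)).
  transitivity (a (\sum_i c i *: x i)); last by rewrite cx lin0.
  by rewrite lin_sum; apply: eq_bigr => i _; rewrite linZ.
have [|m [z [d [yE bd]]]] := eqflat_multi eF (c := b) (x := fun j => g (y j)).
  move=> i; transitivity (g (a (x i))); last exact: ses_comp.
  by rewrite xE lin_sum; apply: eq_bigr => j _; rewrite linZ.
have /choice[w wE] t := ses_surj ex (z t).
have /choice[y' y'E] j : exists y' : K, y j - \sum_t d j t *: w t = a y'.
  apply: (ses_mid ex); rewrite linB yE lin_sum; apply/eqP; rewrite subr_eq0; apply/eqP.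
  by apply: eq_bigr => t _; rewrite linZ wE.
exists l, y', b; split=> // i; apply: subr0_eq; apply: (ses_inj ex).
rewrite linB lin_sum xE -sumrB.
under eq_bigr => j _ do rewrite linZ -scalerBr -y'E opprB addrC subrK scaler_sumr.
rewrite exchange_big big1 // => t _.
under eq_bigr => j _ do rewrite scalerA.
by rewrite -scaler_suml bd scale0r.
Qed.

Lemma eqflat_sum M N : eqflat M -> eqflat N -> eqflat (M * N : lmodType R)%type.
Proof.
move=> eM eN k c x cx.
have [|l [y [a [xE ca]]]] := eM k c (fun i => (x i).1).
  rewrite -[RHS]/((0 : M * N)%type.1) -cx.
  by elim/big_rec2: _ => // i u v _ ->.
have [|l' [y' [a' [xE' ca']]]] := eN k c (fun i => (x i).2).
  rewrite -[RHS]/((0 : M * N)%type.2) -cx.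
  by elim/big_rec2: _ => // i u v _ ->.
have T1 : trivial_rel c (fun i => ((x i).1, 0) : M * N)%type.
  exists l, (fun j => (y j, 0)), a; split=> // i; rewrite xE.
  by elim/big_rec2: _ => // j u v _ <-; apply: injective_projections; rewrite //= scaler0 addr0.
have T2 : trivial_rel c (fun i => (0, (x i).2) : M * N)%type.
  exists l', (fun j => (0, y' j)), a'; split=> // i; rewrite xE'.
  by elim/big_rec2: _ => // j u v _ <-; apply: injective_projections; rewrite //= scaler0 addr0.
apply: trivial_rel_ext (trivial_relD T1 T2) => i.
by apply: injective_projections; rewrite /= ?addr0 ?add0r.
Qed.

Lemma eqflat_free n : eqflat (free R n).
Proof.
move=> k c x cx; exists n, (@fbasis R n), (fun i j => x i j); split=> [i|j].
  exact: fbasisE.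
rewrite -[RHS]/((0 : free R n) j) -cx.
by elim/big_rec2: _ => // i u v _ ->.
Qed.

Inductive flat_dim : nat -> lmodType R -> Prop :=
| flat_dim_flat n N : eqflat N -> flat_dim n N
| flat_dim_ses n K G N (a : {linear K -> G}) (g : {linear G -> N}) :
    ses a g -> eqflat G -> flat_dim n K -> flat_dim n.+1 N.

Lemma flat_dim_inv n N : flat_dim n N -> eqflat N \/
  exists m K G (a : {linear K -> G}) (g : {linear G -> N}),
    [/\ n = m.+1, ses a g, eqflat G & flat_dim m K].
Proof.
by case=> {n N} [n N eN|n K G N a g ex eG fK]; [left | right; exists n, K, G, a, g].
Qed.

(** A first step L -> H -> G of the resolution is pulled back to [K]: the kernel [H'] of H -> G -> F
    is flat by [eqflat_ker], and L -> H' -> K is exact again. *)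
Lemma flat_dim_ker n K G F (a : {linear K -> G}) (g : {linear G -> F}) :
  ses a g -> flat_dim n G -> eqflat F -> flat_dim n K.
Proof.
move=> ex fG eF; case: fG a g ex => {n G} [n G eG a g ex|n L H G b h exb eH fL a g ex].
  exact/flat_dim_flat/(eqflat_ker ex).
have [|H' [i exi]] := @ses_ker H F (lcomp g h).
  by move=> z; have [x <-] := ses_surj ex z; have [y <-] := ses_surj exb x; exists y.
have [|q qE] := @ses_factor _ _ _ _ a g (lcomp h i) ex.
  by move=> x; apply: (ses_comp exi).
have [|j jE] := @ses_factor _ _ _ _ i (lcomp g h) b exi.
  by move=> x /=; rewrite (ses_comp exb) lin0.
apply: (@flat_dim_ses _ L H' K j q) => //; last exact: (eqflat_ker exi).
split.
- by move=> x jx; apply: (ses_inj exb); rewrite jE jx lin0.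
- by move=> x; apply: (ses_inj ex); rewrite -qE /= -jE (ses_comp exb).
- move=> x qx; have [|y yE] := @ses_mid _ _ _ _ _ exb (i x); first by have := qE x; rewrite qx lin0.
  exists y; apply: subr0_eq; apply: (ses_inj exi).
  by rewrite linB -jE -yE subrr.
- move=> z; have [y yE] := ses_surj exb (a z).
  have [|x xE] := @ses_mid _ _ _ _ _ exi y; first by rewrite /= yE (ses_comp ex).
  by exists x; apply: subr0_eq; apply: (ses_inj ex); rewrite linB -qE /= -xE yE subrr.
Qed.

Lemma flat_dim_sum n K r : flat_dim n K -> flat_dim n (K * free R r : lmodType R)%type.
Proof.
case=> {n K} [n K eK|n L G K a g ex eG fL].
  exact/flat_dim_flat/eqflat_sum/eqflat_free.
have al : linear (fun x => (a x, 0) : G * free R r)%type.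
  by move=> c x y; rewrite linearP; apply: injective_projections; rewrite //= scaler0 addr0.
have gl : linear (fun x : (G * free R r)%type => (g x.1, x.2) : K * free R r)%type.
  by move=> c x y; apply: injective_projections; rewrite //= linearP.
apply: (@flat_dim_ses _ L (G * free R r)%type _ (mklin al) (mklin gl)) fL.
  split.
  - by move=> x; rewrite (mklinE al) => /(congr1 fst) /(ses_inj ex).
  - by move=> x; rewrite (mklinE al) (mklinE gl) /= (ses_comp ex).
  - move=> [x c]; rewrite (mklinE gl) => -[/(ses_mid ex)[y ->] ->].
    by exists y; rewrite (mklinE al).
  - by move=> [x c]; have [y <-] := ses_surj ex x; exists (y, c); rewrite (mklinE gl).
apply: eqflat_sum => //; exact: eqflat_free.
Qed.

Inductive proj_dim : lmodType R -> Prop :=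
| proj_dim_proj N : fgproj N -> proj_dim N
| proj_dim_ses n K N (a : {linear K -> free R n}) (g : {linear free R n -> N}) :
    ses a g -> proj_dim K -> proj_dim N.

Hypothesis noethR : noetherian R.

(** The finitely many relations of the generators are trivialized at once. The resulting matrix [a]
    kills the relations, so its columns define functionals [q j], which form a dual basis with the
    [y j]. *)
Lemma eqflat_fgproj N : fin_gen N -> eqflat N -> fgproj N.
Proof.
move=> [n [e eP]] eN.
have [p [w [wW wP]]] := noeth_relations noethR e.
have [l [y [a [eE wa]]]] := eqflat_multi eN wW.
have [j|q qP] := @choice _ _ (fun j (h : {linear N -> R^o}) =>
    forall c, h (\sum_i c i *: e i) = \sum_i c i * a i j).
  have [||x|h hP] := @rel_linear N R^o (fun x r => exists2 c, x = \sum_i c i *: e i & r = \sum_i c i * a i j).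
  - by move=> x; have [c cE] := eP x; exists (\sum_i c i * a i j), c.
  - move=> b x x' r r' [c -> ->] [c' -> ->]; exists (fun i => b * c i + c' i).
      rewrite scaler_sumr -big_split; apply: eq_bigr => i _ /=.
      by rewrite scalerDl scalerA.
    rewrite scaler_sumr -big_split; apply: eq_bigr => i _ /=.
    by rewrite mulrDl -mulrA.
  - move=> [c /esym/wP[b bE] ->].
    under eq_bigr => i _ do rewrite bE mulr_suml.
    rewrite exchange_big big1 // => t _; under eq_bigr => i _ do rewrite -mulrA.
    by rewrite -mulr_sumr wa mulr0.
  exists h => c; have [c' cE ->] := hP (\sum_i c i *: e i).
  have /wP[b bE] : \sum_i (c i - c' i) *: e i = 0.
    by under eq_bigr => i _ do rewrite scalerBl; rewrite sumrB -cE subrr.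
  apply/esym/subr0_eq; rewrite -sumrB.
  under eq_bigr => i _ do rewrite -mulrBl bE mulr_suml.
  rewrite exchange_big big1 // => t _; under eq_bigr => i _ do rewrite -mulrA.
  by rewrite -mulr_sumr wa mulr0.
exists l, y, q => x; have [c ->] := eP x.
under [LHS]eq_bigr => i _ do rewrite eE scaler_sumr.
rewrite exchange_big; apply: eq_bigr => j _; rewrite qP scaler_suml.
by apply: eq_bigr => i _; rewrite scalerA.
Qed.

(** As in Schanuel's lemma, the syzygy [K] of a finite free cover is the kernel of a surjection from
    the sum of [L] and a free module onto the flat module [G]. By [flat_dim_ker] the flat dimension
    drops for this finitely generated syzygy too. *)
Lemma flat_dim_proj_dim n N : flat_dim n N -> fin_gen N -> proj_dim N.
Proof.
elim: n N => [|n IHn] N /flat_dim_inv[eN|]; try by move=> ?; apply/proj_dim_proj/eqflat_fgproj.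
  by move=> [m [K [G [a [g []]]]]].
move=> [_ [L [G [a [g [[<-] ex eG fL]]]]]] [r [e eP]].
have pl := free_map_linear e.
have [|K [i exi]] := @ses_ker (free R r) N (mklin pl).
  by move=> z; have [c ->] := eP z; exists c; rewrite (mklinE pl).
apply: (proj_dim_ses exi); apply: IHn; last first.
  have [p [w [wW wP]]] := noeth_relations noethR e.
  have /choice[k kE] l : exists k, (w l : free R r) = i k.
    by apply: (ses_mid exi); rewrite (mklinE pl); apply: wW.
  exists p, k => x.
  have := ses_comp exi x; rewrite (mklinE pl) => /wP[b bE]; exists b.
  apply: subr0_eq; apply: (ses_inj exi); rewrite linB lin_sum.
  apply/eqP; rewrite subr_eq0; apply/eqP; apply: functional_extensionality_dep => t.
  rewrite bE; apply: esym; under eq_bigr => l _ do rewrite linZ -kE.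
  by elim/big_rec2: _ => // l y z _ <-.
have /choice[x xE] t := ses_surj ex (e t).
have sl := free_map_linear x.
have gs c : g (free_map x c) = free_map e c.
  by rewrite lin_sum; apply: eq_bigr => t _; rewrite linZ xE.
have hl : linear (fun p : (L * free R r)%type => a p.1 + free_map x p.2).
  by move=> b p p'; rewrite linearP sl scalerDr addrACA.
have [|k kE] := @ses_factor _ _ _ K a g (lcomp (mklin sl) i) ex.
  by move=> y; rewrite /= (mklinE sl) gs -(mklinE pl) (ses_comp exi).
have ul : linear (fun y : K => (- k y, i y) : L * free R r)%type.
  by move=> b y y'; rewrite !linearP; apply: injective_projections; rewrite //= scalerN opprD.
apply: (@flat_dim_ker n K (L * free R r)%type G (mklin ul) (mklin hl)) => //; last exact: flat_dim_sum.
split.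
- by move=> y; rewrite (mklinE ul) => /(congr1 snd) /(ses_inj exi).
- move=> y; rewrite (mklinE ul) (mklinE hl) /= linN -kE /= (mklinE sl).
  exact: addNr.
- move=> [y c]; rewrite (mklinE hl) /= => yc.
  have [|z zE] := @ses_mid _ _ _ _ _ exi c.
    by rewrite (mklinE pl) -gs -(addKr (a y) (free_map x c)) yc addr0 linN (ses_comp ex) oppr0.
  exists z; rewrite (mklinE ul); apply: injective_projections => //=.
  apply: subr0_eq; apply: (ses_inj ex); rewrite linB linN opprK.
  by rewrite -kE /= (mklinE sl) -zE.
- move=> z; have [c cE] := eP (g z).
  have [|y yE] := @ses_mid _ _ _ _ _ ex (z - free_map x c); first by rewrite linB gs cE subrr.
  by exists (y, c); rewrite (mklinE hl) /= -yE subrK.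
Qed.
End Modules.

(** * From a flat complex to a perfect resolution *)

Section Resolutions.
Variable R : comPzRingType.
Implicit Types (M N K G : lmodType R).

Lemma conc0 M i (x : concentrated M i) : i != 0 -> x = 0.
Proof.
move: x; case: i => [[|i]|i] //= x _; exact: thinmx0.
Qed.

Lemma conc_bnd0 M i (x : concentrated M i) : bnd x -> x = 0.
Proof. by move=> [k [y <-]]. Qed.

Section Truncation.
Variable F : complex R.
Local Notation Z j := (subm (cycles F j)).
Fact sdif_subproof j x : dif F (j + 1) j x \in cycles F j.
Proof. by apply/eqP; apply: dif_dif. Qed.
Definition sdif_fun j (x : F (j + 1)) : Z j := exist _ (dif F (j + 1) j x) (sdif_subproof x).
Fact sdif_linear j : linear (@sdif_fun j).
Proof. by move=> a x y; apply: val_inj; rewrite /= linearP. Qed.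
Definition sdif j : {linear F (j + 1) -> Z j} := mklin (@sdif_linear j).
Fact zval_linear j : linear (fun x : Z j => val x).
Proof. by []. Qed.
Definition zval j : {linear Z j -> F j} := mklin (@zval_linear j).
Lemma sdifE j x : val (sdif j x) = dif F (j + 1) j x.
Proof. by rewrite /sdif (mklinE (@sdif_linear j)). Qed.
Lemma zvalE j x : zval j x = val x.
Proof. by rewrite /zval (mklinE (@zval_linear j)). Qed.
Lemma zcyc j (x : Z j) : cyc (val x).
Proof. by apply/cycP/eqP/(valP x). Qed.

Lemma cycles_ses j : (forall z : F j, cyc z -> bnd z) -> ses (zval (j + 1)) (sdif j).
Proof.
move=> Hj; split.
- by move=> x; rewrite zvalE => x0; apply: val_inj.
- by move=> x; apply: val_inj; rewrite sdifE zvalE; apply: zcyc.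
- move=> x /(congr1 val); rewrite sdifE => x0.
  have xZ : x \in cycles F (j + 1) by apply/eqP; rewrite addrK.
  by exists (exist _ x xZ); rewrite zvalE.
- move=> z; have [|x xE] := (bndP (val z)).1; first exact/Hj/zcyc.
  by exists x; apply: val_inj; rewrite sdifE.
Qed.

Lemma eqflat_trivial N : (forall x : N, x = 0) -> eqflat N.
Proof. by move=> N0 k c x _; apply: trivial_rel0. Qed.

Variable n : nat.
Hypothesis Fb : forall i : int, (n < `|i|)%N -> forall x : F i, x = 0.
Hypothesis Ff : forall i, eqflat (F i).
Hypothesis FH : forall i (z : F i), i != 0 -> cyc z -> bnd z.

(** Below degree 0 the complex is exact, and it starts from zero at the bottom: each cycle module is
    the kernel of a surjection of flat modules. *)
Lemma cycles_eqflat k j : j = - n%:Z - 1 + k%:Z -> j <= 0 -> eqflat (Z j).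
Proof.
elim: k j => [|k IHk] j jE j0.
  apply: eqflat_trivial => x; apply: val_inj; apply: Fb; lia.
have [j' j'E] : exists j', j = j' + 1 by exists (j - 1); rewrite subrK.
rewrite j'E; apply: (eqflat_ker (cycles_ses (j := j') _)) => //.
  by move=> z; apply: FH; lia.
by apply: IHk; lia.
Qed.

(** Descending from the top, where the cycles are zero, each [F (j + 1)] adds one step to a flat
    resolution. *)
Lemma cycles_flat_dim k j : j = n%:Z + 1 - k%:Z -> 1 <= j -> flat_dim k (Z j).
Proof.
elim: k j => [|k IHk] j jE j0.
  apply/flat_dim_flat/eqflat_trivial => x; apply: val_inj; apply: Fb; lia.
apply: (flat_dim_ses (cycles_ses (j := j) _)) => //.
  by move=> z; apply: FH; lia.
by apply: IHk; lia.
Qed.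

Lemma truncation_flat_dim M (q : {linear Z 0 -> M}) :
  (forall m, exists z, q z = m) -> (forall z, q z = 0 <-> bnd (val z)) ->
  exists m, flat_dim m M.
Proof.
move=> qs q0; have [K [i exi]] := ses_ker qs.
have [|g gE] := @ses_factor _ _ _ _ _ i q (sdif 0) exi.
  by move=> x; apply/q0; rewrite sdifE; apply: bnd_dif.
(* Two flat covers, Z_0 of [M] and F_1 of the boundaries in degree 0, precede Z_1, which has
   dimension at most [n]. *)
exists n.+2; apply: (flat_dim_ses exi); first by apply: (@cycles_eqflat n.+1); lia.
apply: (@flat_dim_ses _ n _ _ _ (zval 1) g) => //; last first.
  by apply: cycles_flat_dim; lia.
split.
- by move=> x; rewrite zvalE => x0; apply: val_inj.
- move=> x; apply: (ses_inj exi); rewrite -gE; apply: val_inj.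
  by rewrite sdifE zvalE; apply: zcyc.
- move=> x gx; have := gE x; rewrite gx lin0 => /(congr1 val); rewrite sdifE => x0.
  have xZ : x \in cycles F 1 by apply/eqP.
  by exists (exist _ x xZ); rewrite zvalE.
- move=> k; have /q0/bndP[x xE] := ses_comp exi k.
  by exists x; apply: subr0_eq; apply: (ses_inj exi); rewrite linB -gE;
    apply: val_inj; rewrite /= sdifE xE subrr.
Qed.
End Truncation.

Lemma finite_flat_dim_proj_dim M : noetherian R -> fin_gen M -> finite_flat_dim M -> proj_dim M.
Proof.
move=> noethR fgM [F [[n Fb] Ff [X [f [g [/quasi_isoP[fi fs] /quasi_isoP[gi gs]]]]]]].
have FH i (z : F i) : i != 0 -> cyc z -> bnd z.
  move=> ne cz; have [x cx zx] := fs _ _ cz.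
  apply: bnd_congr (bndBC zx) _; apply: chain_bnd; apply: gi => //.
  by rewrite [g i x]conc0 //; apply: bnd0.
have [||m m0|q qP] := @rel_linear R (subm (cycles F 0)) M
    (fun z m => exists x : X 0, [/\ cyc x, bnd (val z - f 0 x) & m = g 0 x]).
- by move=> z; have [x cx zx] := fs _ _ (zcyc z); exists (g 0 x), x.
- move=> a z z' m m' [x [cx zx ->]] [x' [cx' zx' ->]].
  exists (a *: x + x'); split; last by rewrite chD chZ.
    by apply: cycD => //; apply: cycZ.
  rewrite chD chZ; have := bndD (bndZ a zx) zx'; rewrite scalerBr /=.
  by congr bnd; zmod.
- case: m0 => x [cx x0 ->]; apply: (conc_bnd0 (i := 0)); apply: chain_bnd; apply: fi => //.
  by have := bndN x0; rewrite opprB subr0.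
have [| |m' fM] := @truncation_flat_dim F n Fb (fun i => flat_eqflat (Ff i)) FH M q.
- move=> m; have cm : cyc (m : concentrated M 0) by [].
  have [x cx /conc_bnd0/subr0_eq mx] := gs _ _ cm.
  have zF : f 0 x \in cycles F 0 by apply/eqP; apply: chain_cyc.
  exists (exist _ (f 0 x) zF); have [x' [cx' xx' ->]] := qP (exist _ (f 0 x) zF).
  have bx : bnd (x' - x) by apply: fi; [exact: cycB | rewrite chB; apply: bndBC].
  by rewrite mx; apply: subr0_eq; have := conc_bnd0 (chain_bnd g bx); rewrite chB.
- move=> z; have [x [cx zx ->]] := qP z; split=> [x0|bz].
    apply: bnd_congr (bndBC zx) _; apply: chain_bnd; apply: gi => //.
    by rewrite x0; apply: bnd0.
  apply: (conc_bnd0 (i := 0)); apply: chain_bnd; apply: fi => //.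
  exact: bnd_congr zx bz.
exact: flat_dim_proj_dim fM fgM.
Qed.

Section StalkMap.
Variables (k : int) (K G : lmodType R) (h : {linear K -> G}).
Fact stalk_map_subproof x : cyc (lcomp (sin k G k) h x : stalk k G k).
Proof. by []. Qed.
Definition stalk_map : chain_map (stalk k K) (stalk k G) := stalk_to stalk_map_subproof.
Lemma stalk_mapE i x : stalk_map i x = sin k G i (h (sout k K i x)).
Proof.
have [ik|ne] := eqVneq i k; last by rewrite [LHS]stalk0 ?[RHS]stalk0.
by move: x; rewrite ik => x; rewrite stalk_toE.
Qed.
End StalkMap.

Lemma stalk_exact k K G N (a : {linear K -> G}) (g : {linear G -> N}) :
  ses a g -> exact_seq (stalk_map k a) (stalk_map k g).
Proof.
move=> ex; split=> i; have [ik|ne] := eqVneq i k.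
- move=> x; rewrite stalk_mapE => /(congr1 (sout k G i)); rewrite sinK // lin0 => /(ses_inj ex) x0.
  by rewrite -[x]soutK x0 lin0.
- by move=> x _; apply: stalk0.
- by move=> x; rewrite !stalk_mapE sinK // (ses_comp ex) lin0.
- by move=> x; apply: stalk0.
- move=> x; rewrite stalk_mapE => /(congr1 (sout k N i)); rewrite sinK // lin0 => /(ses_mid ex)[y yE].
  by exists (sin k K i y); rewrite stalk_mapE sinK // -yE soutK.
- by move=> x _; exists 0; rewrite ch0; apply: stalk0.
- move=> z; have [x xE] := ses_surj ex (sout k N i z).
  by exists (sin k G i x); rewrite stalk_mapE sinK // xE soutK.
- by move=> z; exists 0; rewrite ch0 [z]stalk0.
Qed.

Section ConeRes.
Variables (P A' A A'' : complex R) (f : chain_map P A') (a : chain_map A' A) (g : chain_map A A'').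
Hypotheses (ex : exact_seq a g) (qf : quasi_iso f).
Local Notation cn := (cone (ccomp a f)).
Fact cone_res_linear i : linear (fun p : cn i => g i p.2).
Proof. by move=> c p q; rewrite linearP. Qed.
Fact cone_res_comm i j p : dif A'' i j (mklin (@cone_res_linear i) p) =
  mklin (@cone_res_linear j) (dif cn i j p).
Proof.
rewrite (mklinE (@cone_res_linear i)) (mklinE (@cone_res_linear j)) cone_difE /=.
by rewrite chain_comm chD chain_idm (ex_comp ex) lin0 add0r.
Qed.
Definition cone_res : chain_map cn A'' := ChainMap cone_res_comm.
Lemma cone_resE i p : cone_res i p = g i p.2.
Proof. by rewrite [LHS](mklinE (@cone_res_linear i)). Qed.

(** Replacing [A'] by its resolution [P] in the cone of [a], which is equivalent to [A''], splices
    one more term onto the resolution. *)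
Lemma cone_res_quasi_iso : quasi_iso cone_res.
Proof.
have /quasi_isoP[fi fs] := qf; apply/quasi_isoP; split.
  move=> i [x y] /(_ (i - 1)); rewrite cone_difE idm_id /= => -[dx dy].
  rewrite cone_resE /= => /(bndE erefl)[w wE]; have [y1 y1E] := ex_surj ex w.
  have [|k kE] := ex_mid ex (x := y - dif A (i + 1) i y1).
    by rewrite chB -chain_comm y1E wE subrr.
  have cx : cyc x.
    apply: (cycE (j := i - 1 - 1)); first by rewrite subrK.
    by apply/eqP; rewrite -oppr_eq0; apply/eqP.
  have dk : dif A' i (i - 1) k = - f (i - 1) x.
    apply: subr0_eq; apply: (ex_inj ex); rewrite chB -chain_comm -kE difB dif_dif subr0.
    by rewrite chN opprK -[RHS]dy [RHS]addrC.
  have bx : bnd x by apply: fi => //; rewrite -[f _ _]opprK -dk; apply/bndN/bnd_dif.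
  have [|x0 x0E] := bndE (j := i) _ bx; first by rewrite subrK.
  have [|w' cw' [l [k1 k1E]]] := fs i (k + f i x0).
    by apply: (cycE (j := i - 1)); rewrite ?subrK // difD dk chain_comm x0E addNr.
  have {l k1 k1E} [k1 k1E] : exists k1, dif A' (i + 1) i k1 = k + f i x0 - f i w'.
    by apply/bndP; exists l, k1.
  exists (i + 1), ((idm P i (i + 1 - 1) (w' - x0), y1 + a (i + 1) k1) : cn (i + 1)).
  rewrite cone_difE /=; apply: injective_projections => /=.
    by rewrite dif_idm ?difB ?cw' ?x0E ?sub0r ?opprK //; rewrite addrK.
  rewrite !chain_idm idmKK ?addrK // difD chain_comm k1E !(chD, chN) -[y in RHS](subrK (dif A (i + 1) i y1)) kE.
  zmod.
move=> i z cz; have [y yE] := ex_surj ex z.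
have [|k kE] := ex_mid ex (x := dif A i (i - 1) y).
  by rewrite -chain_comm yE cz.
have ck : cyc k.
  by apply/cycP; apply: (ex_inj ex); rewrite -chain_comm -kE dif_dif.
have [w cw /(bndE (j := i))[|k1 k1E]] := fs _ _ ck; first by rewrite subrK.
exists ((- w, y - a i k1) : cn i); last by rewrite cone_resE /= chB yE (ex_comp ex) subr0 subrr; apply: bnd0.
apply: (cycE (j := i - 1)); first by rewrite subrK.
rewrite cone_difE /= idm_id difN cw oppr0; apply: injective_projections => //=.
  by rewrite oppr0.
rewrite difB kE chain_comm k1E !(chB, chN); zmod.
Qed.
End ConeRes.

Lemma proj_dim_perf N : proj_dim N -> exists P (f : chain_map P (stalk 0 N)),
  perf P /\ quasi_iso f.
Proof.
elim=> {N} [N pN|n K N a g ex _ [P [f [pP qf]]]].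
  exists (stalk 0 N), (cidm _); split; first exact: perf_stalk.
  apply/quasi_isoP; split=> // i w cw; exists w => //.
  by rewrite subrr; apply: bnd0.
exists (cone (ccomp (stalk_map 0 a) f)), (cone_res f (stalk_exact 0 ex)); split.
  by apply: perf_cone => //; apply/perf_stalk/free_fgproj.
exact: cone_res_quasi_iso.
Qed.
End Resolutions.

(** * Maximal ideals and line bundles *)

Section Maximal.
Import classical_sets.
Variable R : comPzRingType.

Lemma memN (m : submodule R^o) (x : R) : x \in m -> - x \in m.
Proof. by move=> xm; rewrite -mulN1r; apply: mmM. Qed.

Lemma maximal_inv (m : submodule R^o) (x : R) : maximal_ideal m -> x \notin m ->
  exists b, b * x - 1 \in m.
Proof.
move=> [m1 mmax] xm; apply: contrapT => H; case/negP: xm.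
pose Jp : {pred R^o} := [pred r | `[< exists b, r - b * x \in m >]].
have Jc : submod_closed Jp.
  split=> [|a r s /asboolP[b rb] /asboolP[c sc]]; apply/asboolP.
    by exists 0; rewrite mul0r subr0; apply: rpred0.
  exists (a * b + c).
  suff -> : a *: r + s - (a * b + c) * x = a *: (r - b * x) + (s - c * x).
    by apply: rpredD => //; apply: rpredZ.
  by rewrite -[a *: r]/(a * r) -[a *: (r - _)]/(a * (r - b * x)); ring.
apply: (mmax (SubmodulePred Jc)).
- by move=> r rm; apply/asboolP; exists 0; rewrite mul0r subr0.
- apply/negP => /asboolP[b b1]; apply: H; exists b.
  by rewrite -opprB; apply: memN.
- by apply/asboolP; exists 1; rewrite mul1r subrr; apply: rpred0.
Qed.

Lemma maximal_prime (m : submodule R^o) (x y : R) : maximal_ideal m ->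
  x \notin m -> y \notin m -> x * y \notin m.
Proof.
move=> mm xm ym; apply/negP => xym; case/negP: ym.
have [b bx] := maximal_inv mm xm.
have -> : y = b * (x * y) - y * (b * x - 1) by ring.
by apply: rpredB; apply: mmM.
Qed.

Definition max_compl (m : submodule R^o) (mm : maximal_ideal m) : mulset R :=
  @Mulset R (fun s => s \notin m) (proj1 mm) (fun s t sm tm => maximal_prime mm sm tm).

Lemma max_complD (m : submodule R^o) (mm : maximal_ideal m) s (c : R^o) :
  max_compl mm s -> c \in m -> max_compl mm (s + c).
Proof.
move=> /= sm cm; apply: contra sm => scm.
have -> : s = s + c - c by rewrite addrK.
by apply: rpredB.
Qed.

Definition is_ideal (I : R -> Prop) := I 0 /\ forall a x y, I x -> I y -> I (a * x + y).

Lemma exists_maximal (I : R -> Prop) : is_ideal I -> ~ I 1 ->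
  exists m : submodule R^o, maximal_ideal m /\ forall x, I x -> x \in m.
Proof.
move=> [I0 Il] I1.
pose Pr (A : set R) := A = set0 \/ [/\ is_ideal A, ~ A 1 & forall x, I x -> A x].
have [F FP tot|A [PA Amax]] := @Zorn_bigcup R Pr.
  have [[A [FA A0]]|none] := pselect (exists A, F A /\ A <> set0); last first.
    left; apply/seteqP; split=> // x [A FA Ax]; apply: none; exists A; split=> // A0.
    by rewrite A0 in Ax.
  have FI B : F B -> B <> set0 -> [/\ is_ideal B, ~ B 1 & forall x, I x -> B x].
    by move=> /FP[].
  right; have [[a0 al] a1 Ia] := FI A FA A0; split.
  - split=> [|a x y [B FB Bx] [D FD Dy]]; first by exists A.
    have B0 : B <> set0 by move=> B0; rewrite B0 in Bx.
    have D0 : D <> set0 by move=> D0; rewrite D0 in Dy.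
    have [BD|DB] := tot B D FB FD.
      by exists D => //; have [[_ Dl] _ _] := FI D FD D0; apply: Dl => //; apply: BD.
    by exists B => //; have [[_ Bl] _ _] := FI B FB B0; apply: Bl => //; apply: DB.
  - move=> [B FB B1]; have B0 : B <> set0 by move=> B0; rewrite B0 in B1.
    by have [] := FI B FB B0.
  - by move=> x Ix; exists A => //; apply: Ia.
have {PA} [[A0 Al] A1 IA] : [/\ is_ideal A, ~ A 1 & forall x, I x -> A x].
  case: PA => // A0; case: (Amax (I : set R)); last by right; split.
  rewrite A0; split=> [x //|]; move=> H; by have := H 0 I0.
pose p : {pred R^o} := [pred r | `[< A r >]].
have pc : submod_closed p.
  by split=> [|a x y /asboolP ax /asboolP ay]; apply/asboolP => //; apply: Al.
exists (SubmodulePred pc); split; last by move=> x Ix; apply/asboolP/IA.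
split; first by apply/negP => /asboolP.
move=> J mJ J1 x xJ; apply: contrapT => xm; case: (Amax ((fun y => y \in J) : set R)).
  split=> [y Ay|]; first by apply: mJ; apply/asboolP.
  by move=> H; apply: xm; apply/asboolP/H.
right; split=> //.
- by split=> [|a y z yJ zJ]; [exact: rpred0 | apply: rpredD => //; apply: mmM].
- by apply/negP.
- by move=> y Iy; apply: mJ; apply/asboolP/IA.
Qed.

Lemma local_global (I : R -> Prop) : is_ideal I ->
  (forall m, maximal_ideal m -> exists2 s, s \notin m & I s) -> I 1.
Proof.
move=> idI H; apply: contrapT => I1.
have [m [mm Im]] := exists_maximal idI I1.
by have [s /negP sm /Im] := H m mm.
Qed.

Lemma prime_in_maximal (p : spec R) : exists m : submodule R^o,
  maximal_ideal m /\ forall x, x \in p -> x \in m.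
Proof.
have [||m [mm pm]] := @exists_maximal (fun x => x \in p).
- by split=> [|a x y xp yp]; [exact: rpred0 | apply: rpredD => //; apply: mmM].
- exact/negP/prime_ideal1.
by exists m.
Qed.

Section Residue.
Variables (V : lmodType R) (m : submodule R^o) (mm : maximal_ideal m).
Local Notation sub N := (N 0 /\ forall a (x y : V), N x -> N y -> N (a *: x + y)).

(** The search for a complement of the line of [y] in [V] modulo [m V], one generator at a time:
    enlarging [N] must preserve that it misses [y]. *)
Lemma residue_grow (es : seq V) (N : V -> Prop) (y : V) :
  sub N -> (forall a x, a \in m -> N (a *: x)) -> ~ N y ->
  exists N' : V -> Prop, [/\ sub N', forall x, N x -> N' x, ~ N' y &
     forall e, e \in es -> exists b, N' (e - b *: y)].
Proof.
elim: es N => [|e es IH] N [N0 Nl] mN Ny; first by exists N; split.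
have Nd x x' : N x -> N x' -> N (x + x') by move=> h h'; rewrite -[x]scale1r; apply: Nl.
have Nz a x : N x -> N (a *: x) by move=> h; rewrite -[_ *: _]addr0; apply: Nl.
pose N1 x := exists a n, N n /\ x = n + a *: e.
(* If adding [e] would capture [y], the coefficient [a] is invertible modulo [m], so [e] is already
   a multiple of [y] modulo [N]; otherwise [e] is added. *)
have [[a [n [Nn yE]]]|N1y] := pselect (N1 y).
  have [N' [sN' NN' N'y eN']] := IH N (conj N0 Nl) mN Ny; exists N'; split=> // e'.
  rewrite inE => /predU1P[->|]; last exact: eN'.
  have am : a \notin m by apply/negP => am; apply: Ny; rewrite yE; apply: Nd => //; apply: mN.
  have [b ba] := maximal_inv mm am; exists b; apply: NN'.
  have -> : e - b *: y = (- b) *: n + (1 - b * a) *: e.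
    by rewrite yE scalerDr scalerA scalerBl scale1r scaleNr; zmod.
  by apply: Nd; [apply: Nz | apply: mN; rewrite -opprB; apply: memN].
have [||//|N' [sN' NN' N'y eN']] := IH N1.
- split=> [|b x x' [a [n [Nn ->]]] [a' [n' [Nn' ->]]]].
    by exists 0, 0; split=> //; rewrite scale0r addr0.
  exists (b * a + a'), (b *: n + n'); split; first exact: Nl.
  by rewrite scalerDr scalerA scalerDl; zmod.
- by move=> a x am; exists 0, (a *: x); split; [exact: mN | rewrite scale0r addr0].
exists N'; split=> // [x Nx|e'].
  by apply: NN'; exists 0, x; rewrite scale0r addr0.
rewrite inE => /predU1P[->|]; last exact: eN'.
by exists 0; rewrite scale0r subr0; apply: NN'; exists 1, 0; rewrite scale1r add0r.
Qed.

(** The coordinate along [y] with respect to the complement [N']. It is well defined modulo [m],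
    because a multiple of [y] lies in [N'] only if the factor lies in [m]. *)
Lemma residue_map (N : V -> Prop) (y : V) : fin_gen V ->
  sub N -> (forall a x, a \in m -> N (a *: x)) -> ~ N y ->
  exists r : V -> R, (forall a x x', r (a *: x + x') - (a * r x + r x') \in m) /\
    r y - 1 \in m.
Proof.
move=> [n [e eP]] sN mN Ny.
have [N' [[N0 Nl] NN' N'y eN']] := residue_grow [seq e k | k <- enum 'I_n] sN mN Ny.
have Nd x x' : N' x -> N' x' -> N' (x + x') by move=> h h'; rewrite -[x]scale1r; apply: Nl.
have Nz a x : N' x -> N' (a *: x) by move=> h; rewrite -[_ *: _]addr0; apply: Nl.
have /choice[r rP] x : exists b, N' (x - b *: y).
  have [c ->] := eP x.
  have /choice[b bP] k : exists b, N' (e k - b *: y).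
    by apply: eN'; apply: map_f; rewrite mem_enum.
  exists (\sum_k c k * b k); rewrite scaler_suml -sumrB.
  elim/big_ind: _ => // k _.
  suff -> : c k *: e k - (c k * b k) *: y = c k *: (e k - b k *: y) by apply: Nz.
  by rewrite scalerBr scalerA.
have key c : N' (c *: y) -> c \in m.
  move=> cy; apply: contrapT => /negP cm; apply: N'y.
  have [b bc] := maximal_inv mm cm.
  have -> : y = b *: (c *: y) + (1 - b * c) *: y by rewrite scalerA -scalerDl addrC subrK scale1r.
  by apply: Nd; [apply: Nz | apply/NN'/mN; rewrite -opprB; apply: memN].
exists r; split=> [a x x'|]; apply: key.
  have -> : (r (a *: x + x') - (a * r x + r x')) *: y =
    a *: (x - r x *: y) + ((x' - r x' *: y) + (-1) *: (a *: x + x' - r (a *: x + x') *: y)).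
    rewrite scalerBl scalerDl -!scalerA !scalerBr !scaleN1r; zmod.
  by apply: (Nd); [exact: Nz | apply: (Nd) => //; exact: Nz].
have -> : (r y - 1) *: y = (-1) *: (y - r y *: y) by rewrite scalerBl scale1r scaleN1r opprB.
exact: Nz.
Qed.
End Residue.
End Maximal.

(** * Universal property of the tensor product *)

Section TensorLift.
Variables (R S : comPzRingType) (phi : {rmorphism R -> S}) (M : lmodType R).
Variables (N W : lmodType S) (b : M -> N -> W).
Hypothesis bl : forall r m m' n, b (r *: m + m') n = phi r *: b m n + b m' n.
Hypothesis br : forall s m n n', b m (s *: n + n') = s *: b m n + b m n'.

Lemma tens_lift : exists h : {linear tensor phi M N -> W},
  forall s, h (tens_pi phi s) = \sum_(p <- s) b p.1 p.2.
Proof.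
have b0 n : b 0 n = 0.
  by have := bl 1 0 0 n; rewrite rmorph1 !scale1r addr0 => /eqP; rewrite -subr_eq subrr eq_sym => /eqP.
have b0r m : b m 0 = 0.
  by have := br 1 m 0 0; rewrite !scale1r addr0 => /eqP; rewrite -subr_eq subrr eq_sym => /eqP.
pose h (t : tensor phi M N) := \sum_(p <- tens_repr t) b p.1 p.2.
have hE s : h (tens_pi phi s) = \sum_(p <- s) b p.1 p.2.
  rewrite /h; have := tens_pi_repr phi s; move: (tens_repr _) => t.
  elim=> {s t} //.
  - by move=> s t u _ -> _ ->.
  - by move=> s s' t t' _ e _ e'; rewrite !big_cat /= e e'.
  - by move=> s t; rewrite !big_cat /= addrC.
  - by move=> n; rewrite big_seq1 big_nil b0.
  - move=> m m' n; rewrite !big_cons !big_nil /= !addr0.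
    by have := bl 1 m m' n; rewrite rmorph1 !scale1r.
  - move=> m n n'; rewrite !big_cons !big_nil /= !addr0.
    by have := br 1 m n n'; rewrite !scale1r.
  - move=> r m n; rewrite !big_seq1 /=.
    have := bl r m 0 n; rewrite !addr0 b0 addr0 => ->.
    by have := br (phi r) m n 0; rewrite !addr0 b0r addr0.
have hl : linear h.
  move=> a t u; rewrite -(tens_reprK t) -(tens_reprK u).
  rewrite -[a *: _]/(tens_scale a _) tens_scaleE -tens_piD !hE big_cat big_map /=.
  congr (_ + _); rewrite scaler_sumr; apply: eq_bigr => p _.
  by have := br a p.1 p.2 0; rewrite !addr0 b0r addr0.
by exists (mklin hl) => s; rewrite (mklinE hl).
Qed.
End TensorLift.

Section Pure.
Variables (R S : comPzRingType) (phi : {rmorphism R -> S}) (M : lmodType R) (N : lmodType S).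
Local Notation pure := (@pure R S phi M N).
Lemma pureDl m m' n : pure (m + m') n = pure m n + pure m' n.
Proof. by rewrite -tens_piD; apply/tens_piP/tens_addl. Qed.
Lemma pureDr m n n' : pure m (n + n') = pure m n + pure m n'.
Proof. by rewrite -tens_piD; apply/tens_piP/tens_addr. Qed.
Lemma pureZr s m n : pure m (s *: n) = s *: pure m n.
Proof. by rewrite -[s *: pure m n]/(tens_scale s _) tens_scaleE. Qed.
Lemma pureZl r m n : pure (r *: m) n = pure m (phi r *: n).
Proof. by apply/tens_piP/tens_bal. Qed.
Lemma pure_sumr m k (n : 'I_k -> N) : pure m (\sum_i n i) = \sum_i pure m (n i).
Proof.
elim/big_ind2: _ => // [|x y x' y' <- <-]; last exact: pureDr.
by apply: (addrI (pure m 0)); rewrite -pureDr !addr0.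
Qed.
Lemma pure_suml n k (m : 'I_k -> M) : pure (\sum_i m i) n = \sum_i pure (m i) n.
Proof.
elim/big_ind2: _ => // [|x y x' y' <- <-]; last exact: pureDl.
by apply: (addrI (pure 0 n)); rewrite -pureDl !addr0.
Qed.
Lemma tens_sum s : tens_pi phi s = \sum_(p <- s) pure p.1 p.2.
Proof.
elim: s => [|[m n] s IH]; first by rewrite big_nil.
by rewrite big_cons -IH -[_ :: s]cat1s tens_piD.
Qed.
End Pure.

Section LineBundle.
Variable R : comPzRingType.

(* [e] generates [L] and has zero annihilator after inverting [s]. *)
Definition local_gen (L : lmodType R) (s : R) (e : L) :=
  (forall x, exists r, s *: x = r *: e) /\ forall r, r *: e = 0 -> s * r = 0.

(** One factor [s] makes [x] a multiple of [e], the second makes the multiplier unique. *)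
Lemma local_gen_form (L : lmodType R) s (e : L) : local_gen s e ->
  exists p : {linear L -> R^o}, (forall x, p x *: e = (s * s) *: x) /\ p e = s * s.
Proof.
move=> [gs an].
have [||y [r [/esym r0 ->]]|p pP] := @rel_linear R L R^o (fun x y => exists r, s *: x = r *: e /\ y = s * r).
- by move=> x; have [r rE] := gs x; exists (s * r), r.
- move=> a x x' y y' [r [xr ->]] [r' [xr' ->]]; exists (a * r + r'); split.
    by rewrite scalerDr scalerA mulrC -scalerA xr xr' scalerDl scalerA.
  by rewrite -[a *: _]/(a * _); ring.
- by rewrite scaler0 in r0; apply: an.
exists p; split=> [x|].
  by have [r [xr ->]] := pP x; rewrite -!scalerA xr scalerA mulrC.
have [r [er ->]] := pP e; apply/eqP; rewrite -subr_eq0 -mulrBr.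
by rewrite an // scalerBl er subrr.
Qed.

Section Line.
Variable L : lmodType R.
Hypothesis Lm : forall m, maximal_ideal m -> exists s (e : L), s \notin m /\ local_gen s e.

(** The [t] for which multiplication by [t] factors through a finite free module form an ideal,
    which by [local_gen_form] is contained in no maximal ideal. *)
Lemma locally_free_fgproj : fgproj L.
Proof.
pose I t := exists n (e : 'I_n -> L) (p : 'I_n -> {linear L -> R^o}),
  forall x, t *: x = \sum_k p k x *: e k.
suff [n [e [p eP]]] : I 1 by exists n, e, p => x; rewrite -eP scale1r.
apply: local_global.
  split=> [|a t u [n [e [p tE]]] [n' [e' [p' uE]]]].
    by exists 0%N, (fun=> 0), (fun=> \0) => x; rewrite big_ord0 scale0r.
  exists (n + n')%N, (fun k => match split k with inl k => a *: e k | inr k => e' k end),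
    (fun k => match split k with inl k => p k | inr k => p' k end) => x.
  rewrite scalerDl -scalerA tE uE big_split_ord /=; congr (_ + _).
    rewrite scaler_sumr; apply: eq_bigr => k _.
    have := unsplitK (inl k : 'I_n + 'I_n')%type; rewrite /unsplit => ->.
    by rewrite !scalerA mulrC.
  apply: eq_bigr => k _.
  by have := unsplitK (inr k : 'I_n + 'I_n')%type; rewrite /unsplit => ->.
move=> m mm; have [s [e [sm /local_gen_form[p [pE _]]]]] := Lm mm.
exists (s * s); first exact: maximal_prime.
by exists 1%N, (fun=> e), (fun=> p) => x; rewrite big_ord1 pE.
Qed.

Lemma locally_free_rank_one : rank_one L.
Proof.
move=> p; have [m [mm pm]] := prime_in_maximal p.
have [s [e [sm /local_gen_form[f [fE fe]]]]] := Lm mm.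
have sp : s * s \notin p.
  by apply/negP => /pm; apply/negP/maximal_prime.
pose d : denom p := exist (fun x => is_true (x \notin p)) _ sp.
(* The inverse of [s * s], which turns the form [f] into a coordinate on the localization. *)
pose v : loc p := loc_pi (1, d).
have vs : v * loc_map p (s * s) = 1.
  rewrite [LHS]loc_mulE; apply: loc_pi_eq; rewrite denM den1 /=.
  by rewrite /den /=; ring.
have [|c x y y'|h hE] := @tens_lift R (loc p) (@loc_map R p) L (loc p)^o (loc p)^o
    (fun x c => loc_map p (f x) * c).
- by move=> r x x' c; rewrite linearP rmorphD rmorphM mulrDl -mulrA.
- by rewrite mulrDr -[c *: y]/(c * y) mulrCA.
have key t : loc_map p (s * s) *: t = pure (@loc_map R p) e (h t).
  rewrite -(tens_reprK t) hE tens_sum.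
  elim: (tens_repr t) => [|[x c] q IH].
    by rewrite !big_nil scaler0; have := @pure_sumr R (loc p) (@loc_map R p) L (loc p)^o e 0 (fun=> 0); rewrite !big_ord0.
  rewrite !big_cons scalerDr IH pureDr; congr (_ + _).
  by rewrite -pureZr -pureZl -fE pureZl.
exists h; exists (fun c => @pure R (loc p) (@loc_map R p) L (loc p)^o e (v *: c)) => [t|c].
  by rewrite pureZr -key scalerA vs scale1r.
rewrite hE big_seq1 /= fe -[v *: c]/(v * c).
by rewrite (mulrA (loc_map p _)) (mulrC _ v) vs; apply: mul1r.
Qed.

Definition locally_free_line : line_bundle R :=
  LineBundle (fgproj_fin_gen locally_free_fgproj)
    (fgproj_projective locally_free_fgproj) locally_free_rank_one.
End Line.

Lemma regular_local_gen (m : submodule R^o) : maximal_ideal m ->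
  exists s (e : R^o), s \notin m /\ local_gen s e.
Proof.
move=> [m1 _]; exists 1, 1; split=> //; split=> [x|r r1].
  by exists x; rewrite scale1r; apply/esym/mulr1.
by rewrite mul1r -[r]mulr1.
Qed.
End LineBundle.

Lemma tensor_regular (R S : comPzRingType) (phi : {rmorphism R -> S}) (N : lmodType S) :
  @mod_iso S (tensor phi R^o N) N.
Proof.
have [||h hE] := @tens_lift R S phi R^o N N (fun r n => phi r *: n).
- by move=> r m m' n; rewrite -[r *: m]/(r * m) rmorphD rmorphM scalerDl scalerA.
- by move=> s m n n'; rewrite scalerDr !scalerA mulrC.
exists h; exists (fun n => pure phi (1 : R^o) n) => [t|n].
  rewrite -[t in RHS](tens_reprK t) -[t in LHS]tens_reprK hE.
  elim: (tens_repr t) => [|[r n] s IH].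
    by rewrite big_nil -[RHS]/(0 : tensor phi R^o N) -(scale0r 0) pureZr scale0r.
  rewrite big_cons pureDr IH -[in RHS]cat1s tens_piD; congr (_ + _).
  have e : r *: (1 : R^o) = r by exact: mulr1.
  by rewrite -pureZl e.
by rewrite hE big_seq1 /= rmorph1 scale1r.
Qed.

(** * Hom(Hom(N, J), J') *)

Lemma delta_sum (R : comPzRingType) (V : lmodType R) n (l : 'I_n) (x : 'I_n -> V) :
  \sum_k (k == l)%:R *: x k = x l.
Proof.
rewrite (bigD1 l) //= eqxx scale1r big1 ?addr0 // => k /negPf ->.
by rewrite scale0r.
Qed.

Section StalkEval.
Variables (R : comPzRingType) (N : lmodType R) (A : complex R).
Local Notation HN := (hom (stalk 0 N) A).

Fact sin_cyc (x : N) : cyc (sin 0 N 0 x : stalk 0 N 0).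
Proof. by []. Qed.
Definition sev (x : N) : chain_map HN A := ev A (sin_cyc x).
Lemma sevE x i f : sev x i f = hc f 0 i (sin 0 N 0 x).
Proof. exact: evE. Qed.
Lemma sevD a x y i f : sev (a *: x + y) i f = a *: sev x i f + sev y i f.
Proof. by rewrite !sevE (linD (sin 0 N 0)) (linZ (sin 0 N 0)) (linD (hc _ _ _)) (linZ (hc _ _ _)). Qed.
Lemma sev0 i f : sev 0 i f = 0.
Proof. by rewrite sevE (lin0 (sin 0 N 0)) (lin0 (hc _ _ _)). Qed.
Lemma sev_sum n (c : 'I_n -> R) (x : 'I_n -> N) i f :
  sev (\sum_l c l *: x l) i f = \sum_l c l *: sev (x l) i f.
Proof.
elim/big_rec2: _ => [|l y z _ <-]; first exact: sev0.
exact: sevD.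
Qed.

Section Multiples.
Variable p : {linear N -> R^o}.
Let b n (y : A n) (q : stalk 0 N 0) : A n := p (sout 0 N 0 q) *: y.
Fact pim_l n y : linear (@b n y).
Proof. by move=> a q q'; rewrite /b !linearP scalerDl scalerA. Qed.
Fact pim_r n q : linear (fun y => @b n y q).
Proof. by move=> a y y'; rewrite /b scalerDr !scalerA mulrC. Qed.
Fact pim_d n m y q : b (dif A n m y) q = dif A n m (b y q).
Proof. by rewrite /b difZ. Qed.
Fact pim_0 n y q : bnd q -> @b n y q = 0.
Proof. by move=> [k [q' <-]]; rewrite /b stalk_dif0 !lin0 scale0r. Qed.
Definition pim : chain_map A HN := pairing pim_l pim_r pim_d pim_0.
Lemma sev_pim x i y : sev x i (pim i y) = p x *: y.
Proof. by rewrite sevE pairingE ?add0r // !idm_id /b sinK. Qed.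
End Multiples.

Lemma pim_sev n (e : 'I_n -> N) (p : 'I_n -> {linear N -> R^o}) i (f : HN i) :
  dual_basis e p -> f = \sum_k pim (p k) i (sev (e k) i f).
Proof.
move=> ep; apply: hom_stalk_eq => j q ji; rewrite hc_sum {1}(ep q) !lin_sum.
apply: eq_bigr => k _; rewrite (linZ (sin _ _ _)) (linZ (hc _ _ _)).
rewrite add0r in ji; rewrite pairingE ?add0r // ji !idm_id sinK //.
by rewrite sevE.
Qed.
End StalkEval.

Section DoubleHom.
Variables (R : comPzRingType) (J J' : complex R).
Implicit Types (N K : lmodType R).
Local Notation X := (hom J J').
(* For [N] of finite projective dimension, [dhom N] computes the derived      *)
(* tensor product of [X] and [N], with [dterm xi x] in the role of the pure   *)
(* tensors.                                                                   *)
Definition dhom N : complex R := hom (hom (stalk 0 N) J) J'.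
Definition dterm N i (xi : X i) (x : N) : dhom N i := hpre J' (sev J x) i xi.
Definition dmap K N (g : {linear K -> N}) : chain_map (dhom K) (dhom N) :=
  hpre J' (hpre J (stalk_map 0 g)).

Lemma dtermZ N i (xi : X i) (x : N) a : dterm (a *: xi) x = a *: dterm xi x.
Proof. exact: chZ. Qed.
Lemma dtermB N i (xi zeta : X i) (x : N) : dterm (xi - zeta) x = dterm xi x - dterm zeta x.
Proof. exact: chB. Qed.
Lemma dterm_suml N i n (xi : 'I_n -> X i) (x : N) :
  dterm (\sum_l xi l) x = \sum_l dterm (xi l) x.
Proof. exact: chS. Qed.
Lemma dterm_sumr N i n (xi : X i) (c : 'I_n -> R) (x : 'I_n -> N) :
  dterm xi (\sum_l c l *: x l) = \sum_l c l *: dterm xi (x l).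
Proof.
apply: hcP => u v f vu; rewrite hpreE sev_sum (lin_sum (hc xi u v)) hc_sum.
by apply: eq_bigr => l _; rewrite hcZ hpreE (linZ (hc xi u v)).
Qed.
Lemma dterm_cyc N i (xi : X i) (x : N) : cyc xi -> cyc (dterm xi x).
Proof. exact: chain_cyc. Qed.

Lemma dmap_term K N (g : {linear K -> N}) i (xi : X i) (x : K) :
  dmap g i (dterm xi x) = dterm xi (g x).
Proof.
apply: hcP => u v f vu; rewrite !hpreE; congr (hc xi u v _).
by rewrite !sevE hpreE stalk_mapE sinK.
Qed.

Lemma dpim_term N (p : {linear N -> R^o}) i (xi : X i) (x : N) :
  hpre J' (pim J p) i (dterm xi x) = p x *: xi.
Proof.
by apply: hcP => u v f vu; rewrite !hpreE sev_pim hcZ (linZ (hc xi u v)).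
Qed.

Lemma dterm_pim N n (e : 'I_n -> N) (p : 'I_n -> {linear N -> R^o}) i (z : dhom N i) :
  dual_basis e p -> z = \sum_k dterm (hpre J' (pim J (p k)) i z) (e k).
Proof.
move=> ep; apply: hcP => u v f vu; rewrite hc_sum.
rewrite [X in hc z u v X](pim_sev f ep) (lin_sum (hc z u v)).
by apply: eq_bigr => k _; rewrite !hpreE.
Qed.

Variables (U : mulset R) (i0 : int).

(** When X vanishes below [i0] near [U], the homology of [dhom N] vanishes below [i0] and equals
    H(X) tensored with [N] in degree [i0]. [dspan] is surjectivity of the tensor product onto it;
    [dgen] is injectivity in equational form: a sum of terms over generators [e] vanishes only
    through relations of [e]. *)
Definition dnull N := forall j, j < i0 -> unull U (dhom N) j.
Definition dspan N := forall z : dhom N i0, cyc z ->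
  exists s n (xi : 'I_n -> X i0) (x : 'I_n -> N),
    [/\ U s, forall l, cyc (xi l) & bnd (s *: z - \sum_l dterm (xi l) (x l))].
Definition dgen N n (e : 'I_n -> N) := forall xi : 'I_n -> X i0, (forall l, cyc (xi l)) ->
  ubnd U (\sum_l dterm (xi l) (e l)) ->
  exists s q (zeta : 'I_q -> X i0) (g : 'I_q -> 'I_n -> R),
    [/\ U s, forall k, cyc (zeta k), forall l, bnd (s *: xi l - \sum_k g k l *: zeta k) &
        forall k, \sum_l g k l *: e l = 0].

Hypotheses (KJ : K_injective J) (KJ' : K_injective J').
Hypothesis X0 : forall j, j < i0 -> unull U X j.

Lemma dhom_fgproj N : fgproj N -> [/\ dnull N, dspan N &
  exists n (e : 'I_n -> N), (forall x, exists c : 'I_n -> R, x = \sum_l c l *: e l) /\ dgen e].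
Proof.
move=> [n [e [p ep]]]; split.
- move=> j ji z cz; rewrite (dterm_pim z ep).
  elim/big_ind: _ => [|x y|k _]; [exact/bnd_ubnd/bnd0 | exact: ubndD |].
  by apply: chain_ubnd; apply: X0 => //; apply: chain_cyc.
- move=> z cz; exists 1, n, (fun k => hpre J' (pim J (p k)) i0 z), e; split.
  + exact: ms1.
  + by move=> l; apply: chain_cyc.
  + by rewrite scale1r -(dterm_pim z ep) subrr; apply: bnd0.
exists n, e; split=> [x|xi cxi [s Us bs]]; first by exists (fun k => p k x).
(* Expanding [e k] in the dual basis makes each row [g k] a relation of [e]; what the rows leave
   over is the [p l]-component of the given sum, a boundary. *)
exists s, n, (fun k => s *: xi k), (fun k l => (k == l)%:R - p l (e k)); split=> //.
- by move=> k; apply: cycZ.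
- move=> l; have := chain_bnd (hpre J' (pim J (p l))) bs.
  rewrite lZ lS; congr bnd; under eq_bigr => k _ do rewrite dpim_term.
  under [in RHS]eq_bigr => k _ do rewrite scalerBl.
  rewrite sumrB delta_sum scaler_sumr opprB addrC subrK; apply: eq_bigr => k _.
  by rewrite !scalerA mulrC.
- move=> k; under eq_bigr => l _ do rewrite scalerBl.
  rewrite sumrB -ep (bigD1 k) //= eqxx scale1r big1 ?addr0 ?subrr // => l /negPf.
  by rewrite eq_sym => ->; rewrite scale0r.
Qed.

(** Induction along a resolution: with vanishing below [i0], the long exact sequence is right exact
    in degree [i0]. For [dgen], a vanishing sum lifts to the free cover, comes from the syzygy [K],
    and terms spanning there supply the relations. *)
Lemma dhom_proj_dim N : proj_dim N -> [/\ dnull N, dspan N &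
  exists n (e : 'I_n -> N), (forall x, exists c : 'I_n -> R, x = \sum_l c l *: e l) /\ dgen e].
Proof.
elim=> {N} [N|n K N a g ex _ [nK sK _]]; first exact: dhom_fgproj.
have [nF sF _] := dhom_fgproj (free_fgproj R n).
have tri : triangle (dmap a) (dmap g).
  exact/K_triangle/K_triangle/exact_triangle/stalk_exact.
split.
- move=> j ji; apply: (unull_right tri (j := j - 1)); first by rewrite subrK.
    exact: nF.
  by apply: nK; lia.
- move=> z cz; have n0 : unull U (dhom K) (i0 - 1) by apply: nK; lia.
  have ij : i0 = i0 - 1 + 1 by rewrite subrK.
  have [s [x [Us cx sx]]] := tri_lift tri ij n0 cz.
  have [t [m [xi [y [Ut cxi tx]]]]] := sF x cx.
  exists (t * s), m, xi, (fun l => g (y l)); split=> //; first exact: msM.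
  rewrite -scalerA; apply: (@bnd_trans _ _ _ _ (t *: dmap g i0 x)).
    by rewrite -scalerBr; apply: bndZ.
  have := chain_bnd (dmap g) tx; rewrite lB lZ lS.
  by under eq_bigr => l _ do rewrite dmap_term.
exists n, (fun l => g (fbasis R l)); split=> [x|xi cxi ux].
  have [c <-] := ses_surj ex x; exists c.
  by rewrite {1}(fbasisE c) lin_sum; apply: eq_bigr => l _; rewrite linZ.
pose x := \sum_l dterm (xi l) (fbasis R l).
have cx : cyc x by apply: cyc_sum => l; apply: dterm_cyc.
have [|s [k [Us ck sk]]] := tri_uexact tri cx (U := U).
  by rewrite lS; under eq_bigr => l _ do rewrite dmap_term.
have [t [q [zeta [kap [Ut cz tk]]]]] := sK k ck.
exists (t * s), q, zeta, (fun r l => a (kap r) l); split=> //; first exact: msM.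
- move=> l.
  have b1 : bnd ((t * s) *: x - \sum_r dterm (zeta r) (a (kap r))).
    rewrite -scalerA; apply: (@bnd_trans _ _ _ _ (t *: dmap a i0 k)).
      by rewrite -scalerBr; apply: bndZ.
    have := chain_bnd (dmap a) tk; rewrite lB lZ lS.
    by under eq_bigr => r _ do rewrite dmap_term.
  have := chain_bnd (hpre J' (pim J (coord R l))) b1; rewrite lB lZ !lS.
  under eq_bigr => r _ do rewrite dpim_term /coord (mklinE (@coord_linear R n l)).
  under [X in _ - X]eq_bigr => r _ do rewrite dpim_term /coord (mklinE (@coord_linear R n l)).
  rewrite (bigD1 l) //= {1}/fbasis eqxx scale1r big1 ?addr0 // => r.
  by rewrite /fbasis => /negPf ->; rewrite scale0r.
- move=> r; rewrite -[RHS](ses_comp ex (kap r)) [in RHS](fbasisE (a (kap r))) lin_sum.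
  by apply: eq_bigr => l _; rewrite linZ.
Qed.
End DoubleHom.

(** * Residues of tensors *)

Section Residual.
Variables (R : comPzRingType) (mm : submodule R^o).

(** Membership of the class of [z] in the submodule mm H_i(M). *)
Definition mspan (M : complex R) i (z : M i) := exists n (c : 'I_n -> R) (v : 'I_n -> M i),
  [/\ forall k, c k \in mm, forall k, cyc (v k) & bnd (z - \sum_k c k *: v k)].

Lemma mspanD (M : complex R) i (z z' : M i) : mspan z -> mspan z' -> mspan (z + z').
Proof.
move=> [n [c [v [cm cv b]]]] [n' [c' [v' [cm' cv' b']]]].
exists (n + n')%N, (fun k => match split k with inl k => c k | inr k => c' k end),
  (fun k => match split k with inl k => v k | inr k => v' k end); split.
- by move=> k; case: (split k).
- by move=> k; case: (split k).
rewrite big_split_ord /=.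
rewrite (eq_bigr (fun k => c k *: v k)); last first.
  by move=> k _; have := unsplitK (inl k : 'I_n + 'I_n')%type; rewrite /unsplit => ->.
rewrite [X in _ - (_ + X)](eq_bigr (fun k => c' k *: v' k)); last first.
  by move=> k _; have := unsplitK (inr k : 'I_n + 'I_n')%type; rewrite /unsplit => ->.
by have := bndD b b'; congr bnd; zmod.
Qed.

Lemma mspanZ (M : complex R) i (z : M i) a : mspan z -> mspan (a *: z).
Proof.
move=> [n [c [v [cm cv b]]]]; exists n, (fun k => a * c k), v; split=> //.
  by move=> k; apply: mmM.
have := bndZ a b; rewrite scalerBr scaler_sumr.
by under eq_bigr => k _ do rewrite scalerA.
Qed.

Lemma mspan_bnd (M : complex R) i (z z' : M i) : bnd (z - z') -> mspan z' -> mspan z.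
Proof. by move=> b [n [c [v [cm cv b']]]]; exists n, c, v; split=> //; apply: bnd_trans b b'. Qed.

Lemma mspan1 (M : complex R) i (z : M i) c : c \in mm -> cyc z -> mspan (c *: z).
Proof.
move=> cm cz; exists 1%N, (fun=> c), (fun=> z); split=> //.
by rewrite big_ord1 subrr; apply: bnd0.
Qed.

Lemma mspan0 (M : complex R) i : mspan (0 : M i).
Proof.
exists 0%N, (fun=> 0), (fun=> 0); split=> [[]|[]|] //.
by rewrite big_ord0 subrr; apply: bnd0.
Qed.

Variables (N : lmodType R) (rho : N -> R).
Hypothesis rhol : forall a x y, rho (a *: x + y) - (a * rho x + rho y) \in mm.

Lemma rho_sum n (c : 'I_n -> R) (e : 'I_n -> N) :
  rho (\sum_l c l *: e l) - \sum_l c l * rho (e l) \in mm.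
Proof.
elim/big_rec2: _ => [|l y z _ IH].
  have := rhol 1 0 0; rewrite scale1r addr0 mul1r => /memN.
  by rewrite subr0 opprB addrK.
have -> : rho (c l *: e l + z) - (c l * rho (e l) + y) =
  (rho (c l *: e l + z) - (c l * rho (e l) + rho z)) + (rho z - y) by ring.
exact: rpredD.
Qed.

(** The functional [rho] induces a map from H(X) tensored with [N] to H(X)/mm H(X), so a vanishing
    tensor has residue zero. [dgen] replaces the tensor by relations of the [e l], and [rho] kills
    each of these modulo [mm]. *)
Lemma dgen_residue (J J' : complex R) (U : mulset R) i0 n (e : 'I_n -> N) :
    (forall x, exists c : 'I_n -> R, x = \sum_l c l *: e l) ->
    dgen J J' U i0 e ->
  forall m (xi : 'I_m -> hom J J' i0) (x : 'I_m -> N), (forall t, cyc (xi t)) ->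
  ubnd U (\sum_t dterm (xi t) (x t)) ->
  exists2 s, U s & mspan (s *: \sum_t rho (x t) *: xi t).
Proof.
move=> eP ge m xi x cxi ux.
have /choice[d dE] t := eP (x t).
have [||s [q [zeta [g [Us cz gz ge0]]]]] := ge (fun l => \sum_t d t l *: xi t).
- by move=> l; apply: cyc_sum => t; apply: cycZ.
- move: ux; congr ubnd.
  under eq_bigr => t _ do rewrite dE dterm_sumr.
  rewrite exchange_big; apply: eq_bigr => l _; rewrite dterm_suml.
  by apply: eq_bigr => t _; rewrite dtermZ.
exists s => //.
have -> : s *: \sum_t rho (x t) *: xi t =
    \sum_l rho (e l) *: (s *: \sum_t d t l *: xi t) +
    s *: \sum_t (rho (x t) - \sum_l d t l * rho (e l)) *: xi t.
  have -> : \sum_l rho (e l) *: (s *: \sum_t d t l *: xi t) =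
      s *: \sum_t (\sum_l d t l * rho (e l)) *: xi t.
    under [in RHS]eq_bigr => t _ do rewrite scaler_suml.
    rewrite exchange_big scaler_sumr; apply: eq_bigr => l _.
    rewrite scalerA mulrC -scalerA scaler_sumr; congr (_ *: _).
    by apply: eq_bigr => t _; rewrite scalerA mulrC.
  rewrite -scalerDr -big_split; congr (_ *: _); apply: eq_bigr => t _ /=.
  by rewrite scalerBl addrC subrK.
apply: mspanD; last first.
  apply: mspanZ; elim/big_ind: _ => [|a b|t _]; [exact: mspan0 | exact: mspanD |].
  by apply: mspan1 => //; rewrite {1}dE; apply: rho_sum.
apply: (@mspan_bnd _ _ _ (\sum_l rho (e l) *: \sum_k g k l *: zeta k)).
  rewrite -sumrB; apply: bnd_sum => l; rewrite -scalerBr; exact: bndZ.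
have -> : \sum_l rho (e l) *: (\sum_k g k l *: zeta k) =
    \sum_k (\sum_l g k l * rho (e l)) *: zeta k.
  under [in RHS]eq_bigr => k _ do rewrite scaler_suml.
  rewrite exchange_big; apply: eq_bigr => l _; rewrite scaler_sumr.
  by apply: eq_bigr => k _; rewrite scalerA mulrC.
elim/big_ind: _ => [|a b|k _]; [exact: mspan0 | exact: mspanD |].
apply: mspan1 => //; have := memN (rho_sum (g k) e); rewrite ge0 opprB => gm.
have r0 : rho 0 \in mm.
  by have := rho_sum (fun _ : 'I_0 => 0) (fun=> 0); rewrite !big_ord0 subr0.
by rewrite -[X in X \in _](subrK (rho 0)); apply: rpredD.
Qed.
End Residual.

(** * Semidualizing complexes *)

Section HomElements.
Variable R : comPzRingType.
Implicit Types (A B C D : complex R).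

Definition hel A B (f : chain_map A B) : hom A B 0 :=
  hmk 0 (fun i j => idm B i j \o f i).
Lemma helE A B (f : chain_map A B) i x : hc (hel f) i i x = f i x.
Proof. by rewrite hmk_compE ?addr0 // idm_id. Qed.
Lemma helE' A B (f : chain_map A B) i j x : j = i -> hc (hel f) i j x = idm B i j (f i x).
Proof. by move=> ji; rewrite hmk_compE ?addr0. Qed.

Lemma hel_cyc A B (f : chain_map A B) : cyc (hel f).
Proof.
apply/hcyc => i j k l x kj il ki; rewrite !helE'; try lia.
by rewrite /sg expr0 scale1r dif_idm -?chain_comm ?idm_dif //; lia.
Qed.

Lemma hel_surj A B (z : hom A B 0) : cyc z -> exists f : chain_map A B, z = hel f.
Proof.
move=> cz; have fc i j x : dif B i j (hc z i i x) = hc z j j (dif A i j x).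
  have [ij|ne] := eqVneq i (j + 1); last by rewrite !dif_shape // (lin0 (hc _ _ _)).
  have := (hcyc z).1 cz i j i j x ij ij; rewrite addr0 => /(_ erefl).
  by rewrite /sg expr0 scale1r.
exists (ChainMap fc); apply: hcP => i j x; rewrite addr0 => ->.
by rewrite helE.
Qed.

Lemma hpre_hel A B C (u : chain_map A B) (f : chain_map B C) :
  hpre C u 0 (hel f) = hel (ccomp f u).
Proof. by apply: hcP => i j x; rewrite addr0 => ->; rewrite hpreE !helE. Qed.

Lemma hpost_hel A B C (f : chain_map B C) (u : chain_map A B) :
  hpost A f 0 (hel u) = hel (ccomp f u).
Proof. by apply: hcP => i j x; rewrite addr0 => ->; rewrite hpostE !helE. Qed.

Lemma hpost_homotopic A B C (f g : chain_map B C) n (z : hom A B n) :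
  bnd (hel f - hel g) -> cyc z -> bnd (hpost A f n z - hpost A g n z).
Proof.
move=> /(bndE (j := 1))[//|w wE] cz.
exists (n + 1), (hmk (n + 1) (fun u v => hc w (v - 1) v \o hc z u (v - 1))).
apply: hbnd => // i j k l x kj il ji.
rewrite hcB !hpostE !hmk_compE; try lia.
have := congr1 (fun h => hc h j j (hc z i j x)) wE.
rewrite (hc_dif _ (k := j + 1) (l := j - 1)) ?subrK ?addr0 // hcB !helE => <-.
have kj' : k - 1 = j by lia.
rewrite kj' -kj; congr (_ - _).
have := (hcyc z).1 cz i (j - 1) j l x; rewrite subrK => -> //.
rewrite (sgS R (erefl (n + 1))) (linZ (hc _ _ _)) scaleNr !scalerA.
by rewrite mul1r scaleNr.
Qed.

Lemma hpre_homotopic A B C (f g : chain_map A B) n (z : hom B C n) :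
  bnd (hel f - hel g) -> cyc z -> bnd (hpre C f n z - hpre C g n z).
Proof.
move=> /(bndE (j := 1))[//|w wE] cz.
exists (n + 1), (sg R n *: hmk (n + 1) (fun u v => hc z (u + 1) v \o hc w u (u + 1))).
apply: hbnd => // i j k l x kj il ji.
rewrite hcB !hpreE !hcZ !hmk_compE; try lia.
have := congr1 (fun h => hc z i j (hc h i i x)) wE.
rewrite (hc_dif _ (k := i + 1) (l := l)) ?addr0 // hcB !helE -(linB (hc z i j)) => <-.
have -> : sg R 1 = - 1 by rewrite /sg expr1.
rewrite scaleN1r opprK (linD (hc _ _ _)) (sgS R (erefl (n + 1))) scaleNr opprK sgK -il difZ.
congr (_ + _).
by rewrite ((hcyc z).1 cz (i + 1) j k i) ?sgK //; lia.
Qed.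
End HomElements.

Section FinGenTotal.
Variables (R : comPzRingType) (C : complex R).

Definition single i (h : homology C i) : prodm (homology C) := fun j =>
  if i =P j is ReflectT e then ecast j (homology C j) e h else 0.
Lemma single_id i h : @single i h i = h.
Proof. by rewrite /single; case: eqP => // e; rewrite (eq_axiomK e). Qed.
Lemma single_sub i h : @single i h \in SubmodulePred (@total_homology_closed R C).
Proof.
apply/asboolP; exists [:: i] => j; rewrite inE /single => ne.
by case: eqP => // e; rewrite e eqxx in ne.
Qed.

Definition single_total i (h : homology C i) : total_homology C :=
  exist _ (single h) (single_sub h).

Lemma total_homology_fg : fin_gen (total_homology C) -> fg_homology C.
Proof.
move=> [n [e eP]].
have hP i (h : homology C i) : exists c : 'I_n -> R, h = \sum_k c k *: val (e k) i.
  have [c cE] := eP (single_total h); exists c.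
  rewrite -[LHS]single_id -[single h]/(val (single_total h)) cE.
  by elim/big_rec2: _ => // k u v _ <-.
have /choice[s sP] k : exists s : seq int, forall i, i \notin s -> val (e k) i = 0.
  by have /asboolP := valP (e k).
have [lo [m loP]] : exists lo (m : nat), forall k i, i \in s k -> lo <= i < lo + m%:Z.
  pose all := flatten [seq s k | k <- enum 'I_n].
  have [lo [m H]] : exists lo (m : nat), forall i, i \in all -> lo <= i < lo + m%:Z.
    elim: all => [|i t [lo [m IH]]]; first by exists 0, 0%N.
    pose lo' := (Num.min i lo : int).
    pose d := (Num.max (i + 1) (lo + m%:Z) - lo' : int).
    exists lo', (absz d) => j; rewrite inE => /predU1P[->|/IH]; lia.
  exists lo, m => k i ik; apply: H; apply/flattenP; exists (s k) => //.
  by apply: map_f; rewrite mem_enum.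
split=> [i|].
  have /choice[y yP] k : exists y : C i, cyc y /\ exists cy : cyc y, val (e k) i = hclass cy.
    by have [z [cz zE]] := hclassP (val (e k) i); exists z; split=> //; exists cz.
  have cy k : cyc (y k) by case: (yP k).
  exists n, y; split=> // z cz; have [c] := hP i (hclass cz).
  under eq_bigr => k _.
    have [_ [cyk ->]] := yP k.
    have -> : hclass cyk = hclass (cy k) by apply/hclass_eq; rewrite subrr; apply: bnd0.
    rewrite hclassZ; over.
  by rewrite hclass_sum => /hclass_eq; exists c.
exists lo, m => i z iout cz; apply/(hclass0P cz); have [c ->] := hP i (hclass cz).
apply: big1 => k _; rewrite sP ?scaler0 //; apply/negP => /loP; lia.
Qed.
End FinGenTotal.

Lemma quasi_iso_fg (R : comPzRingType) (C D : complex R) (f : chain_map C D) :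
  quasi_iso f -> fg_homology C -> fg_homology D.
Proof.
move=> /quasi_isoP[fi fs] [gC [lo [n bC]]]; split=> [i|].
  have [m [e [ce eP]]] := gC i; exists m, (fun k => f i (e k)); split=> [k|w cw].
    exact: chain_cyc.
  have [z cz wz] := fs i w cw; have [c zc] := eP z cz; exists c.
  apply: bnd_trans wz _; have := chain_bnd f zc; rewrite lB lS.
  by under eq_bigr => k _ do rewrite chZ.
exists lo, n => i w iout cw; have [z cz wz] := fs i w cw.
apply: bnd_congr (bndBC wz) _; apply/chain_bnd; exact: bC iout cz.
Qed.

Section Semidualizing.
Variables (R : comPzRingType) (C : complex R).

Transparent hc homC.
Lemma unit_homE (J : injective_resolution C) : unit_hom J = hel (ires_map J) :> hom C J 0.
Proof.
apply: hcP => i j x; rewrite addr0 => ->; rewrite helE.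
by rewrite -(unit_bihomE J x).
Qed.
Opaque hc homC.

Lemma homothety_cycles (J : injective_resolution C) : quasi_iso (homothety J) ->
  [/\ forall j (z : hom C J j), j != 0 -> cyc z -> bnd z,
      forall z : hom C J 0, cyc z -> exists r : R, bnd (z - r *: hel (ires_map J)) &
      forall r : R, bnd (r *: hel (ires_map J)) -> r = 0].
Proof.
move=> /quasi_isoP[hi hs]; split.
- move=> j z j0 cz; have [x cx] := hs j z cz.
  by rewrite [x]conc0 // ch0 subr0.
- move=> z cz; have [r _ zr] := hs 0 z cz; exists r; move: zr.
  by rewrite -unit_homE.
- move=> r; rewrite -unit_homE => br.
  by have /conc_bnd0 := hi 0 (r : concentrated R^o 0) (fun=> erefl) br.
Qed.

(** The definition provides the property for one resolution [J0]. K-injectivity yields comparison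
    maps t : J -> J0 and u : J0 -> J with [u t] homotopic to the identity, which carry it to any
    [J]. *)
Lemma semidualizing_homothety (J : injective_resolution C) : semidualizing C ->
  [/\ fg_homology J, forall j (z : hom J J j), j != 0 -> cyc z -> bnd z,
      forall z : hom J J 0, cyc z -> exists r : R, bnd (z - r *: hel (cidm J)) &
      forall r : R, bnd (r *: hel (cidm J)) -> r = 0].
Proof.
move=> [fgC [J0 /homothety_cycles[H0 Hs Hi]]].
have KJ := @ires_K_injective _ _ J; have KJ0 := @ires_K_injective _ _ J0.
have /quasi_isoP[i1 s1] := K_injective_quasi_iso KJ0 (ires_quasi_iso J).
have /quasi_isoP[i2 s2] := K_injective_quasi_iso KJ (ires_quasi_iso J).
have /quasi_isoP[i3 s3] := K_injective_quasi_iso KJ (ires_quasi_iso J0).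
have [t' ct' tE] := s1 0 _ (hel_cyc (ires_map J0)).
have [t tt] := hel_surj ct'; rewrite {}tt {t' ct'} hpre_hel in tE.
have [u' cu' uE] := s3 0 _ (hel_cyc (ires_map J)).
have [u uu] := hel_surj cu'; rewrite {}uu {u' cu'} hpre_hel in uE.
have ut : bnd (hel (ccomp u t) - hel (cidm J)).
  apply: i2; first by apply: cycB; apply: hel_cyc.
  rewrite lB !hpre_hel; apply: bndBC.
  have -> : hel (ccomp (cidm J) (ires_map J)) = hel (ires_map J) :> hom C J 0.
    by apply: hcP => i j x; rewrite addr0 => ->; rewrite !helE.
  apply: bnd_trans uE _; have := chain_bnd (hpost C u) tE; rewrite lB !hpost_hel.
  congr bnd; congr (_ - _); apply: hcP => i j x; rewrite addr0 => ->; by rewrite !helE.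
have utz n (z : hom J J n) : cyc z -> bnd (hpost J u n (hpost J t n z) - z).
  move=> cz; have := hpost_homotopic ut cz; congr bnd; congr (_ - _).
    by apply: hcP => i j x ji; rewrite !hpostE.
  by apply: hcP => i j x ji; rewrite hpostE.
split.
- exact: quasi_iso_fg (ires_quasi_iso J) (total_homology_fg fgC).
- move=> j z j0 cz; apply: bnd_congr (utz j z cz) _; apply: chain_bnd.
  by apply: i1; [exact: chain_cyc | apply: H0 => //; do 2 apply: chain_cyc].
- move=> z cz; have [|r rE] := Hs (hpre J0 (ires_map J) 0 (hpost J t 0 z)).
    by do 2 apply: chain_cyc.
  exists r; apply: bnd_trans (bndBC (utz 0 z cz)) _.
  have b1 : bnd (hpost J t 0 z - r *: hel t).
    apply: i1; first by apply: cycB; [exact: chain_cyc | apply/cycZ/hel_cyc].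
    rewrite lB lZ hpre_hel; apply: bnd_trans rE _.
    by rewrite -scalerBr; apply: bndZ.
  have b2 := chain_bnd (hpost J u) b1; rewrite lB lZ hpost_hel in b2.
  by apply: bnd_trans b2 _; rewrite -scalerBr; apply: bndZ.
- move=> r br; apply: Hi.
  have := chain_bnd (hpost J t) br; rewrite lZ hpost_hel => b1.
  have := chain_bnd (hpre J0 (ires_map J)) b1; rewrite lZ hpre_hel => b2.
  have -> : r *: hel (ires_map J0) = r *: (hel (ires_map J0) - hel (ccomp t (ires_map J))) +
      r *: hel (ccomp t (ires_map J)) by rewrite -scalerDr subrK.
  apply: bndD; first exact: bndZ.
  move: b2; congr bnd; congr (_ *: _); apply: hcP => i j x; rewrite addr0 => ->.
  by rewrite !helE.
Qed.
End Semidualizing.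

(** * Restriction of scalars *)

Section Restriction.
Variables (R S : comPzRingType) (phi : {rmorphism R -> S}).

Section ResC.
Variable Y : complex S.
Fact resC_linear i j : linear (fun x : res phi (Y i) => dif Y i j x : res phi (Y j)).
Proof. by move=> a x y; rewrite -[a *: x]/(phi a *: (x : Y i)) linearP. Qed.
Definition resC_dif i j := mklin (@resC_linear i j).
Lemma resC_difE i j x : resC_dif i j x = dif Y i j x.
Proof. exact: (mklinE (@resC_linear i j)). Qed.
Fact resC_shape i j : i != j + 1 -> forall x, resC_dif i j x = 0.
Proof. by move=> ij x; rewrite resC_difE dif_shape. Qed.
Fact resC_dd i j k x : resC_dif j k (resC_dif i j x) = 0.
Proof. by rewrite !resC_difE dif_dif. Qed.
Definition resC : complex R :=
  @Complex R (fun i => res phi (Y i)) resC_dif resC_shape resC_dd.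
Lemma resC_cyc i (x : Y i) : cyc (x : resC i) <-> cyc x.
Proof. by split=> cx j; have := cx j; rewrite /= resC_difE. Qed.
Lemma resC_bnd i (x : Y i) : bnd (x : resC i) <-> bnd x.
Proof. by split=> -[k [y <-]]; exists k, y; rewrite /= resC_difE. Qed.

Section Scale.
Variable s : S.
Fact scaleC_linear i : linear (fun x : res phi (Y i) => s *: (x : Y i) : res phi (Y i)).
Proof.
move=> a x y; rewrite -[a *: x]/(phi a *: (x : Y i)) scalerDr scalerA mulrC -scalerA.
by [].
Qed.
Fact scaleC_comm i j x : dif resC i j (mklin (@scaleC_linear i) x) =
  mklin (@scaleC_linear j) (dif resC i j x).
Proof. by rewrite (mklinE (@scaleC_linear i)) (mklinE (@scaleC_linear j)) /= !resC_difE difZ. Qed.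
Definition scaleC : chain_map resC resC := @ChainMap R resC resC (fun i => mklin (@scaleC_linear i)) scaleC_comm.
Lemma scaleCE i x : scaleC i x = s *: (x : Y i).
Proof. exact: (mklinE (@scaleC_linear i)). Qed.
End Scale.
End ResC.

Section ResMap.
Variables (Y Z : complex S) (F : chain_map Y Z).
Fact resC_map_linear i : linear (fun x : res phi (Y i) => F i x : res phi (Z i)).
Proof. by move=> a x y; rewrite -[a *: x]/(phi a *: (x : Y i)) linearP. Qed.
Fact resC_map_comm i j x : dif (resC Z) i j (mklin (@resC_map_linear i) x) =
  mklin (@resC_map_linear j) (dif (resC Y) i j x).
Proof.
by rewrite (mklinE (@resC_map_linear i)) (mklinE (@resC_map_linear j)) /= !resC_difE chain_comm.
Qed.
Definition resC_map : chain_map (resC Y) (resC Z) := @ChainMap R (resC Y) (resC Z) (fun i => mklin (@resC_map_linear i)) resC_map_comm.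
Lemma resC_mapE i x : resC_map i x = F i x.
Proof. exact: (mklinE (@resC_map_linear i)). Qed.
Lemma resC_map_quasi_iso : quasi_iso F -> quasi_iso resC_map.
Proof.
move=> /quasi_isoP[Fi Fs]; apply/quasi_isoP; split.
  by move=> i z /resC_cyc cz; rewrite resC_mapE => /resC_bnd bz; apply/resC_bnd/Fi.
move=> i w /resC_cyc cw; have [z cz b] := Fs i w cw; exists z; first exact/resC_cyc.
by rewrite resC_mapE; apply/resC_bnd.
Qed.
End ResMap.

Lemma bijective_quasi_iso (A B : complex R) (f : chain_map A B) :
  (forall i x, f i x = 0 -> x = 0) -> (forall i y, exists x, f i x = y) -> quasi_iso f.
Proof.
move=> fi fs; apply/quasi_isoP; split.
  move=> i z cz [k [y yE]]; have [x xE] := fs k y; exists k, x.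
  by apply/subr0_eq/fi; rewrite chB -chain_comm xE yE subrr.
move=> i w cw; have [x xE] := fs i w; exists x.
  by move=> j; apply: fi; rewrite -chain_comm xE cw.
by rewrite xE subrr; apply: bnd0.
Qed.

Section Convert.
Variable J : complex R.
Local Notation HJ := (homC phi (concentrated S^o) J).
Local Notation Sr := (res phi S^o : lmodType R).

Definition coef n (h : homC_obj phi (concentrated S^o) J n) (x : S) : J n :=
  homm_fun ((val h : bihom phi (concentrated S^o) J) (Posz 0) n) x.

Transparent homC.
Lemma coef_scale n s (h : homC_obj phi (concentrated S^o) J n) x : coef (s *: h) x = coef h (s * x).
Proof.
by rewrite /coef -[RHS]/(homm_fun (s *: (val h : bihom phi (concentrated S^o) J) (Posz 0) n) x).
Qed.
Lemma coefD n (h h' : homC_obj phi (concentrated S^o) J n) x : coef (h + h') x = coef h x + coef h' x.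
Proof. by []. Qed.
Lemma coef_linear n (h : homC_obj phi (concentrated S^o) J n) a (x y : S) : coef h (phi a * x + y) = a *: coef h x + coef h y.
Proof. exact: homm_lin. Qed.
Lemma coef0 n (h : homC_obj phi (concentrated S^o) J n) : coef h 0 = 0.
Proof. exact: homm0. Qed.
Lemma coef_dif n m (h : HJ n) x : coef (dif HJ n m h) x = dif J n m (coef h x).
Proof.
have [nm|ne] := eqVneq n (m + 1); last by rewrite !dif_shape.
move: h; rewrite nm => h.
rewrite -[LHS]/(homm_fun (homC_bidif (m + 1) m
  (val (h : homC_obj phi (concentrated S^o) J (m + 1))) (Posz 0) m) x) /homC_bidif.
have -> : (m + 1 == m + 1) && (m == Posz 0 + m) = true by rewrite eqxx add0r eqxx.
pose h' : bihom phi (concentrated S^o) J := val (h : homC_obj phi (concentrated S^o) J (m + 1)).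
rewrite -[LHS]/(dif J (m + 1) m (coef h x) - homm_fun (h' (Posz 0 - 1) m)
  (dif (concentrated S^o) (Posz 0) (Posz 0 - 1)
    ((-1) ^+ absz (GRing.add m 1) *: (x : concentrated S^o (Posz 0))))).
by apply: (etrans _ (subr0 _)); congr (_ - _); apply: homm0.
Qed.

Let b n (h : resC HJ n) (q : stalk 0 Sr 0) : J n := coef (h : HJ n) (sout 0 Sr 0 q).
Fact conv_l n h : linear (@b n h).
Proof. by move=> a q q'; rewrite /b linearP; apply: coef_linear. Qed.
Fact conv_r n q : linear (fun h => @b n h q).
Proof.
move=> a h h'; rewrite /b -[a *: h]/(phi a *: (h : HJ n)) coefD coef_scale.
by have := coef_linear h a (sout 0 Sr 0 q) 0; rewrite addr0 => ->; rewrite coef0 addr0.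
Qed.
Fact conv_d n m h q : b (dif (resC HJ) n m h) q = dif J n m (b h q).
Proof. by rewrite /b /= resC_difE coef_dif. Qed.
Fact conv_0 n h q : bnd q -> @b n h q = 0.
Proof. by move=> [k [q' <-]]; rewrite /b stalk_dif0 lin0; apply: coef0. Qed.
(** After restriction of scalars the complex Hom(S, J) becomes an [R]-linear Hom complex out of a
    stalk. The action of [S] is remembered by evaluation at elements of [S], see [sev_conv]. *)
Definition conv : chain_map (resC HJ) (hom (stalk 0 Sr) J) := pairing conv_l conv_r conv_d conv_0.

Lemma sev_conv x n h : sev J x n (conv n h) = coef (h : HJ n) x.
Proof. by rewrite sevE pairingE ?add0r // !idm_id /b sinK. Qed.

Section Unconv.
Variables (n : int) (f : hom (stalk 0 Sr) J n).
Fact unconv_linear j : linear (fun x : res phi S^o => hc f 0 j (sin 0 Sr 0 x)).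
Proof. by move=> a x y; rewrite !linearP. Qed.
Definition unconv_bihom : bihom phi (concentrated S^o) J := fun i j =>
  match i as i return homm phi (conc_obj S^o i) (J j) with
  | Posz 0 => exist _ _ (@unconv_linear j)
  | _ => 0
  end.
Fact unconv_sub : unconv_bihom \in homC_sub phi (concentrated S^o) J n.
Proof.
apply/asboolP => -[[|i]|i] j ne //; apply: hommP => x.
rewrite homm_zeroE [LHS]/=; exact: hc_ne.
Qed.
Definition unconv : HJ n := exist _ unconv_bihom unconv_sub.
Lemma coef_unconv x : coef unconv x = hc f 0 n (sin 0 Sr 0 x).
Proof. by []. Qed.
End Unconv.

Lemma coef_eq0 n (h : HJ n) : (forall x, coef h x = 0) -> h = 0.
Proof.
move=> h0; apply: val_inj; apply: functional_extensionality_dep => i.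
apply: functional_extensionality_dep => j; apply: hommP => x.
have [ji|ne] := eqVneq j (i + n); last first.
  have /asboolP/(_ i j ne) := valP (h : homC_obj phi (concentrated S^o) J n).
  by move=> ->.
have [i0|ne] := eqVneq i 0; last first.
  by rewrite (@conc0 S S^o i x ne) homm0 homm0.
have jn : j = n by rewrite ji i0 add0r.
by move: x; rewrite {}i0 {ji}jn; apply: h0.
Qed.
Opaque homC.

Lemma conv_quasi_iso : quasi_iso conv.
Proof.
apply: bijective_quasi_iso => [i h h0|i f].
  by apply: coef_eq0 => x; rewrite -sev_conv h0 ch0.
exists (unconv f); apply: hom_stalk_eq => j q; rewrite add0r => ->.
by rewrite -!sevE sev_conv coef_unconv sevE.
Qed.
End Convert.

(** Linearity over [S] survives restriction to [R] as an action [sigma] on the middle term of the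
    roof, and the legs translate it into multiplication of the evaluation point. *)
Lemma transport (J J' : complex R) :
    derived_iso (homC phi (concentrated S^o) J) (homC phi (concentrated S^o) J') ->
  exists (Y : complex R) (sigma : S -> chain_map Y Y)
    (f : chain_map Y (hom (stalk 0 (res phi S^o)) J))
    (g : chain_map Y (hom (stalk 0 (res phi S^o)) J')),
  [/\ quasi_iso f /\ quasi_iso g,
      forall s x i y, @sev R (res phi S^o) J x i (f i (sigma s i y)) = @sev R (res phi S^o) J (s * x) i (f i y),
      forall s x i y, @sev R (res phi S^o) J' x i (g i (sigma s i y)) = @sev R (res phi S^o) J' (s * x) i (g i y),
      (forall s t i y, sigma s i (sigma t i y) = sigma (s * t) i y) /\
      forall a i y, sigma (phi a) i y = a *: y &
      forall a s t i y, sigma (phi a * s + t) i y = a *: sigma s i y + sigma t i y].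
Proof.
move=> [X [F [G [qF qG]]]].
exists (resC X), (scaleC X), (ccomp (conv J) (resC_map F)), (ccomp (conv J') (resC_map G)).
split.
- by split; apply: quasi_iso_comp; (try exact: conv_quasi_iso); apply: resC_map_quasi_iso.
- move=> s x i y; rewrite [ccomp _ _ _ _]/= [ccomp _ _ _ y]/= !sev_conv !resC_mapE scaleCE linearZ.
  by rewrite coef_scale.
- move=> s x i y; rewrite [ccomp _ _ _ _]/= [ccomp _ _ _ y]/= !sev_conv !resC_mapE scaleCE linearZ.
  by rewrite coef_scale.
- by split=> [s t i y|a i y]; rewrite !scaleCE ?scalerA.
- by move=> a s t i y; rewrite !scaleCE scalerDl -scalerA.
Qed.
End Restriction.

(** * Mapping cones *)

Section MappingCones.
Variable R : comPzRingType.
Implicit Types (A B C D I P Y : complex R) (U : mulset R).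

Lemma hel_homotopic A B (f g : chain_map A B) i (z : A i) :
  bnd (hel f - hel g) -> cyc z -> bnd (f i z - g i z).
Proof.
move=> /(bndE (j := 1))[//|w wE] cz; exists (i + 1), (hc w i (i + 1) z).
have := congr1 (fun h => hc h i i z) wE.
rewrite (hc_dif _ (k := i + 1) (l := i - 1)) ?addr0 ?subrK // hcB !helE => <-.
by rewrite cz (lin0 (hc _ _ _)) scaler0 subr0.
Qed.

Lemma homotopy_quasi_iso A B (f : chain_map A B) (g : chain_map B A) :
  bnd (hel (ccomp g f) - hel (cidm A)) -> bnd (hel (ccomp f g) - hel (cidm B)) ->
  quasi_iso f.
Proof.
move=> gf fg; apply/quasi_isoP; split.
  move=> i z cz bf; apply: bnd_congr (hel_homotopic gf cz) _.
  exact: (chain_bnd g bf).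
move=> i w cw; exists (g i w); first exact: chain_cyc.
exact/bndBC/(hel_homotopic fg cw).
Qed.

(** Through the quasi-isomorphisms [f] and [g], the map [a] acts as [sigma], which [tau] inverts up
    to [s]. So [a] is invertible up to [U] and its cone is null. *)
Lemma cone_unull U A A' I Y (a : chain_map A A') (f : chain_map Y A) (g : chain_map Y A')
    (sigma tau : chain_map Y Y) (s : R) i :
    K_injective I -> quasi_iso f -> quasi_iso g -> U s ->
    (forall i y, sigma i (tau i y) = s *: y) -> (forall i y, tau i (sigma i y) = s *: y) ->
    bnd (hel (ccomp a f) - hel (ccomp g sigma)) ->
  unull U (hom (cone a) I) i.
Proof.
move=> KI qf qg Us st ts af u cu.
have /quasi_isoP[fi fs] := K_injective_quasi_iso KI qf.
have /quasi_isoP[gi gs] := K_injective_quasi_iso KI qg.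
have htpy n (t : hom A' I n) : cyc t ->
    bnd (hpre I f n (hpre I a n t) - hpre I sigma n (hpre I g n t)).
  by move=> ct; have := hpre_homotopic af ct; rewrite !hpre_comp.
have cu' := chain_cyc (hpre I (cone_in a)) cu.
(* Injectivity: the restriction of [u] to [A'] dies on [A], hence under [sigma], and applying [tau]
   multiplies it by [s]. *)
have un : ubnd U (hpre I (cone_in a) i u).
  exists s => //; apply: gi; first exact: cycZ.
  have b1 : bnd (hpre I sigma i (hpre I g i (hpre I (cone_in a) i u))).
    apply: bnd_congr (htpy _ _ cu') _; apply: chain_bnd; exact: cone_nullhomotopic.
  have := chain_bnd (hpre I tau) b1; congr bnd.
  by rewrite chZ; apply: hcP => k l x lk; rewrite hcZ !hpreE st (linZ (g k)) (linZ (cone_in a k)) (linZ (hc u _ _)).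
have tri := exact_triangle (hom_cone_exact a I).
have [s1 [y [Us1 cy b1]]] := tri_uexact tri cu un.
apply: (ubndS Us1); apply: ubnd_congr (bndBC b1) _.
pose z := hsh (sh_shifted A) (i + 1) y.
have cz : cyc z by apply/(hsh_cyc (sh_shifted A) y (erefl (i + 1))).
(* Surjectivity: [t] corresponds to [tau] applied to [z], so its pullback along [a] is [s *: z], and
   this class dies on the cone. *)
have [|t ct tE] := gs (i + 1) (hpre I tau (i + 1) (hpre I f (i + 1) z)).
  by do 2 apply: chain_cyc.
have zt : bnd (s *: z - hpre I a (i + 1) t).
  apply: fi; first by apply: cycB; [exact: cycZ | exact: chain_cyc].
  rewrite chB; apply: (@bnd_trans _ _ _ _ (hpre I sigma (i + 1) (hpre I g (i + 1) t))).
    have := chain_bnd (hpre I sigma) tE; rewrite chB; congr bnd; congr (_ - _).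
    by rewrite chZ; apply: hcP => k l x lk; rewrite hcZ !hpreE ts (linZ (f k)) (linZ (hc z _ _)).
  exact/bndBC/htpy.
have [y' y'E] := hsh_surj (sh_shifted A) (hpre I a (i + 1) t) (erefl (i + 1)).
exists s => //; rewrite -chZ.
have bo : bnd (hpre I (cone_out a) i y') by apply: cone_out_null ct y'E.
apply: bnd_congr bo; rewrite -chB; apply: chain_bnd.
apply/(hsh_bnd (sh_shifted A) _ (erefl (i + 1))).
suff -> : hsh (sh_shifted A) (i + 1) (y' - s *: y) = hpre I a (i + 1) t - s *: z by apply: bndBC.
rewrite -y'E; apply: hcP => k l x lk.
by rewrite hcB hcZ !(hshE (sh_shifted A) _ l x (erefl (i + 1)) (erefl (k + 1))) hcB hcZ !scale1r.
Qed.

Section ConeOfHom.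
Variables (P A B : complex R) (f : chain_map A B).
Local Notation cn := (cone (hpost P f)).
Fact cone_pair_linear n i j (q : cn n) :
  linear (fun p : P i => (hc q.1 i (j - 1) p, hc q.2 i j p) : cone f j).
Proof. by move=> c p p'; rewrite !linearP. Qed.
Definition cone_hom_fun n (q : cn n) : hom P (cone f) n :=
  hmk n (fun i j => mklin (@cone_pair_linear n i j q)).
Lemma cone_hom_funE n (q : cn n) i j p : j = i + n ->
  hc (cone_hom_fun q) i j p = (hc q.1 i (j - 1) p, hc q.2 i j p).
Proof. by move=> ji; rewrite hmkE // (mklinE (@cone_pair_linear n i j q)). Qed.
Fact cone_hom_linear n : linear (@cone_hom_fun n).
Proof.
move=> c q q'; apply: hcP => i j p ji.
rewrite hcDE hcZ !cone_hom_funE //; apply: injective_projections.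
  by rewrite /= hcDE hcZ.
by rewrite /= hcDE hcZ.
Qed.
Fact cone_hom_comm n m q : dif (hom P (cone f)) n m (mklin (@cone_hom_linear n) q) =
  mklin (@cone_hom_linear m) (dif cn n m q).
Proof.
rewrite !(mklinE (@cone_hom_linear _)).
have [nm|ne] := eqVneq n (m + 1); last first.
  by rewrite !dif_shape // -(mklinE (@cone_hom_linear m)) lin0.
apply: hcP => i j p ji.
rewrite (hc_dif _ (k := j + 1) (l := i - 1)) ?subrK //.
rewrite !cone_hom_funE //; try lia.
rewrite !cone_difE; apply: injective_projections => /=.
  rewrite hcN (hc_dif _ (k := j + 1 - 1) (l := i - 1)) ?subrK //; try lia.
  by rewrite (@sgS R n (n - 1)) ?subrK // scaleNr opprD opprK.
rewrite hcDE (hc_dif _ (k := j + 1) (l := i - 1)) ?subrK // addrA; congr (_ + _ - _).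
have H1 k (h : hom P A k) : k = m ->
    hc (idm (hom P B) k m (hpost P f k h)) i j p = f j (hc h i j p).
  by move=> km; move: h; rewrite km => h; rewrite idm_id hpostE.
have H2 k : k = j -> idm B k j (f k (hc q.1 i k p)) = f j (hc q.1 i j p).
  by move=> ->; rewrite idm_id.
by rewrite H1 ?H2 //; lia.
Qed.
Definition cone_hom : chain_map cn (hom P (cone f)) := ChainMap cone_hom_comm.
Lemma cone_homE n (q : cn n) i j p : j = i + n ->
  hc (cone_hom n q) i j p = (hc q.1 i (j - 1) p, hc q.2 i j p).
Proof. by move=> ji; rewrite /= (mklinE (@cone_hom_linear n)) cone_hom_funE. Qed.

Lemma cone_hom_quasi_iso : quasi_iso cone_hom.
Proof.
apply: bijective_quasi_iso => [n [u v] q0|n h].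
  apply: injective_projections => /=; apply: hcP => i j p ji; rewrite hc0.
    have := congr1 (fun h => hc h i (j + 1) p) q0; rewrite cone_homE ?hc0 /=; last lia.
    by move=> /(congr1 fst); rewrite /= addrK.
  by have := congr1 (fun h => hc h i j p) q0; rewrite cone_homE ?hc0 // => /(congr1 snd).
have l1 i j : linear (fun p : P i => (hc h i (j + 1) p).1 : A (j + 1 - 1)).
  by move=> c p p'; rewrite linearP.
have l2 i j : linear (fun p : P i => (hc h i j p).2 : B j).
  by move=> c p p'; rewrite linearP.
exists ((hmk (n - 1) (fun i j => idm A (j + 1 - 1) j \o mklin (@l1 i j)),
         hmk n (fun i j => mklin (@l2 i j))) : cn n).
apply: hcP => i j p ji; rewrite cone_homE //=.
rewrite (@hmk_compE _ _ _ (n - 1)); last lia.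
rewrite hmkE // (mklinE (@l1 i (j - 1))) (mklinE (@l2 i j)); apply: injective_projections => //=.
have e : j - 1 + 1 = j by lia.
have H k : k = j -> idm A (k - 1) (j - 1) (hc h i k p).1 = (hc h i j p).1.
  by move=> ->; rewrite idm_id.
exact: H.
Qed.
End ConeOfHom.

(* The homotopy fibre of [C + C' -> D].                                      *)
Section Coroof.
Variables (C C' D : complex R) (u : chain_map C D) (u' : chain_map C' D).
Definition fib_obj i : lmodType R := (C i * C' i * D (i + 1)%R)%type.
Definition fib_dif_fun i j (p : fib_obj i) : fib_obj j :=
  (dif C i j p.1.1, dif C' i j p.1.2,
   idm D i (j + 1) (u i p.1.1 - u' i p.1.2) - dif D (i + 1) (j + 1) p.2).
Fact fib_dif_linear i j : linear (@fib_dif_fun i j).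
Proof.
move=> a p q; apply: injective_projections; first by apply: injective_projections; rewrite /= linearP.
rewrite /fib_dif_fun /= !(chD, chZ) difD difZ.
have -> : a *: u i p.1.1 + u i q.1.1 - (a *: u' i p.1.2 + u' i q.1.2) =
  a *: (u i p.1.1 - u' i p.1.2) + (u i q.1.1 - u' i q.1.2) by rewrite scalerBr; zmod.
by rewrite (linD (idm _ _ _)) (linZ (idm _ _ _)) scalerBr; zmod.
Qed.
Definition fib_dif i j := mklin (@fib_dif_linear i j).
Lemma fib_difE i j p : fib_dif i j p = fib_dif_fun j p.
Proof. exact: (mklinE (@fib_dif_linear i j)). Qed.
Fact fib_shape i j : i != j + 1 -> forall p, fib_dif i j p = 0.
Proof.
move=> ij p; rewrite fib_difE /fib_dif_fun !dif_shape //; last by apply: contra_neq ij; lia.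
by rewrite idm_ne // subr0.
Qed.
Fact fib_dd i j k p : fib_dif j k (fib_dif i j p) = 0.
Proof.
have [ij|ne] := eqVneq i (j + 1); last by rewrite (fib_shape ne) lin0.
rewrite !fib_difE /fib_dif_fun /= !dif_dif; congr (_, _, _).
rewrite -!chain_comm -difB [dif D (j + 1) _ _]difB dif_dif subr0 dif_idm //.
have [jk|ne] := eqVneq j (k + 1); last first.
  by rewrite idm_ne // sub0r dif_shape ?oppr0 // ij; apply: contra_neq ne; lia.
by rewrite idm_dif // subrr.
Qed.
Definition fib : complex R := @Complex R fib_obj fib_dif fib_shape fib_dd.
Fact fib_l_linear i : linear (fun p : fib i => p.1.1).
Proof. by []. Qed.
Fact fib_l_comm i j p : dif C i j (mklin (@fib_l_linear i) p) =
  mklin (@fib_l_linear j) (dif fib i j p).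
Proof. by rewrite (mklinE (@fib_l_linear i)) (mklinE (@fib_l_linear j)) /= fib_difE. Qed.
Definition fib_l : chain_map fib C := ChainMap fib_l_comm.
Fact fib_r_linear i : linear (fun p : fib i => p.1.2).
Proof. by []. Qed.
Fact fib_r_comm i j p : dif C' i j (mklin (@fib_r_linear i) p) =
  mklin (@fib_r_linear j) (dif fib i j p).
Proof. by rewrite (mklinE (@fib_r_linear i)) (mklinE (@fib_r_linear j)) /= fib_difE. Qed.
Definition fib_r : chain_map fib C' := ChainMap fib_r_comm.

Lemma fib_difS i p : dif fib i (i - 1) p =
  (dif C i (i - 1) p.1.1, dif C' i (i - 1) p.1.2,
   idm D i (i - 1 + 1) (u i p.1.1 - u' i p.1.2) - dif D (i + 1) (i - 1 + 1) p.2).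
Proof. exact: fib_difE. Qed.

Lemma fib_cyc i (c : C i) (c' : C' i) (d : D (i + 1)) : cyc c -> cyc c' ->
  dif D (i + 1) i d = u i c - u' i c' -> cyc ((c, c', d) : fib i).
Proof.
move=> cc cc' dE; apply: (cycE (j := i - 1)); first by rewrite subrK.
rewrite fib_difS /= cc cc'.
have H k : k = i -> idm D i k (u i c - u' i c') - dif D (i + 1) k d = 0.
  by move=> ->; rewrite idm_id dE subrr.
by rewrite H // subrK.
Qed.

Lemma fib_cycE i (p : fib i) : cyc p ->
  [/\ cyc p.1.1, cyc p.1.2 & dif D (i + 1) i p.2 = u i p.1.1 - u' i p.1.2].
Proof.
move=> /(_ (i - 1)); rewrite fib_difS => -[c0 c0' d0].
have ii : i = i - 1 + 1 by rewrite subrK.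
split; [exact: (cycE ii) | exact: (cycE ii) |].
have H k : k = i -> idm D i k (u i p.1.1 - u' i p.1.2) - dif D (i + 1) k p.2 = 0 ->
    dif D (i + 1) i p.2 = u i p.1.1 - u' i p.1.2.
  by move=> ->; rewrite idm_id => /subr0_eq.
exact: (H _ _ d0).
Qed.

Lemma fib_bnd i (p : fib i) (c : C (i + 1)) (c' : C' (i + 1)) (d : D (i + 1 + 1)) :
  dif C (i + 1) i c = p.1.1 -> dif C' (i + 1) i c' = p.1.2 ->
  u (i + 1) c - u' (i + 1) c' - dif D (i + 1 + 1) (i + 1) d = p.2 -> bnd p.
Proof.
move=> cE cE' dE; exists (i + 1), ((c, c', d) : fib (i + 1)).
rewrite /= fib_difE /fib_dif_fun /= idm_id cE cE' dE.
by case: p {cE cE' dE} => [[]].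
Qed.

(** Resolutions provide arrows out of [C] and [C'] into a common complex, while the definition of
    isomorphism asks for a roof; the fibre supplies its top. *)
Lemma coroof : quasi_iso u -> quasi_iso u' -> derived_iso C C'.
Proof.
move=> /quasi_isoP[ui us] /quasi_isoP[ui' us']; exists fib, fib_l, fib_r.
have lE i p : fib_l i p = p.1.1 by exact: (mklinE (@fib_l_linear i)).
have rE i p : fib_r i p = p.1.2 by exact: (mklinE (@fib_r_linear i)).
split; apply/quasi_isoP; split.
- move=> i p /fib_cycE[cc cc' dE]; rewrite lE => /bndP[x xE].
  have /ui' : bnd (u' i p.1.2).
    have -> : u' i p.1.2 = u i p.1.1 - dif D (i + 1) i p.2 by rewrite dE; zmod.
    by apply: bndB; [apply: chain_bnd; rewrite -xE; exact: bnd_dif | exact: bnd_dif].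
  case=> // k [y' yE']; have /bndP[y yE] : bnd p.1.2 by exists k, y'.
  have cd : cyc (u (i + 1) x - u' (i + 1) y - p.2).
    apply: (cycE (j := i)) => //.
    by rewrite !difB !chain_comm xE yE dE subrr.
  have [w cw /bndP[d' dE']] := us' _ _ cd.
  apply: (@fib_bnd i p x (y + w) d') => //.
    by rewrite difD yE cw addr0.
  by rewrite dE' chD; zmod.
- move=> i c cc; have [c' cc' /bndP[d dE]] := us' _ _ (chain_cyc u cc).
  exists ((c, c', d) : fib i); first exact: fib_cyc.
  by rewrite lE subrr; apply: bnd0.
- move=> i p /fib_cycE[cc cc' dE]; rewrite rE => /bndP[y yE].
  have /ui : bnd (u i p.1.1).
    have -> : u i p.1.1 = dif D (i + 1) i p.2 + u' i p.1.2 by rewrite dE subrK.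
    by apply: bndD; [exact: bnd_dif | apply: chain_bnd; rewrite -yE; exact: bnd_dif].
  case=> // k [x' xE']; have /bndP[x xE] : bnd p.1.1 by exists k, x'.
  have cd : cyc (p.2 - (u (i + 1) x - u' (i + 1) y)).
    apply: (cycE (j := i)) => //.
    by rewrite !difB !chain_comm xE yE dE subrr.
  have [w cw /bndP[d' dE']] := us _ _ cd.
  apply: (@fib_bnd i p (x + w) y (- d')) => //.
    by rewrite difD xE cw addr0.
  by rewrite difN dE' chD; zmod.
- move=> i c' cc'; have [c cc /bndP[d dE]] := us _ _ (chain_cyc u' cc').
  exists ((c, c', - d) : fib i).
    by apply: fib_cyc => //; rewrite difN dE opprB.
  by rewrite rE subrr; apply: bnd0.
Qed.
End Coroof.
End MappingCones.

Lemma mod_iso_sym (R : pzRingType) (M N : lmodType R) : mod_iso M N -> mod_iso N M.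
Proof.
move=> [f [g fK gK]].
have gl : linear g by move=> a x y; rewrite -[RHS]fK linearP !gK.
by exists (mklin gl); exists f => x; rewrite (mklinE gl).
Qed.

Lemma mod_iso_trans (R : pzRingType) (M N K : lmodType R) :
  mod_iso M N -> mod_iso N K -> mod_iso M K.
Proof. by move=> [f bf] [g bg]; exists (g \o f); apply: bij_comp. Qed.

(** * Descent *)

(** With this multiplicative set, statements up to [U] become exact ones. *)
Definition ms_one (R : comPzRingType) : mulset R :=
  @Mulset R (fun s => s = 1) erefl
    (fun s t s1 t1 => etrans (congr2 *%R s1 t1) (mulr1 1)).

Lemma ubnd_one (R : comPzRingType) (A : complex R) i (z : A i) : ubnd (ms_one R) z <-> bnd z.
Proof.
split=> [[s ->]|bz]; first by rewrite scale1r.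
exact: bnd_ubnd.
Qed.

Definition null_below (R : comPzRingType) (A : complex R) (i : int) :=
  forall j (z : A j), j < i -> cyc z -> bnd z.

(* The properties of [J] equivalent to [R -> Hom(J, J)] being a quasi-isomorphism. *)
Record homothety_iso (R : comPzRingType) (J : complex R) : Prop := HomothetyIso {
  hi_null : forall j (z : hom J J j), j != 0 -> cyc z -> bnd z;
  hi_surj : forall z : hom J J 0, cyc z -> exists r : R, bnd (z - r *: hel (cidm J));
  hi_inj : forall r : R, bnd (r *: hel (cidm J)) -> r = 0
}.

(** * Biduality for modules of finite projective dimension *)

Section Biduality.
Variables (R : comPzRingType) (J : complex R) (N : lmodType R).
Hypotheses (KJ : K_injective J) (HJ : homothety_iso J) (pN : proj_dim N).
Local Notation ev u := (dterm (hel (cidm J)) u : dhom J J N 0).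

Let nullX : forall j, j < 0 -> unull (ms_one R) (hom J J) j.
Proof. by move=> j j0 z cz; apply/ubnd_one/(hi_null HJ) => //; lia. Qed.

Lemma dhom_null : null_below (dhom J J N) 0.
Proof.
have [nN _ _] := dhom_proj_dim KJ KJ nullX pN.
by move=> j z j0 cz; apply/ubnd_one/nN.
Qed.

Lemma ev_cyc u : cyc (ev u).
Proof. exact/dterm_cyc/hel_cyc. Qed.

(** H_0(Hom(J, J)) is [R], so a spanning sum of tensors of [r l] times the identity with [x l] is
    the identity tensored with one element. *)
Lemma ev_surj (z : dhom J J N 0) : cyc z -> exists u, bnd (z - ev u).
Proof.
have [_ sN _] := dhom_proj_dim KJ KJ nullX pN.
move=> /sN[s [n [xi [x [-> cxi]]]]]; rewrite scale1r => zx.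
have /choice[r rE] l := hi_surj HJ (cxi l).
exists (\sum_l r l *: x l); apply: bnd_trans zx _.
rewrite dterm_sumr -sumrB; apply: bnd_sum => l.
by rewrite -dtermZ -dtermB; apply: chain_bnd.
Qed.

Lemma ev_inj u : bnd (ev u) -> u = 0.
Proof.
have [_ _ [n [e [eP ge]]]] := dhom_proj_dim KJ KJ nullX pN.
have [c ->] := eP u; rewrite dterm_sumr => bu.
have [||s [q [zeta [g [-> cz gz g0]]]]] := ge (fun l => c l *: hel (cidm J)).
- by move=> l; apply/cycZ/hel_cyc.
- apply: bnd_ubnd; move: bu; congr bnd; apply: eq_bigr => l _; exact/esym/dtermZ.
have /choice[r rE] k := hi_surj HJ (cz k).
(* Since H_0(Hom(J, J)) is [R], the relation between classes becomes one between scalars, and the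
   relations [g] of [e] then annihilate [u]. *)
have cE l : c l = \sum_k g k l * r k.
  apply: subr0_eq; apply: (hi_inj HJ).
  have := gz l; rewrite scale1r => b1.
  rewrite scalerBl scaler_suml; apply: bnd_trans b1 _; rewrite -sumrB; apply: bnd_sum => k.
  by rewrite -scalerA -scalerBr; apply: bndZ.
under eq_bigr => l _ do rewrite cE scaler_suml.
rewrite exchange_big big1 // => k _.
under eq_bigr => l _ do rewrite mulrC -scalerA.
by rewrite -scaler_sumr g0 scaler0.
Qed.
End Biduality.

Lemma sev_eq (R : comPzRingType) (N : lmodType R) (A : complex R) i (a b : hom (stalk 0 N) A i) :
  (forall x, sev A x i a = sev A x i b) -> a = b.
Proof.
move=> ab; apply: hom_stalk_eq => j q; rewrite add0r => ->.
by rewrite -!sevE.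
Qed.

(** * Comparison of Hom(J, J') with S *)

Section Descent.
Variables (R S : comPzRingType) (phi : {rmorphism R -> S}).
Local Notation Sr := (res phi S^o : lmodType R).
Variables (J J' Y : complex R) (sigma : S -> chain_map Y Y).
Variables (f : chain_map Y (hom (stalk 0 Sr) J)) (g : chain_map Y (hom (stalk 0 Sr) J')).
Hypotheses (KJ : K_injective J) (KJ' : K_injective J').
Hypotheses (HJ : homothety_iso J) (HJ' : homothety_iso J').
Hypotheses (qf : quasi_iso f) (qg : quasi_iso g) (pS : proj_dim Sr).
Hypothesis fs : forall s x i y, @sev R Sr J x i (f i (sigma s i y)) = @sev R Sr J (s * x) i (f i y).
Hypothesis gs : forall s x i y, @sev R Sr J' x i (g i (sigma s i y)) = @sev R Sr J' (s * x) i (g i y).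
Hypothesis ss : forall s t i y, sigma s i (sigma t i y) = sigma (s * t) i y.
Hypothesis sphi : forall a i y, sigma (phi a) i y = a *: y.
Hypothesis sl : forall a s t i y, sigma (phi a * s + t) i y = a *: sigma s i y + sigma t i y.

Local Notation X := (hom J J').
Local Notation term xi x := (@dterm R J J' Sr 0 xi x).
Local Notation ev u := (@dterm R J' J' Sr 0 (hel (cidm J')) u).

(** [u] is the value of [xi] tensored with 1 under the isomorphism of the derived tensor product of
    X and [S] with Hom(Hom(S, J'), J') = S. A relation is used, since the legs [f] and [g] of the
    roof are inverted in homology only. *)
Definition vrel (xi : X 0) (u : S) := bnd (hpre J' f 0 (term xi (1 : S)) - hpre J' g 0 (ev u)).

Lemma vrel_term xi u : vrel xi u -> forall x : S,
  bnd (hpre J' f 0 (term xi x) - hpre J' g 0 (ev (x * u))).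
Proof.
move=> b x; have := chain_bnd (hpre J' (sigma x)) b; rewrite lB.
congr bnd; congr (_ - _); apply: hcP => i j y ji; rewrite !hpreE.
  by rewrite fs mulr1.
by rewrite gs.
Qed.

Lemma ev_sub u u' : ev (u - u') = ev u - ev u'.
Proof.
apply: hcP => i j y ji; rewrite hcB !hpreE -(linB (hc _ i j)); congr (hc _ i j _).
by rewrite !sevE -(linB (hc y _ _)) -(linB (sin 0 Sr 0)).
Qed.

Lemma gev_eq u u' : bnd (hpre J' g 0 (ev u) - hpre J' g 0 (ev u')) -> u = u'.
Proof.
have /quasi_isoP[gi _] := K_injective_quasi_iso KJ' qg.
rewrite -lB -ev_sub => /gi b; apply: subr0_eq; apply: (ev_inj KJ' HJ' pS).
by apply: b; apply: ev_cyc.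
Qed.

Lemma vrel_ex xi : cyc xi -> exists u, vrel xi u.
Proof.
move=> cxi; have /quasi_isoP[_ gsurj] := K_injective_quasi_iso KJ' qg.
have [w cw wE] := gsurj 0 _ (chain_cyc (hpre J' f) (dterm_cyc (1 : Sr) cxi)).
have [u uE] := ev_surj KJ' HJ' pS cw; exists u; apply: bnd_trans wE _.
by rewrite -lB; apply: chain_bnd.
Qed.

Lemma vrel_lin a xi xi' u u' : vrel xi u -> vrel xi' u' -> vrel (a *: xi + xi') (phi a * u + u').
Proof.
move=> b b'; have := bndD (bndZ a b) b'; congr bnd.
have -> : term (a *: xi + xi') (1 : S) = a *: term xi (1 : S) + term xi' (1 : S).
  by rewrite /dterm chD chZ.
have -> : ev (phi a * u + u') = a *: ev u + ev u'.
  have := @dterm_sumr R J' J' Sr 0 2 (hel (cidm J')) (fun k => if k == ord0 then a else 1)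
    (fun k => if k == ord0 then u else u').
  by rewrite !big_ord_recl !big_ord0 /= !addr0 !scale1r.
by rewrite !(chD, chZ) scalerBr; zmod.
Qed.

Lemma vrel_eq xi xi' u u' : bnd (xi - xi') -> vrel xi u -> vrel xi' u' -> u = u'.
Proof.
move=> bx b b'; apply: gev_eq; apply: bnd_trans (bndBC b) _; apply: bnd_trans b'.
by rewrite -lB -dtermB; do 2 apply: chain_bnd.
Qed.

Lemma dual_null : null_below (dhom J J' Sr) 0.
Proof.
have /quasi_isoP[_ gsurj] := K_injective_quasi_iso KJ' qg.
have /quasi_isoP[fi _] := K_injective_quasi_iso KJ' qf.
move=> j z j0 cz; apply: fi => //.
have [w cw wE] := gsurj j _ (chain_cyc (hpre J' f) cz).
by apply: bnd_congr (bndBC wE) _; apply: chain_bnd; apply: (dhom_null KJ' HJ' pS).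
Qed.

(* An S-linear homotopy into [Hom(S, J')] is determined by its evaluation at  *)
(* 1: an R-linear [h] extends to [y |-> (x |-> h (x y))].                      *)
Lemma hpost_sigma (al : chain_map J J') v : vrel (hel al) v ->
  bnd (hel (ccomp (hpost (stalk 0 Sr) al) f) - hel (ccomp g (sigma v))).
Proof.
move=> /(bndE (j := 1))[//|h hE].
have Hl u w y i j : linear (fun q : stalk 0 Sr i => idm J' w j (hc h u w (sigma (sout 0 Sr i q) u y))).
  move=> a q q'; rewrite linearP -[a *: sout _ _ _ q]/(phi a * (sout 0 Sr i q : S)).
  by rewrite sl !linearP.
pose H0 u w y : hom (stalk 0 Sr) J' w := hmk w (fun i j => mklin (@Hl u w y i j)).
have H0E x u w y : sev J' x w (H0 u w y) = hc h u w (sigma x u y).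
  by rewrite sevE hmkE ?add0r // (mklinE (@Hl u w y 0 w)) sinK // idm_id.
have H1 u w : linear (H0 u w).
  move=> a y y'; apply: sev_eq => x; rewrite chD chZ !H0E.
  by rewrite chD chZ linearP.
exists 1, (hmk 1 (fun u w => mklin (@H1 u w))).
apply: hbnd => // i j k l y kj il; rewrite addr0 => ji; subst.
rewrite hcB !helE !hmkE ?(mklinE (@H1 _ _)); try lia.
apply: sev_eq => x; rewrite !(chB, chZ) -chain_comm !H0E.
have := congr1 (fun h => hc h (l + 1) (l + 1) (sigma x (l + 1) y)) hE.
have -> : sev J' x (l + 1) (ccomp (hpost _ al) f (l + 1) y) =
    hc (hel al) (l + 1) (l + 1) (@sev R Sr J (1 : S) (l + 1) (f (l + 1) (sigma x (l + 1) y))).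
  by rewrite helE fs mulr1 !sevE hpostE.
have -> : sev J' x (l + 1) (ccomp g (sigma v) (l + 1) y) =
    hc (hel (cidm J')) (l + 1) (l + 1) (@sev R Sr J' v (l + 1) (g (l + 1) (sigma x (l + 1) y))).
  by rewrite helE [ccomp _ _ _ _]/= [RHS]/= !gs mulrC.
rewrite (hc_dif _ (k := l + 1 + 1) (l := l)) ?addr0 // hcB !hpreE => <-.
by rewrite chain_comm.
Qed.

Hypotheses (noethR : noetherian R) (fgS : fin_gen Sr).
Hypotheses (fJ : fg_homology J) (fJ' : fg_homology J').

(** Surjectivity of the map from the degree 0 homology of X tensored with [S] to [S]: values of
    classes of X generate [S] as an ideal. *)
Lemma unit_sum (X0 : null_below X 0) u : exists n (x w : 'I_n -> S) (xi : 'I_n -> X 0),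
  [/\ forall l, cyc (xi l), forall l, vrel (xi l) (w l) & u = \sum_l x l * w l].
Proof.
have [|_ sN _] := @dhom_proj_dim R J J' (ms_one R) 0 KJ KJ' _ Sr pS.
  by move=> j j0 z cz; apply/ubnd_one/X0.
have /quasi_isoP[_ fsurj] := K_injective_quasi_iso KJ' qf.
have [z cz zE] := fsurj 0 _ (chain_cyc (hpre J' g) (ev_cyc J' (u : Sr))).
have [s [n [xi [x [-> cxi]]]]] := sN z cz; rewrite scale1r => zx.
have /choice[w wE] l := vrel_ex (cxi l).
exists n, x, w, xi; split=> //; apply: gev_eq; apply: bnd_trans zE _.
apply: bnd_trans (_ : bnd (hpre J' f 0 z - hpre J' f 0 (\sum_l term (xi l) (x l)))) _.
  by rewrite -lB; apply: chain_bnd.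
have -> : ev (\sum_l x l * w l) = \sum_l ev (x l * w l).
  have := @dterm_sumr R J' J' Sr 0 n (hel (cidm J')) (fun=> 1) (fun l => x l * w l).
  by under eq_bigr => l _ do rewrite scale1r; under [in RHS]eq_bigr => l _ do rewrite scale1r.
rewrite !lS -sumrB; apply: bnd_sum => l; exact: vrel_term.
Qed.

Section AtMaximal.
Variables (m : submodule R^o) (mm : maximal_ideal m) (q : spec S).
Hypothesis mq : forall x : R, (x \in m) = (phi x \in q).
Local Notation U := (max_compl mm).

Lemma residue_at (y : S) : y \notin q -> exists rho : Sr -> R,
  (forall a x x', rho (a *: x + x') - (a * rho x + rho x') \in m) /\ rho y - 1 \in m.
Proof.
move=> yq; apply: (@residue_map R Sr m mm (fun x => x \in q)) => //; last exact/negP.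
- split=> [|a x x' xq x'q]; first exact: rpred0.
  by apply: (@rpredD _ q (phi a * x) x') => //; apply: mmM.
- by move=> a x; rewrite mq => aq; have := mmM (x : S) aq; rewrite mulrC.
Qed.

Lemma max_compl1 (c : R) : c - 1 \in m -> U c.
Proof. by move=> c1; rewrite -(subrK 1 c) addrC; apply: max_complD => //; apply: ms1. Qed.

(** The cycle [p] lifts 1 to the resolution [P] of [S], and [rho] comes from a functional on [S]
    with value 1 at 1 modulo [m], available because 1 is not in [q]. *)
Lemma stalk_detection (sm : smallness) (P : complex R) (fP : chain_map P (stalk 0 Sr)) A I :
  perf P -> quasi_iso fP -> K_injective I -> fg_homology I -> fg_homology A ->
  sm (null U I (hom P A)) -> sm (null U I A).
Proof.
move=> pP /quasi_isoP[_ fPs] KI fI fA.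
have [rho [rhol rho1]] := residue_at (prime_ideal1 q).
have [p cp [k [y pE]]] := fPs 0 (sin 0 Sr 0 (1 : S)) (fun=> erefl).
pose rho' x := rho (sout 0 Sr 0 (fP 0 x)).
have rho0 : rho 0 \in m.
  by have := rho_sum rhol (fun _ : 'I_0 => 0) (fun=> 0); rewrite !big_ord0 subr0.
apply: (null_detection noethR (@max_complD R m mm) (rho := rho') KI fI pP cp) => //.
- by move=> a x x'; rewrite /rho' chD chZ linearP; apply: rhol.
- by move=> x [l [x' <-]]; rewrite /rho' -chain_comm stalk_dif0 lin0.
- have e : sin 0 Sr 0 (1 : S) = fP 0 p by apply: subr0_eq; rewrite -pE stalk_dif0.
  by rewrite /rho' -e sinK.
Qed.

(** Detection gives vanishing below some [c]. From there one climbs: once the lower degrees vanish,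
    [z] tensored with 1 lies in a homology group that is zero, so its residue shows that a multiple
    of [z] by an element of [U] lies in m H_j(X). *)
Lemma X_unull j : j < 0 -> unull U X j.
Proof.
have [P [fP [pP qP]]] := proj_dim_perf pS.
have nP : small_below (null U J' (hom P J)).
  exists 0 => i i0; apply/(quasi_iso_unull _ _ (K_injective_quasi_iso KJ' (K_injective_quasi_iso KJ qP))).
  by move=> z cz; apply/bnd_ubnd/dual_null.
have [c cP] := stalk_detection pP qP KJ' fJ' fJ nP.
have [rho [rhol rho1]] := residue_at (prime_ideal1 q).
suff H (n : nat) : forall j, j < c + n%:Z -> j < 0 -> unull U X j.
  by pose d := (j + 1 - c : int); apply: (H (absz d)); lia.
elim: n => [|n IHn] {}j jc j0; first by apply: cP; lia.
have [|_ _ [k [e [eP ge]]]] := @dhom_proj_dim R J J' U j KJ KJ' _ Sr pS.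
  by move=> i ij; apply: IHn; lia.
apply: (nakayama_unull (@max_complD R m mm)); first exact: fgh_hom.
move=> z cz.
have [||s Us] := dgen_residue rhol eP ge (xi := fun _ : 'I_1 => z) (x := fun=> (1 : S)) => //.
  by rewrite big_ord1; apply/bnd_ubnd/dual_null => //; apply: dterm_cyc.
rewrite big_ord1 scalerA => -[l [a [v [am cv b]]]].
exists (s * rho 1), l, a, v; split=> //.
by apply: (msM Us); apply: max_compl1.
Qed.

(** As 1 is a combination of values of classes and lies outside [q], one of these values does
    too. *)
Lemma generator_at (X0 : null_below X 0) : exists (al : chain_map J J') v,
  vrel (hel al) v /\ v \notin q.
Proof.
have [n [x [w [xi [cxi wE e1]]]]] := unit_sum X0 1.
have [l wl] : exists l, w l \notin q.
  apply: contrapT => H; case/negP: (prime_ideal1 q); rewrite e1.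
  elim/big_ind: _ => [|a b aq bq|l _]; [exact: rpred0 | exact: rpredD |].
  by apply: mmM; apply: contrapT => /negP wl; apply: H; exists l.
have [al alE] := hel_surj (cxi l); exists al, (w l); split=> //.
by rewrite -alE.
Qed.

Section Span.
Hypothesis X0 : null_below X 0.
Variables (e : X 0) (v : S).
Hypotheses (ce : cyc e) (ev_e : vrel e v) (vq : v \notin q).

Fact line_linear : linear (fun r : R^o => (r : R) *: e).
Proof. by move=> a r r'; rewrite scalerDl -scalerA. Qed.
Fact line_cyc (r : R^o) : cyc (mklin line_linear r).
Proof. by rewrite (mklinE line_linear); apply: cycZ. Qed.
(** Its degree 0 homology is H_0(X) modulo the multiples of [e]. *)
Let E := cone (stalk_to line_cyc).

Lemma line_bnd (w : X 0) : bnd (cone_in (stalk_to line_cyc) 0 w) <-> exists r : R, bnd (w - r *: e).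
Proof.
have lE i x : stalk_to line_cyc i x = idm X 0 i ((sout 0 R^o i x : R) *: e).
  by rewrite -(mklinE line_linear).
split=> [/bndP[[a b]]|[r /bndP[b bE]]].
  rewrite cone_difE lE idmKK // => -[_ <-] /=.
  by exists (sout 0 R^o _ a); rewrite [_ + _ - _]addrC addKr; apply: bnd_dif.
exists (0 + 1), ((sin 0 R^o (0 + 1 - 1) r, b) : E (0 + 1)).
rewrite cone_difE lE idmKK // sinK // bE [_ *: e + _]addrC subrK.
by apply: injective_projections => //=; apply: oppr0.
Qed.

(** A class [z] with value [u] and [e] with value [v] satisfy that [z] tensored with [v] equals [e]
    tensored with [u]. A functional with value 1 at [v] puts [z] into R e + m H_0(X) near [m], and
    Nakayama's lemma applies to the cone [E]. *)
Lemma line_span : exists2 s, U s & forall z : X 0, cyc z -> exists r : R, bnd (s *: z - r *: e).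
Proof.
have [rho [rhol rho1]] := residue_at vq.
have nX j : j < 0 -> unull U X j by move=> j0 z cz; apply/bnd_ubnd/X0.
have [_ _ [k [b [bP gb]]]] := dhom_proj_dim KJ KJ' nX pS.
have [n [eps [ceps epsP]]] : fgh X 0 by apply: fgh_hom.
have Ecyc (z : E 0) : z = cone_in (stalk_to line_cyc) 0 z.2.
  by case: z => a w; apply: injective_projections => //=; apply: stalk0.
have key (z : X 0) : cyc z -> exists2 s, U s & exists r : R, bnd (s *: z - r *: e).
  have : unull U E 0.
    apply: (nakayama_unull (@max_complD R m mm)).
      exists n, (fun l => cone_in (stalk_to line_cyc) 0 (eps l)); split=> [l|w cw].
        exact: chain_cyc.
      have cw2 : cyc w.2.
        apply/cycP; have := congr1 snd (cw (0 - 1)).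
        by rewrite [w in X in X -> _]Ecyc chain_comm.
      have [c cE] := epsP w.2 cw2; exists c; rewrite [w]Ecyc.
      have := chain_bnd (cone_in (stalk_to line_cyc)) cE; rewrite lB lS.
      by under eq_bigr => l _ do rewrite chZ.
    move=> w cw.
    have cw2 : cyc w.2.
      apply/cycP; have := congr1 snd (cw (0 - 1)).
      by rewrite [w in X in X -> _]Ecyc chain_comm.
    have [u uE] := vrel_ex cw2.
    (* The vanishing tensor, [w.2] at [v] minus [e] at [u]: both terms have value [u * v]. *)
    pose xi t : X 0 := if t == ord0 :> 'I_2 then w.2 else - e.
    pose x t : S := if t == ord0 :> 'I_2 then v else u.
    have cxi t : cyc (xi t) by rewrite /xi; case: ifP => _ //; apply: cycN.
    have [|s Us] := dgen_residue rhol bP gb (xi := xi) (x := x) cxi.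
      rewrite big_ord_recl big_ord1 /xi /x /=.
      have -> : term (- e) u = - term e u by rewrite /dterm chN.
      have /quasi_isoP[fi _] := K_injective_quasi_iso KJ' qf.
      apply/bnd_ubnd/fi; first by apply: cycB; apply: dterm_cyc.
      rewrite chB; apply: bnd_trans (vrel_term uE v) _.
      by rewrite mulrC; apply/bndBC/vrel_term.
    rewrite big_ord_recl big_ord1 /xi /x /= => -[l [c [zeta [cm cz bz]]]].
    exists (s * rho v), l, c, (fun t => cone_in (stalk_to line_cyc) 0 (zeta t)); split=> //.
    - by apply: (msM Us); apply: max_compl1.
    - by move=> t; apply: chain_cyc.
    have b1 : bnd (cone_in (stalk_to line_cyc) 0 ((s * rho u) *: e)).
      by apply/line_bnd; exists (s * rho u); rewrite subrr; apply: bnd0.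
    have := bndD (chain_bnd (cone_in (stalk_to line_cyc)) bz) b1; rewrite -chD [w in X in _ -> X]Ecyc.
    congr bnd.
    have -> : s *: (rho v *: w.2 + rho u *: - e) - \sum_t c t *: zeta t + (s * rho u) *: e =
        (s * rho v) *: w.2 - \sum_t c t *: zeta t.
      by rewrite scalerDr !scalerN !scalerA; zmod.
    by rewrite chB chZ chS; congr (_ - _); apply: eq_bigr => t _; apply: chZ.
  move=> nE cz; have [s Us] := nE _ (chain_cyc (cone_in (stalk_to line_cyc)) cz).
  by rewrite -chZ => /line_bnd; exists s.
have /choice[s sP] l : exists s, U s /\ exists r : R, bnd (s *: eps l - r *: e).
  by have [s Us H] := key _ (ceps l); exists s.
(* One multiplier for all cycles, obtained from finitely many generators. *)
exists (\prod_l s l).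
  by elim/big_ind: _ => [|a b'|l _]; [exact: ms1 | exact: msM | have [] := sP l].
have /choice[r rP] l : exists r : R, bnd (\prod_l s l *: eps l - r *: e).
  have [_ [r rE]] := sP l; exists (\prod_(t | t != l) s t * r).
  rewrite (bigD1 l) //= mulrC -!scalerA -scalerBr; exact: bndZ.
move=> z cz; have [c cE] := epsP z cz; exists (\sum_l c l * r l).
apply: bnd_trans (_ : bnd (\prod_l s l *: z - \prod_l s l *: \sum_l c l *: eps l)) _.
  by rewrite -scalerBr; apply: bndZ.
rewrite scaler_suml scaler_sumr -sumrB; apply: bnd_sum => l.
by rewrite scalerA mulrC -!scalerA -scalerBr; apply: bndZ.
Qed.
End Span.

(** By [hpost_sigma], [al] induces multiplication by [v] on Hom(S, -), which is invertible up to
    [s]. So the cone is null after Hom(S, -), and detection in all degrees removes that functor. *)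
Lemma cone_unull_at (al : chain_map J J') v w (s : R) I i :
    vrel (hel al) v -> w * v = phi s -> U s -> K_injective I -> fg_homology I ->
  unull U (hom (cone al) I) i.
Proof.
move=> alv wv Us KI fI; have [P [fP [pP qP]]] := proj_dim_perf pS.
move: i; apply: (stalk_detection (sm := small_all) pP qP KI fI (fg_homology_cone noethR al fJ fJ')).
move=> i; apply/(quasi_iso_unull U i (K_injective_quasi_iso KI (cone_hom_quasi_iso P al))).
apply: (@cone_unull R U _ _ I Y (hpost P al) (ccomp (hpre J fP) f) (ccomp (hpre J' fP) g)
  (sigma v) (sigma w) s i KI) => //.
- by apply: quasi_iso_comp => //; apply: K_injective_quasi_iso.
- by apply: quasi_iso_comp => //; apply: K_injective_quasi_iso.
- by move=> j y; rewrite ss mulrC wv sphi.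
- by move=> j y; rewrite ss wv sphi.
have := chain_bnd (hpost Y (hpre J' fP)) (hpost_sigma alv); rewrite lB !hpost_hel.
congr bnd; congr (_ - _); apply: hcP => j k y; rewrite addr0 => ->; rewrite !helE //.
by apply: hcP => a b x ba; rewrite [ccomp _ _ _ _]/= [RHS]/= !(hpreE, hpostE).
Qed.
End AtMaximal.

Hypothesis mSpec : comap_hits_maximal phi.

Lemma X_null : null_below X 0.
Proof.
move=> j z j0 cz; rewrite -[z]scale1r; apply: (@local_global R (fun r => bnd (r *: z))).
  split=> [|a r t br bt]; first by rewrite scale0r; apply: bnd0.
  by rewrite scalerDl -scalerA; apply: bndD => //; apply: bndZ.
move=> m mm; have [q mq] := mSpec mm.
by have [s Us bs] := X_unull mm mq j0 cz; exists s.
Qed.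

Lemma vrelZ a z u : vrel z u -> vrel (a *: z) (phi a * u).
Proof.
move=> zu; have := vrel_lin (a - 1) zu zu.
have -> : (a - 1) *: z + z = a *: z by rewrite scalerBl scale1r subrK.
by rewrite rmorphB rmorph1 mulrBl mul1r subrK.
Qed.

Lemma vrel_bnd z u : bnd z -> vrel z u -> u = 0.
Proof.
move=> bz zu; have := vrel_lin 1 zu zu; rewrite rmorph1 scale1r mul1r => zu2.
have : u + u = u by apply: vrel_eq zu2 zu; rewrite addrK.
by move=> /eqP; rewrite -subr_eq0 addrK => /eqP.
Qed.

(** Write 1 as a combination of values [w l]. Each [phi s * w l] is a multiple of [v], hence so is
    [phi s]. *)
Lemma span_unit (e : X 0) v s : vrel e v ->
  (forall z : X 0, cyc z -> exists r : R, bnd (s *: z - r *: e)) -> exists w, w * v = phi s.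
Proof.
move=> ev_e se; have [n [x [w [xi [cxi wE e1]]]]] := unit_sum X_null 1.
have /choice[r rE] l := se _ (cxi l).
exists (\sum_l x l * phi (r l)); rewrite -[RHS]mulr1 e1 mulr_suml mulr_sumr.
apply: eq_bigr => l _; rewrite mulrCA -mulrA; congr (_ * _).
exact/esym/(vrel_eq (rE l) (vrelZ s (wE l)) (vrelZ (r l) ev_e)).
Qed.

(** Near [m] the class of [al] spans by [line_span]. For its annihilator, the null cone of [al]
    gives a map [b] from [J'] to [J] with [b al] homotopic to [t] times the identity; so if [r]
    kills [al], then [r * t] kills the identity of [J] and is zero. *)
Lemma X_local_gen (m : submodule R^o) : maximal_ideal m ->
  exists s (e : homology X 0), s \notin m /\ local_gen s e.
Proof.
move=> mm; have [q mq] := mSpec mm.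
have [al [v [alv vq]]] := generator_at q X_null.
have [s Us sE] := line_span mm mq X_null (hel_cyc al) alv vq.
have [w wv] := span_unit alv sE.
have nc i : unull (max_compl mm) (hom (cone al) J) i := cone_unull_at mq alv wv Us KJ fJ.
(* The identity of [J], a class of Hom(J, J), is divisible by [al] up to the multiplier [t]. *)
have [t [b' [Ut cb']]] := cone_divisible (nc (0 - 1)) (hel_cyc (cidm J)).
have [b ->] := hel_surj cb' => tb.
exists (s * t), (hclass (hel_cyc al)); split; first exact: (msM Us Ut).
split=> [h|r].
  have [z [cz ->]] := hclassP h; have [r rE] := sE z cz; exists (t * r).
  rewrite !hclassZ; apply/hclass_eq; rewrite mulrC -!scalerA -scalerBr; exact: bndZ.
rewrite hclassZ => /hclass0P br; have -> : s * t * r = s * (r * t) by ring.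
suff -> : r * t = 0 by rewrite mulr0.
apply: (hi_inj HJ); rewrite -scalerA.
have := bndD (bndZ r tb) (chain_bnd (hpost J b) br); congr bnd.
rewrite chZ scalerBr.
suff -> : hpost J b 0 (hel al) = hpre J al 0 (hel b) by rewrite subrK.
by rewrite hpost_hel hpre_hel.
Qed.

(** The isomorphism sends a class tensored with [x] to [x] times the value of the class; [unit_sum]
    gives surjectivity, [dgen] injectivity. *)
Lemma tensor_X_iso : @mod_iso S (tensor phi (homology X 0) S^o) S^o.
Proof.
pose L : lmodType R := homology X 0.
have [h|a h h' u u' [z [cz [-> zu]]] [z' [cz' [-> zu']]]|u [z [cz [/esym/hclass0P bz zu]]]|v vP] :=
  @rel_linear R L Sr (fun h u => exists z (cz : cyc z), h = hclass cz /\ vrel z u).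
- by have [z [cz ->]] := hclassP h; have [u zu] := vrel_ex cz; exists u, z, cz.
- exists (a *: z + z'), (cycD (cycZ a cz) cz'); split; last exact: vrel_lin.
  by rewrite hclassZ hclassD.
- exact: vrel_bnd zu.
have vE z (cz : cyc z) : vrel z (v (hclass cz)).
  have [z' [cz' [e zv]]] := vP (hclass cz); have [u zu] := vrel_ex cz.
  have b : bnd (z - z') by apply/(hclass_eq cz cz').
  by rewrite -(vrel_eq b zu zv).
have [||th thE] := @tens_lift R S phi L S^o S^o (fun h x => x * (v h : S)).
- move=> r h h' x; rewrite linearP -[r *: v h]/(phi r * (v h : S)) mulrDr mulrCA.
  by [].
- by move=> s h x x'; rewrite mulrDl -[s *: x]/(s * x) -mulrA.
have nX j : j < 0 -> unull (ms_one R) X j.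
  by move=> j0 z cz; apply/ubnd_one/X_null.
have [_ _ [k [b [bP gb]]]] := dhom_proj_dim KJ KJ' nX pS.
(* If the values add up to zero, the sum of terms vanishes in the double Hom. [dgen] expresses it by
   relations of the generators [b] of [S], and these relations annihilate the tensor. *)
have thi t : th t = 0 -> t = 0.
  rewrite -(tens_reprK t) thE tens_sum; move: (tens_repr t) => {t} t.
  pose n := size t; pose xp (l : 'I_n) := tnth (in_tuple t) l.
  have tE (V : zmodType) (F : L * S^o -> V) : \sum_(p <- t) F p = \sum_(l < n) F (xp l).
    by rewrite (big_tnth _ _ t).
  rewrite !tE => t0.
  have /choice[z zP] l : exists z : X 0, cyc z /\ exists cz : cyc z, (xp l).1 = hclass cz.
    by have [z [cz e]] := hclassP (xp l).1; exists z; split=> //; exists cz.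
  have cz l : cyc (z l) by case: (zP l).
  have hz l : (xp l).1 = hclass (cz l).
    by have [_ [cz' ->]] := zP l; apply/hclass_eq; rewrite subrr; apply: bnd0.
  have /choice[d dE] l : exists d : 'I_k -> R, ((xp l).2 : Sr) = \sum_i d i *: b i := bP _.
  have [||s [r [zeta [gg [-> cze gz g0]]]]] := gb (fun i => \sum_l d l i *: z l).
  + by move=> i; apply: cyc_sum => l; apply: cycZ.
  + apply: bnd_ubnd; have /quasi_isoP[fi _] := K_injective_quasi_iso KJ' qf.
    have -> : \sum_i term (\sum_l d l i *: z l) (b i) = \sum_l term (z l) ((xp l).2 : Sr).
      under [in RHS]eq_bigr => l _ do rewrite dE dterm_sumr.
      rewrite exchange_big; apply: eq_bigr => i _; rewrite dterm_suml.
      by apply: eq_bigr => l _; rewrite dtermZ.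
    apply: fi; first by apply: cyc_sum => l; apply: dterm_cyc.
    have g0 : hpre J' g 0 (ev (0 : S)) = 0.
      by have := ev_sub 0 0; rewrite !subrr => ->; rewrite ch0.
    rewrite -[X in bnd X]subr0 -[X in _ - X]g0 -[X in ev X]t0.
    have -> : ev (\sum_l (xp l).2 * (v (xp l).1 : S)) = \sum_l ev ((xp l).2 * (v (xp l).1 : S)).
      have := @dterm_sumr R J' J' Sr 0 n (hel (cidm J')) (fun=> 1) (fun l => (xp l).2 * (v (xp l).1 : S)).
      by under eq_bigr => l _ do rewrite scale1r; under [in RHS]eq_bigr => l _ do rewrite scale1r.
    rewrite !lS -sumrB; apply: bnd_sum => l; rewrite hz; exact: vrel_term.
  have pE l : pure phi (xp l).1 (xp l).2 = \sum_i pure phi (d l i *: (xp l).1) (b i : S^o).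
    rewrite [in LHS](dE l) pure_sumr; apply: eq_bigr => i _; by rewrite pureZl.
  under eq_bigr => l _ do rewrite pE.
  rewrite exchange_big /=.
  have gE i : \sum_l pure phi (d l i *: (xp l).1) (b i : S^o) =
      \sum_j pure phi (hclass (cze j)) (phi (gg j i) *: (b i : S^o)).
    rewrite -pure_suml; under [in RHS]eq_bigr => j _ do rewrite -pureZl.
    rewrite -pure_suml; congr (pure phi _ _).
    under eq_bigr => l _ do rewrite hz hclassZ.
    under [in RHS]eq_bigr => j _ do rewrite hclassZ.
    rewrite !hclass_sum; apply/hclass_eq; have := gz i; by rewrite scale1r.
  under eq_bigr => i _ do rewrite gE.
  rewrite exchange_big big1 // => j _; rewrite -pure_sumr.
  have -> : \sum_i phi (gg j i) *: (b i : S^o) = 0 by exact: g0.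
  by have := @pure_sumr R S phi L S^o (hclass (cze j)) 0 (fun=> 0); rewrite !big_ord0.
have ths u : exists t, th t = u.
  have [n [x [w [xi [cxi wE ->]]]]] := unit_sum X_null u.
  exists (\sum_l pure phi (hclass (cxi l)) (x l : S^o)); rewrite lin_sum.
  apply: eq_bigr => l _; rewrite thE big_seq1 /=; congr (_ * _).
  by apply: vrel_eq (vE _ (cxi l)) (wE l); rewrite subrr; apply: bnd0.
have /choice[th' thK] := ths.
exists th, th' => // t; apply: subr0_eq; apply: thi.
by rewrite linB thK subrr.
Qed.

(** A global generator [al] spans with multiplier 1, so its value [v] is a unit of [S] and its cone
    is null near every maximal ideal, hence null. The null cone yields a homotopy inverse of
    [al]. *)
Lemma dualizing_quasi_iso : Pic_injective phi -> exists al : chain_map J J', quasi_iso al.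
Proof.
move=> Pic.
have iso : @mod_iso R (homology X 0) R^o.
  apply: (Pic (locally_free_line X_local_gen) (locally_free_line (@regular_local_gen R))).
  exact: mod_iso_trans tensor_X_iso (mod_iso_sym (tensor_regular phi S^o)).
have [h [h' hK h'K]] := iso.
have [e [ce eE]] := hclassP (h' 1); have [al ale] := hel_surj ce; exists al.
have span z : cyc z -> exists r : R, bnd (1 *: z - r *: hel al).
  move=> cz; exists (h (hclass cz)); rewrite scale1r -ale.
  apply/(hclass_eq cz (cycZ _ ce)); rewrite -hclassZ -eE; apply: (can_inj hK).
  by rewrite linearZ h'K; apply/esym/mulr1.
have [v alv] := vrel_ex (hel_cyc al); have [w wv] := span_unit alv span.
(* The multipliers [r] for which [r *: z] is a boundary form an ideal contained in no maximal
   ideal. *)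
have nc I i (z : hom (cone al) I i) : K_injective I -> fg_homology I -> cyc z -> bnd z.
  move=> KI fI cz; rewrite -[z]scale1r; apply: (@local_global R (fun r => bnd (r *: z))).
    split=> [|a r t br bt]; first by rewrite scale0r; apply: bnd0.
    by rewrite scalerDl -scalerA; apply: bndD => //; apply: bndZ.
  move=> m mm; have [q mq] := mSpec mm.
  by have [s Us bs] := cone_unull_at mq alv wv (ms1 (max_compl mm)) KI fI cz; exists s.
have nuJ i : unull (ms_one R) (hom (cone al) J) i by move=> z cz; apply/ubnd_one/nc.
have nuJ' i : unull (ms_one R) (hom (cone al) J') i by move=> z cz; apply/ubnd_one/nc.
have [t [b' [-> cb']]] := cone_divisible (nuJ (0 - 1)) (hel_cyc (cidm J)).
have [b ->] := hel_surj cb'; rewrite scale1r hpre_hel => /bndBC ba.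
(* [al b] is the identity up to homotopy: precomposition with [al] is injective on classes, and
   [al b al] is homotopic to [al]. *)
apply: (homotopy_quasi_iso ba); apply/ubnd_one/(cone_injective (nuJ' 0)).
  by apply: cycB; apply: hel_cyc.
have := chain_bnd (hpost J al) ba; rewrite !lB !hpre_hel !hpost_hel; congr bnd.
by congr (_ - _); apply: hcP => i j x; rewrite addr0 => ->; rewrite !helE.
Qed.
End Descent.

Theorem theorem5p9 (R S : comPzRingType) (phi : {rmorphism R -> S})
  (noethR : noetherian R) (noethS : noetherian S)
  (finite_phi : module_finite phi)
  (fd_S : finite_flat_dim (res phi S^o))
  (mSpec_phi : comap_hits_maximal phi)
  (Pic_phi : Pic_injective phi)
  (C C' : complex R) (sdC : semidualizing C) (sdC' : semidualizing C')
  (J : injective_resolution C) (J' : injective_resolution C')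
  (RHom_iso : derived_iso (RHom phi (concentrated S^o) J)
                          (RHom phi (concentrated S^o) J')) :
  derived_iso C C'.
Proof.
have [fJ h1 h2 h3] := semidualizing_homothety J sdC.
have [fJ' h1' h2' h3'] := semidualizing_homothety J' sdC'.
have pS := finite_flat_dim_proj_dim noethR finite_phi fd_S.
have [Y [sigma [f [g [[qf qg] fs gs [ss sphi] sl]]]]] := transport RHom_iso.
have [al qal] := dualizing_quasi_iso (@ires_K_injective _ _ J) (@ires_K_injective _ _ J')
  (HomothetyIso h1 h2 h3) (HomothetyIso h1' h2' h3') qf qg pS fs gs ss sphi sl
  noethR finite_phi fJ fJ' mSpec_phi Pic_phi.
(* The coroof is C -> J -> J' <- C'. *)
apply: (coroof (u := ccomp al (ires_map J)) (u' := ires_map J')).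
  by apply: quasi_iso_comp => //; apply: ires_quasi_iso.
exact: ires_quasi_iso.
Qed.
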